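(* Let $a>0$, let $(k_n)$ be positive integers with $\tfrac{k_n}{\log n}\to a$ as $n\to\infty$, let $0<\beta<1$, and let $\theta\neq 0$ be a real number in $\Theta$ with $\theta_a^-\le\theta\le\theta_a^+$. Consider the testing problem in which $$Y_{in}\sim_{\rm i.i.d.}(1-\epsilon_n)F_0^{k_n}+\epsilon_nF_\theta^{k_n},\qquad 1\le i\le n,$$ with $\epsilon_n=0$ under $H_0$ and $\epsilon_n=n^{-\beta}$ under $H_1$. If $\beta>b(\theta)$ then all test statistics are asymptotically powerless. If $\beta<b(\theta)$ then the higher criticism test statistic ${\rm HC}_n$ is asymptotically powerful.
   Context: Exponential family: $\{F_\theta\}_{\theta\in\Theta}$ are distributions on $\mathbb{R}$ with $dF_\theta(x)=e^{\theta x-\psi(\theta)}dF_0(x)$, where $e^{\psi(\theta)}=E_0e^{\theta X}$ ($X\sim F_0$) and $\Theta=\{\theta:\psi(\theta)<\infty\}$. $F^k$ denotes the $k$-fold convolution of $F$, i.e. the law of the sum of $k$ i.i.d. variables with distribution $F$. Rate function: $I(\nu)=\sup_{\theta\in\Theta}[\theta\nu-\psi(\theta)]$. Define $\mu_a^+=\sup\{\mu:I(\mu)\le a^{-1}\}$, $\mu_a^-=\inf\{\mu:I(\mu)\le a^{-1}\}$, and let $\theta_a^+>0$ (possibly $\infty$) and $\theta_a^-<0$ (possibly $-\infty$) satisfy $\mu_a^+=\lim_{\theta\to\theta_a^+}\psi'(\theta)$ and $\mu_a^-=\lim_{\theta\to\theta_a^-}\psi'(\theta)$. (When solutions exist these satisfy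 $\mu_a^\pm=\psi'(\theta_a^\pm)$ and $I(\mu_a^\pm)=a^{-1}$.) Phase transition curve: $$b(\theta)=\begin{cases}\tfrac12\{1+a[\psi(2\theta)-2\psi(\theta)]\}&\text{if }\tfrac12\theta_a^-\le\theta\le\tfrac12\theta_a^+,\\ a[\theta\mu_a^+-\psi(\theta)]&\text{if }\tfrac12\theta_a^+<\theta\le\theta_a^+,\\ a[\theta\mu_a^--\psi(\theta)]&\text{if }\theta_a^-\le\theta<\tfrac12\theta_a^-.\end{cases}$$ P-values: $p_i$ is the two-sided p-value of $Y_{in}$, that is, two times the upper or lower tail probability of $Y_{in}$ under $F_0^{k_n}$, whichever is smaller. When $F_0$ is discrete the p-values are randomized so that $p_i\sim{\rm Uniform}(0,1)$ under the $i$th null $Y_{in}\sim F_0^{k_n}$; concretely, $p_i=2\min(T_i,1-T_i)$ with $T_i=P_0(Y>Y_{in})+V_iP_0(Y=Y_{in})$ where $Y\sim F_0^{k_n}$ is taken independent of the data and $V_i$ are independent auxiliary Uniform$(0,1)$ variables. Higher criticism: with $p_{(1)}\le\cdots\le p_{(n)}$ the sorted p-values, $${\rm HC}_n=\max_{1\le i\le n/2}\frac{i-np_{(i)}}{\sqrt{np_{(i)}(1-p_{(i)})}}.$$ Risk: $P_0,P_1$ denote probability under $H_0,H_1$. For a test statistic $T$, ${\rm Risk}(T)=\inf_c[P_0(T\ge c)+P_1(T<c)]$; if $T$ is stochastically smaller under $H_1$ than under $H_0$, the inequalities are reversed. A sequence $T_n$ is asymptotically powerful if ${\rm Risk}(T_n)\to0$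 and asymptotically powerless if ${\rm Risk}(T_n)\to1$ as $n\to\infty$. *)

(* Defs.v *)
From HB Require Import structures.
From mathcomp Require Import all_boot all_order all_algebra.
From mathcomp Require Import interval_inference.
From mathcomp Require Import all_classical all_reals all_analysis.

Set Implicit Arguments.
Unset Strict Implicit.
Unset Printing Implicit Defensive.
Import Order.TTheory GRing.Theory Num.Theory.
Import numFieldNormedType.Exports.

Local Open Scope classical_set_scope.
Local Open Scope ring_scope.

Section iid.
Context d (T : measurableType d) (R : realType).

Definition cons_pair n (x : T * n.-tuple T) : n.+1.-tuple T :=
  [the n.+1.-tuple T of x.1 :: x.2].

Lemma measurable_cons_pair n : measurable_fun [set: T * n.-tuple T] (@cons_pair n).
Proof. by apply: measurable_cons; [exact: measurable_fst|exact: measurable_snd]. Qed.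

HB.instance Definition _ n :=
  isMeasurableFun.Build _ _ _ _ (@cons_pair n) (@measurable_cons_pair n).

Fixpoint iid (P : probability T R) (n : nat) : probability (n.-tuple T) R :=
  match n with
  | 0 => (\d_[tuple])%R
  | n'.+1 => distribution (P \x iid P n')%E (@cons_pair n')
  end.

End iid.

Section convolution.
Context (R : realType).

Definition tuple_sum n (x : n.-tuple (measurableTypeR R)) : measurableTypeR R :=
  \sum_(i < n) tnth x i.

Lemma measurable_tuple_sum n :
  measurable_fun [set: n.-tuple (measurableTypeR R)] (@tuple_sum n).
Proof. by apply: measurable_sum => i; exact: measurable_tnth. Qed.

HB.instance Definition _ n :=
  isMeasurableFun.Build _ _ _ _ (@tuple_sum n) (@measurable_tuple_sum n).

Definition convn (P : probability (measurableTypeR R) R) (k : nat) :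
    probability (measurableTypeR R) R :=
  distribution (iid P k) (@tuple_sum k).

End convolution.

Section mixture.
Context d (T : measurableType d) (R : realType).
Variables (e : {i01 R}) (P Q : probability T R).

Definition mixture : set T -> \bar R :=
  measure_add (mscale (1 - e%:num)%:nng P) (mscale (e%:num)%:nng Q).

HB.instance Definition _ := Measure.on mixture.

Let mixture_setT : mixture [set: T] = 1%E.
Proof.
rewrite /mixture measure_addE /= /mscale /= !probability_setT !mule1.
by rewrite -EFinD subrK.
Qed.

HB.instance Definition _ := Measure_isProbability.Build _ _ _ mixture mixture_setT.

End mixture.

Section exponential_family.
Context (R : realType) (F0 : probability (measurableTypeR R) R).
Local Open Scope ereal_scope.

Definition psi (t : R) : \bar R :=
  lne (mmt_gen_fun F0 (id : measurableTypeR R -> R) t).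

Definition Theta : set R := [set t | psi t < +oo].

(* only meaningful in the interior of [Theta] *)
Definition dpsi : R -> R := derive1 (fun t => fine (psi t)).

Definition rate (nu : R) : \bar R :=
  ereal_sup [set (t * nu)%:E - psi t | t in Theta].

Definition mu_plus (a : R) : \bar R :=
  ereal_sup [set m%:E | m in [set m | rate m <= (a^-1)%:E]].

Definition mu_minus (a : R) : \bar R :=
  ereal_inf [set m%:E | m in [set m | rate m <= (a^-1)%:E]].

(* The limit of [dpsi] is taken from inside [Theta], so that the endpoint may be
   infinite or lie on the boundary of [Theta]. *)
Definition is_theta_plus (a : R) (tp : \bar R) : Prop :=
  [/\ 0 < tp,
      forall t : R, (0 < t)%R -> t%:E < tp -> Theta t &
      match tp with
      | t%:E => (dpsi s)%:E @[s --> t^'-] --> mu_plus a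
      | +oo => (dpsi s)%:E @[s --> +oo%R] --> mu_plus a
      | -oo => False
      end].

Definition is_theta_minus (a : R) (tm : \bar R) : Prop :=
  [/\ tm < 0,
      forall t : R, (t < 0)%R -> tm < t%:E -> Theta t &
      match tm with
      | t%:E => (dpsi s)%:E @[s --> t^'+] --> mu_minus a
      | -oo => (dpsi s)%:E @[s --> -oo%R] --> mu_minus a
      | +oo => False
      end].

(* Used only for [tm <= t <= tp]: the last branch is [tm <= t < tm / 2]. *)
Definition phase_curve (a : R) (tm tp : \bar R) (t : R) : \bar R :=
  if (2^-1)%:E * tm <= t%:E <= (2^-1)%:E * tp then
    (2^-1)%:E * (1 + a%:E * (psi (2 * t)%R - 2%:E * psi t))
  else if (2^-1)%:E * tp < t%:E <= tp then
    a%:E * (t%:E * mu_plus a - psi t)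
  else
    a%:E * (t%:E * mu_minus a - psi t).

End exponential_family.

Definition exponential_family (R : realType)
    (F : R -> probability (measurableTypeR R) R) : Prop :=
  forall t : R, Theta (F 0) t ->
  forall A : set (measurableTypeR R), measurable A ->
  F t A = (\int[F 0%R]_(x in A) (expR (t * x - fine (psi (F 0%R) t)))%:E)%E.

Section testing.
Context (R : realType).

(* An observation [(Y, V)] carries the auxiliary uniform variable [V] that
   randomizes the p-values. *)
Definition obs := (measurableTypeR R * measurableTypeR R)%type.

(* joint law of the [n] independent observations, [Y] having law
   [(1 - e) F0^k + e F1^k] *)
Definition data_law (F0 F1 : probability (measurableTypeR R) R)
    (k n : nat) (e : {i01 R}) : probability (n.-tuple obs) R :=
  iid (mixture e (convn F0 k) (convn F1 k) \x uniform_prob (@ltr01 R))%E n.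

Definition pvalue (G : probability (measurableTypeR R) R) (x : obs) : R :=
  let t := fine (G [set y | x.1 < y]) + x.2 * fine (G [set x.1]) in
  2 * Num.min t (1 - t).

(* [hc_term i] uses the [i]-th smallest p-value, with [i] counted from 1; the
   default value of the maximum matters only for [n < 2]. *)
Definition HC (G : probability (measurableTypeR R) R) (n : nat)
    (x : n.-tuple obs) : R :=
  let p := sort <=%R [seq pvalue G xi | xi <- x] in
  let hc_term i := (i%:R - n%:R * p`_(i.-1))
                   / Num.sqrt (n%:R * p`_(i.-1) * (1 - p`_(i.-1))) in
  \big[Num.max/hc_term 1%N]_(1 <= i < n./2.+1) hc_term i.

Context d (T : measurableType d).
Local Open Scope ereal_scope.

Definition stoch_smaller (P1 P0 : probability T R) (S : T -> R) : Prop :=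
  forall c : R, P1 [set x | (c <= S x)%R] <= P0 [set x | (c <= S x)%R].

Definition risk (P0 P1 : probability T R) (S : T -> R) : \bar R :=
  if `[< stoch_smaller P1 P0 S >] then
    ereal_inf [set P0 [set x | (S x <= c)%R] + P1 [set x | (c < S x)%R]
              | c in [set: R]]
  else
    ereal_inf [set P0 [set x | (c <= S x)%R] + P1 [set x | (S x < c)%R]
              | c in [set: R]].

End testing.

Definition asymptotically_powerful (R : realType)
    (P0 P1 : forall n, probability (n.-tuple (obs R)) R)
    (S : forall n, n.-tuple (obs R) -> R) : Prop :=
  (risk (P0 n) (P1 n) (S n) @[n --> \oo] --> 0)%E.

Definition asymptotically_powerless (R : realType)
    (P0 P1 : forall n, probability (n.-tuple (obs R)) R)
    (S : forall n, n.-tuple (obs R) -> R) : Prop :=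
  (risk (P0 n) (P1 n) (S n) @[n --> \oo] --> 1)%E.

(* Main.v *)
Require Import Defs.
From HB Require Import structures.
From mathcomp Require Import all_boot all_order all_algebra.
From mathcomp Require Import interval_inference.
From mathcomp Require Import all_classical all_reals all_analysis.
From mathcomp Require Import ring lra zify.
Import Order.TTheory GRing.Theory Num.Theory.
Import numFieldNormedType.Exports.
Local Open Scope classical_set_scope.
Local Open Scope ring_scope.
From mathcomp Require Import measurable_realfun.

(** Since [k n] is about [a ln n], a probability [expR (- c (k n))] is about
[n] to the power [- a c], and the theorem is a comparison of such exponents.
Write psi for the cumulant function and l for the likelihood ratio of the
k-fold convolution of F_theta to that of F_0.

Undetectable side.  For every region the two error probabilities add up to at
least the null mean of min (1, L), whenever L is dominated by the likelihood
ratio of the alternative.  Take for L the product over the observations of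
1 - eps + eps l 1_B, with a truncation set B.  Two moments of L suffice
([two_point_bound]), and the sum of errors tends to 1 as soon as the expected
number n eps F_theta^k(~B) of discarded signals and the quantity
n eps^2 E_0 [l^2 1_B] both vanish ([truncated_powerless]).  With B the whole
line the second condition is 1 - 2 beta + a (psi (2 theta) - 2 psi theta) < 0,
which is the first branch of the curve.  Otherwise B is the half-line
theta y <= theta k mu with mu = mu_a^+ or mu_a^-, and Chernoff's inequality at
s = theta_a^+ or theta_a^-, which lies between theta and 2 theta, bounds both
quantities, because s mu - psi s >= 1/a ([critical_rate]); both exponents come
out as multiples of a (theta mu - psi theta) - beta.

Detectable side.  Take s in the interior of the parameter set, on the same side
of 0 as theta: s = 2 theta when this is inside the critical range, and s just
short of the critical parameter otherwise ([detection_exponents]).  The sum of k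
variables from F_s concentrates at k psi'(s).  By Chernoff's inequality the
half-line starting just before that point has null probability at most about
n^(-q), so observations there have p-values at most t, about 2 n^(-q)
([pvalue_far]); by a change of measure from F_s to F_theta its probability under
F_theta is at least about n^(-r) ([far_mass]).  The number of p-values below t
exceeds its null mean n t by about n^(1 - beta - r), against a null standard
deviation of about n^((1 - q)/2), and the ratio is a positive power of n
exactly when beta < (1 + q)/2 - r.  The higher criticism is then above
8 ln n, a level it exceeds with vanishing probability under the null, where the
p-values are uniform ([pvalue_uniform], [HC_null_vanishes]).

The comparison of beta with the phase curve is turned into these two kinds of
exponents in [phase_curve_lt] and [phase_curve_gt].  Only the endpoints of the
critical range need care: psi is lower semicontinuous, so a finite critical
parameter belongs to the parameter set, but psi need not be differentiable
there.  Negative theta is reduced to positive theta by reflection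
([cumulant_opp]). *)

Set Implicit Arguments.
Unset Strict Implicit.
Unset Printing Implicit Defensive.

(** * Integrals against product laws *)

Section iid_integral.
Local Open Scope ereal_scope.
Context d (T : measurableType d) (R : realType).
Implicit Types (P Q : probability T R).

Lemma integral_iidS P n (f : n.+1.-tuple T -> \bar R) :
  measurable_fun setT f -> (forall x, 0 <= f x) ->
  \int[iid P n.+1]_x f x = \int[P]_x \int[iid P n]_y f (cons_pair (x, y)).
Proof.
move=> mf f0.
rewrite /= ge0_integral_distribution//.
rewrite fubini_tonelli1//; last by move=> x /=; exact: f0.
by apply: measurableT_comp => //; exact: measurable_cons_pair.
Qed.

Lemma measurable_cons_pair1 n (x : T) (f : n.+1.-tuple T -> \bar R) :
  measurable_fun setT f -> measurable_fun setT (fun y => f (cons_pair (x, y))).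
Proof.
move=> mf; apply: (measurableT_comp mf).
apply: (@measurableT_comp _ _ _ _ _ _ (@cons_pair _ T n) _ (fun y => (x, y))).
  exact: measurable_cons_pair.
exact: pair1_measurable.
Qed.

Lemma measurable_fun_integral_iid P n (f : n.+1.-tuple T -> \bar R) :
  measurable_fun setT f -> (forall x, 0 <= f x) ->
  measurable_fun setT (fun x => \int[iid P n]_y f (cons_pair (x, y))).
Proof.
move=> mf f0.
apply: (@measurable_fun_fubini_tonelli_F _ _ _ _ _ (iid P n) (f \o @cons_pair _ T n)).
  apply: measurableT_comp => //; exact: measurable_cons_pair.
by move=> x /=; exact: f0.
Qed.

Lemma integral_iid0 P (f : 0.-tuple T -> \bar R) :
  \int[iid P 0]_x f x = f [tuple].
Proof.
rewrite (eq_integral (fun=> f [tuple])); last by move=> x _; rewrite (tuple0 x).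
by rewrite integral_cst//= diracT mule1.
Qed.

Lemma tnth_cons_pair0 n (x : T) (y : n.-tuple T) :
  tnth (cons_pair (x, y)) ord0 = x.
Proof. by rewrite (tnth_nth x). Qed.

Lemma tnth_cons_pairS n (x : T) (y : n.-tuple T) i :
  tnth (cons_pair (x, y)) (lift ord0 i) = tnth y i.
Proof. by rewrite !(tnth_nth x). Qed.

Lemma prod_cons_pair n (h : T -> R) (x : T) (y : n.-tuple T) :
  (\prod_(i < n.+1) h (tnth (cons_pair (x, y)) i) =
   h x * \prod_(i < n) h (tnth y i))%R.
Proof.
rewrite big_ord_recl tnth_cons_pair0; congr (_ * _)%R.
by apply: eq_bigr => i _; rewrite tnth_cons_pairS.
Qed.

Lemma measurable_prod_tnth n (h : T -> R) : measurable_fun setT h ->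
  measurable_fun [set: n.-tuple T] (fun x => \prod_(i < n) h (tnth x i))%R.
Proof.
move=> mh; apply: measurable_prod => i _.
by apply: measurableT_comp => //; exact: measurable_tnth.
Qed.

Lemma integral_iid_prod P n (h : T -> R) :
  measurable_fun setT h -> (forall x, 0 <= h x)%R ->
  \int[iid P n]_x (\prod_(i < n) h (tnth x i))%:E =
  (\int[P]_x (h x)%:E) ^+ n.
Proof.
move=> mh h0; elim: n => [|n IH].
  by rewrite integral_iid0 big_ord0 expe0.
rewrite [RHS]expeS integral_iidS; last 2 first.
- by apply/measurable_EFinP; exact: measurable_prod_tnth.
- by move=> x; rewrite lee_fin prodr_ge0.
under eq_integral => x _.
  under eq_integral => y _ do rewrite prod_cons_pair EFinM.
  rewrite ge0_integralZl//; last 3 first.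
  - by apply/measurable_EFinP; exact: measurable_prod_tnth.
  - by move=> y _; rewrite lee_fin prodr_ge0.
  - by rewrite lee_fin.
  rewrite IH; over.
rewrite /= ge0_integralZr//; last 3 first.
- exact/measurable_EFinP.
- by move=> x _; rewrite lee_fin.
- by apply: expe_ge0; apply: integral_ge0 => x _; rewrite lee_fin.
Qed.

(** Domination tensorizes one coordinate at a time.  It is expressed by an
inequality of integrals and not by an equality of densities, so that [h] may be
a truncated likelihood ratio, of total mass less than 1. *)
Lemma integral_iid_density P Q n (h : T -> R) (f : n.-tuple T -> \bar R) :
  measurable_fun setT h -> (forall x, 0 <= h x)%R ->
  (forall g : T -> \bar R, measurable_fun setT g -> (forall x, 0 <= g x) ->
     \int[P]_x (g x * (h x)%:E) <= \int[Q]_x g x) ->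
  measurable_fun setT f -> (forall x, 0 <= f x) ->
  \int[iid P n]_x (f x * (\prod_(i < n) h (tnth x i))%:E) <= \int[iid Q n]_x f x.
Proof.
move=> mh h0 hPQ; elim: n f => [|n IH] f mf f0.
  by rewrite !integral_iid0 big_ord0 mule1.
have mp : measurable_fun setT
    (fun x : n.-tuple T => (\prod_(i < n) h (tnth x i))%:E).
  by apply/measurable_EFinP; exact: measurable_prod_tnth.
have p0 m (x : m.-tuple T) : 0 <= (\prod_(i < m) h (tnth x i))%:E.
  by rewrite lee_fin prodr_ge0.
rewrite !integral_iidS//; last 2 first.
- apply: emeasurable_funM => //.
  by apply/measurable_EFinP; exact: measurable_prod_tnth.
- by move=> x; rewrite mule_ge0.
set G := fun x => \int[iid Q n]_y f (cons_pair (x, y)).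
have mG : measurable_fun setT G by exact: measurable_fun_integral_iid.
have G0 x : 0 <= G x by apply: integral_ge0.
apply: le_trans (hPQ G mG G0).
apply: ge0_le_integral => //.
- move=> x _; apply: integral_ge0 => y _; by rewrite mule_ge0.
- apply: (@measurable_fun_integral_iid P n (fun x => f x * (\prod_(i < n.+1) h (tnth x i))%:E)).
  apply: emeasurable_funM => //.
    by apply/measurable_EFinP; exact: measurable_prod_tnth.
  by move=> x; rewrite mule_ge0.
- apply: emeasurable_funM => //; exact/measurable_EFinP.
move=> x _.
have mfx := measurable_cons_pair1 x mf.
under eq_integral => y _ do rewrite prod_cons_pair EFinM muleCA.
rewrite ge0_integralZl//; last 3 first.
- exact: emeasurable_funM.
- by move=> y _; rewrite mule_ge0.
- by rewrite lee_fin.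
rewrite [leRHS]muleC; apply: lee_wpmul2l; first by rewrite lee_fin.
exact: IH.
Qed.

End iid_integral.

(** * Densities, and Chernoff bounds for the number of hits *)

Section measure_tools.
Local Open Scope ereal_scope.
Context d (T : measurableType d) (R : realType).
Implicit Types (P Q : probability T R).

Lemma measure_le_integral P A (g : T -> R) :
  measurable A -> measurable_fun setT g -> (forall x, 0 <= g x)%R ->
  (forall x, A x -> 1 <= g x)%R -> P A <= \int[P]_x (g x)%:E.
Proof.
move=> mA mg g0 g1.
rewrite -[leLHS]mul1e -(integral_cst P mA 1).
apply: (@le_trans _ _ (\int[P]_(x in A) (g x)%:E)).
  apply: ge0_le_integral => //.
  - by apply/measurable_EFinP; exact: measurable_funTS.
apply: ge0_subset_integral => //; first exact/measurable_EFinP.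
by move=> x _; rewrite lee_fin.
Qed.

Lemma measurable_set_ler (f g : T -> R) : measurable_fun setT f ->
  measurable_fun setT g -> measurable [set x | (f x <= g x)%R].
Proof.
move=> mf mg; have := measurable_fun_ler mf mg measurableT (Y := [set true]).
by rewrite setTI; apply.
Qed.

Lemma measurable_set_ltr (f g : T -> R) : measurable_fun setT f ->
  measurable_fun setT g -> measurable [set x | (f x < g x)%R].
Proof.
move=> mf mg; have := measurable_fun_ltr mf mg measurableT (Y := [set true]).
by rewrite setTI; apply.
Qed.

Import HBNNSimple.

(** Monotone convergence along simple functions: a density that is specified on
sets only, as in an exponential family, computes all nonnegative integrals. *)
Lemma integral_density P Q (h : T -> R) :
  measurable_fun setT h -> (forall x, 0 <= h x)%R ->
  (forall A, measurable A -> Q A = \int[P]_(x in A) (h x)%:E) ->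
  forall g : T -> \bar R, measurable_fun setT g -> (forall x, 0 <= g x) ->
  \int[Q]_x g x = \int[P]_x (g x * (h x)%:E).
Proof.
move=> mhR h0R QP g mg g0.
have mh : measurable_fun setT (fun x => (h x)%:E) by exact/measurable_EFinP.
have h0 x : 0 <= (h x)%:E by rewrite lee_fin.
pose g_ := nnsfun_approx measurableT mg.
have gcvg x : (g_ n x)%:E @[n --> \oo] --> g x.
  by apply: cvg_nnsfun_approx => // y _; exact: g0.
have gnd x : {homo (fun n => (g_ n x)%:E) : m n / (m <= n)%N >-> m <= n}.
  by move=> m n mn; rewrite lee_fin; exact/lefP/nd_nnsfun_approx.
transitivity (limn (fun n => \int[Q]_x (g_ n x)%:E)).
  rewrite -monotone_convergence//=.
  - by apply: eq_integral => x _; apply/esym/cvg_lim => //; exact: gcvg.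
  - by move=> n; exact/measurable_EFinP.
  - by move=> n x _; rewrite lee_fin.
transitivity (limn (fun n => \int[P]_x ((g_ n x)%:E * (h x)%:E))); last first.
  rewrite -monotone_convergence//=.
  - apply: eq_integral => x _; apply/cvg_lim => //.
    exact: cvgeZr.
  - by move=> n; apply: emeasurable_funM => //; exact/measurable_EFinP.
  - by move=> n x _; rewrite mule_ge0// lee_fin.
  - move=> x _ m n mn; apply: lee_wpmul2r => //; exact: gnd.
congr (limn _); apply/funext => n.
rewrite integralT_nnsfun.
rewrite (eq_integral (fun x => \sum_(r \in range (g_ n))
  (r%:E * (\1_(g_ n @^-1` [set r]) x)%:E * (h x)%:E))); last first.
  move=> x _; rewrite [in LHS]fimfunE -fsumEFin// ge0_mule_fsuml//.
  by move=> r; exact: nnfun_muleindic_ge0.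
rewrite ge0_integral_fsum//; last 2 first.
- move=> r; apply: emeasurable_funM => //; apply/measurable_EFinP.
  by do 2 apply/measurableT_comp => //.
- by move=> r x _; rewrite mule_ge0// nnfun_muleindic_ge0.
rewrite sintegralE; apply: eq_fsbigr => r /[!inE]/= -[x _ <-].
set A := _ @^-1` _.
have mA : measurable A by exact: measurable_funPTI.
rewrite QP//.
under [RHS]eq_integral => y _ do rewrite -muleA.
rewrite ge0_integralZl//; last 3 first.
- apply: emeasurable_funM => //; apply/measurable_EFinP.
  exact: measurable_indic.
- by move=> y _; rewrite mule_ge0// lee_fin.
- by rewrite lee_fin.
congr (_ * _); rewrite [LHS]integral_mkcond; apply: eq_integral => y _.
rewrite patchE indicE; case: ifPn => _; first by rewrite mul1e.
by rewrite mul0e.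
Qed.

End measure_tools.

Section occupancy.
Local Open Scope ereal_scope.
Context d (T : measurableType d) (R : realType).

Definition hits n (A : set T) (x : n.-tuple T) : R :=
  (\sum_(i < n) \1_A (tnth x i))%R.

Lemma measurable_hits n A : measurable A -> measurable_fun setT (@hits n A).
Proof.
move=> mA; apply: measurable_sum => i; apply: measurableT_comp.
  exact: measurable_indic.
exact: measurable_tnth.
Qed.

Lemma integral_expR_indic (P : probability T R) A (lam : R) : measurable A ->
  \int[P]_x (expR (lam * \1_A x))%:E =
  (1 + (expR lam - 1) * fine (P A))%R%:E.
Proof.
move=> mA.
have PAf : P A \is a fin_num by exact: fin_num_measure.
have e0 : (0 <= expR lam)%R := expR_ge0 _.
rewrite (eq_integral (fun x => (expR lam)%:E * (\1_A x)%:E + (\1_(~` A) x)%:E)); last first.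
  move=> x _; rewrite !indicE in_setC.
  by case: (x \in A); rewrite /= ?mulr1 ?mulr0 ?expR0 -EFinM -EFinD ?mulr1 ?mulr0 ?addr0 ?add0r.
have mI (B : set T) : measurable B -> measurable_fun setT (fun x => (\1_B x : R)%:E).
  by move=> mB; apply/measurable_EFinP; exact: measurable_indic.
rewrite ge0_integralD//; last 2 first.
- by apply: emeasurable_funM => //; exact: mI.
- by apply: mI; exact: measurableC.
rewrite ge0_integralZl//; last exact: mI.
rewrite !integral_indic ?setIT//; last exact: measurableC.
rewrite [X in _ + X](_ : _ = 1 - P A); last exact: probability_setC.
transitivity ((expR lam)%:E * (fine (P A))%:E + (1 - (fine (P A))%:E)).
  by rewrite fineK.
rewrite -EFinM -EFinB -EFinD.
by congr (_%:E); ring.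
Qed.

(** The bound has Poisson form because [1 + p (expR lam - 1)] is at most
[expR (p (expR lam - 1))].  Positive [lam] gives the upper tail of the number of
hits and negative [lam] the lower tail. *)
Lemma hits_chernoff (P : probability T R) n A (lam c : R) : measurable A ->
  iid P n [set x | (lam * c <= lam * hits A x)%R] <=
  (expR (n%:R * (fine (P A) * (expR lam - 1)) - lam * c))%:E.
Proof.
move=> mA.
pose g x := (expR (- (lam * c)) * \prod_(i < n) expR (lam * \1_A (tnth x i)))%R.
have mp : measurable_fun [set: n.-tuple T]
    (fun x => \prod_(i < n) expR (lam * \1_A (tnth x i)))%R.
  apply: (@measurable_prod_tnth _ _ _ n (fun x => expR (lam * \1_A x)%R)).
  apply: measurableT_comp => //; apply: measurable_funM => //.
apply: (@le_trans _ _ (\int[iid P n]_x (g x)%:E)).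
  apply: measure_le_integral.
  - apply: measurable_set_ler => //.
    by apply: measurable_funM => //; exact: measurable_hits.
  - exact: measurable_funM.
  - move=> x; rewrite mulr_ge0 ?expR_ge0// prodr_ge0// => i _; exact: expR_ge0.
  - move=> x /= cx; rewrite /g -expR_sum -mulr_sumr -expRD.
    by rewrite -expR0 ler_expR addrC subr_ge0.
rewrite /g; under eq_integral do rewrite EFinM.
rewrite ge0_integralZl//; last 2 first.
- exact/measurable_EFinP.
- by move=> x _; rewrite lee_fin prodr_ge0// => i _; exact: expR_ge0.
rewrite (@integral_iid_prod _ _ _ P n (fun x => expR (lam * \1_A x))); last 2 first.
- apply: measurableT_comp => //; exact: measurable_funM.
- by move=> x; exact: expR_ge0.
rewrite integral_expR_indic// -EFin_expe -EFinM lee_fin addrC expRD [leRHS]mulrC.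
apply: ler_wpM2l; first exact: expR_ge0.
rewrite expRM_natl lerXn2r ?nnegrE ?expR_ge0//.
  have : (0 <= fine (P A) <= 1)%R.
    rewrite fine_ge0//= -lee_fin fineK ?fin_num_measure//; exact: probability_le1.
  move=> /andP[p0 p1]; have := expR_ge0 lam; nra.
by rewrite addrC mulrC expR_ge1Dx.
Qed.

End occupancy.

(** * The log-Laplace transform and exponential tilting *)

Section positive_integral.
Local Open Scope ereal_scope.
Context d (T : measurableType d) (R : realType).

Lemma integral_eq0_null (P : probability T R) (f : T -> R) :
  measurable_fun setT f -> (forall x, 0 <= f x)%R ->
  \int[P]_x (f x)%:E = 0 -> P [set x | (0 < f x)%R] = 0.
Proof.
move=> mf f0 I0.
have mf' : measurable_fun setT (fun x => (f x)%:E) by exact/measurable_EFinP.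
have : \int[P]_x `|(f x)%:E| = 0.
  by rewrite -[RHS]I0; apply: eq_integral => x _; rewrite gee0_abs// lee_fin.
move/(ae_eq_integral_abs P measurableT mf') => -[N [mN N0 fN]].
apply: (subset_measure0 _ mN) => //.
- by apply: (@measurable_set_ltr _ _ _ (cst 0%R) f).
move=> x /= fx; apply: fN => /= /(_ I) [] fx0.
by move: fx; rewrite fx0 ltxx.
Qed.
End positive_integral.

Section log_mgf.
Local Open Scope ereal_scope.
Context (R : realType) (P : probability (measurableTypeR R) R).

Definition lpsi (t : R) : R := fine (psi P t).

Lemma measurable_expR_mul (t : R) :
  measurable_fun [set: measurableTypeR R] (fun x : R => expR (t * x)).
Proof. by apply: measurableT_comp => //; exact: measurable_funM. Qed.

Lemma mmt_gen_funE t :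
  mmt_gen_fun P (id : measurableTypeR R -> R) t = \int[P]_x (expR (t * x))%:E.
Proof.
rewrite /mmt_gen_fun unlock; apply: eq_integral => x _ /=.
by rewrite mulrC.
Qed.

Lemma mgf_gt0 t : 0 < \int[P]_x (expR (t * x))%:E.
Proof.
rewrite lt0e integral_ge0 ?andbT; last by move=> x _; rewrite lee_fin expR_ge0.
apply/eqP => /(integral_eq0_null (measurable_expR_mul t)).
have -> : [set x : measurableTypeR R | (0 < expR (t * x))%R] = setT.
  by apply/seteqP; split => // x _ /=; rewrite expR_gt0.
rewrite probability_setT => /(_ (fun x => expR_ge0 _)) /eqP.
by rewrite onee_eq0.
Qed.

Lemma psi_neqNy t : psi P t != -oo.
Proof.
rewrite /psi mmt_gen_funE; have := mgf_gt0 t.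
by case: integral => [r| |] // r0; rewrite lne_EFin.
Qed.

Lemma psi_fin t : Theta P t -> psi P t = (lpsi t)%:E.
Proof.
move=> Tt; rewrite /lpsi fineK// fin_numE psi_neqNy/=.
by apply/eqP => e; move: Tt; rewrite /Theta/= e ltxx.
Qed.

Lemma mgf_lpsi t : Theta P t ->
  \int[P]_x (expR (t * x))%:E = (expR (lpsi t))%:E.
Proof.
move=> /psi_fin; rewrite /psi mmt_gen_funE; have := mgf_gt0 t.
case: integral => [r| |] //; rewrite lte_fin => r0.
by rewrite lne_EFin// => -[<-]; rewrite lnK.
Qed.

Lemma mgf_ThetaP t : Theta P t <-> \int[P]_x (expR (t * x))%:E < +oo.
Proof.
split=> [/mgf_lpsi ->|]; first exact: ltry.
rewrite /Theta /= /psi mmt_gen_funE; have := mgf_gt0 t.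
by case: integral => [r| |] // r0 _; rewrite lne_EFin// ltry.
Qed.

(** A bound on the integral also yields membership in the parameter set, so
limits can be taken without knowing beforehand that they stay inside it. *)
Lemma mgf_le_lpsi t (u : R) : \int[P]_x (expR (t * x))%:E <= (expR u)%:E ->
  Theta P t /\ (lpsi t <= u)%R.
Proof.
move=> tu; have Tt : Theta P t.
  by apply/mgf_ThetaP; apply: (le_lt_trans tu); exact: ltry.
by split => //; move: tu; rewrite mgf_lpsi// lee_fin ler_expR.
Qed.

Lemma psi0 : psi P 0%R = 0.
Proof.
rewrite /psi mmt_gen_funE.
under eq_integral do rewrite mul0r expR0.
by rewrite integral_cst// mul1e [X in lne X]probability_setT lne1.
Qed.

Lemma Theta0 : Theta P 0%R.
Proof. by rewrite /Theta/= psi0 ltry. Qed.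

Lemma lpsi0 : lpsi 0%R = 0%R.
Proof. by rewrite /lpsi psi0. Qed.

End log_mgf.

Section exponential_tilting.
Local Open Scope ereal_scope.
Context (R : realType) (F : R -> probability (measurableTypeR R) R).
Hypothesis expfamF : exponential_family F.
Local Notation Theta := (Theta (F 0%R)).
Local Notation ps := (lpsi (F 0%R)).
Local Notation T := (measurableTypeR R).

Lemma measurable_tilt (a b : R) : measurable_fun [set: T] (fun x : R => expR (a * x - b)).
Proof.
by apply: measurableT_comp => //; apply: measurable_funB => //; exact: measurable_funM.
Qed.

Lemma integral_expfam t (g : T -> \bar R) : Theta t -> measurable_fun setT g ->
  (forall x, 0 <= g x) ->
  \int[F t]_x g x = \int[F 0%R]_x (g x * (expR (t * x - ps t))%:E).
Proof.
move=> Tt mg g0.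
apply: (@integral_density _ T R (F 0%R) (F t) (fun x => expR (t * x - ps t))) => //.
- exact: measurable_tilt.
- by move=> A mA; rewrite expfamF.
Qed.

(** Any member of the family can serve as the base point. *)
Lemma integral_tilt s t (g : T -> \bar R) : Theta s -> Theta t ->
  measurable_fun setT g -> (forall x, 0 <= g x) ->
  \int[F s]_x (g x * (expR ((t - s) * x - (ps t - ps s)))%:E) = \int[F t]_x g x.
Proof.
move=> Ts Tt mg g0.
have mh : measurable_fun setT
    (fun x : T => g x * (expR ((t - s) * x - (ps t - ps s)))%:E).
  by apply: emeasurable_funM => //; apply/measurable_EFinP; exact: measurable_tilt.
have h0 x : 0 <= g x * (expR ((t - s) * x - (ps t - ps s)))%:E.
  by rewrite mule_ge0// lee_fin expR_ge0.
rewrite [RHS](integral_expfam Tt mg g0) [LHS](integral_expfam Ts mh h0).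
apply: eq_integral => x _; rewrite -muleA -EFinM -expRD.
by congr (_ * (expR _)%:E); ring.
Qed.

Lemma prod_tilt k (a b : R) (x : k.-tuple T) :
  (\prod_(i < k) expR (a * tnth x i - b) =
   expR (a * tuple_sum x - k%:R * b))%R.
Proof.
rewrite -expR_sum; congr expR.
by rewrite big_split/= -mulr_sumr sumr_const card_ord /tuple_sum mulr_natl mulNrn.
Qed.

Lemma integral_convn (P : probability T R) k (g : T -> \bar R) :
  measurable_fun setT g -> (forall x, 0 <= g x) ->
  \int[convn P k]_y g y = \int[iid P k]_x g (tuple_sum x).
Proof. by move=> mg g0; rewrite /convn ge0_integral_distribution. Qed.

(** The tilting factors multiply to a function of the sum alone, so the
convolutions form an exponential family again. *)
Lemma convn_tilt s t k (g : T -> \bar R) : Theta s -> Theta t ->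
  measurable_fun setT g -> (forall x, 0 <= g x) ->
  \int[convn (F s) k]_y (g y * (expR ((t - s) * y - k%:R * (ps t - ps s)))%:E)
  <= \int[convn (F t) k]_y g y.
Proof.
move=> Ts Tt mg g0.
rewrite !integral_convn//; last 2 first.
- apply: emeasurable_funM => //; apply/measurable_EFinP; exact: measurable_tilt.
- by move=> x; rewrite mule_ge0// lee_fin expR_ge0.
under eq_integral do rewrite -prod_tilt.
apply: (@integral_iid_density _ _ _ (F s) (F t) k
  (fun x => expR ((t - s) * x - (ps t - ps s)))%R (g \o @tuple_sum R k)) => //.
- exact: measurable_tilt.
- by move=> g' mg' g'0; rewrite integral_tilt.
- by apply: measurableT_comp => //; exact: measurable_tuple_sum.
- by move=> x; exact: g0.
Qed.

Lemma convn_mgf s t k : Theta s -> Theta t ->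
  \int[convn (F s) k]_y (expR ((t - s) * y))%:E =
  (expR (k%:R * (ps t - ps s)))%:E.
Proof.
move=> Ts Tt.
rewrite integral_convn//; last first.
  by apply/measurable_EFinP; exact: measurable_expR_mul.
rewrite (eq_integral (fun x : k.-tuple T => (\prod_(i < k) expR ((t - s) * tnth x i))%:E)); last first.
  by move=> x _; rewrite -expR_sum /tuple_sum -mulr_sumr.
rewrite (@integral_iid_prod _ T R (F s) k (fun x => expR ((t - s) * x))); last 2 first.
- exact: measurable_expR_mul.
- by move=> x; exact: expR_ge0.
rewrite expRM_natl EFin_expe; congr (_ ^+ _).
rewrite integral_expfam//; last first.
  by apply/measurable_EFinP; exact: measurable_expR_mul.
rewrite (eq_integral (fun x : T => (expR (- ps s))%:E * (expR (t * x))%:E)); last first.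
  by move=> x _; rewrite -!EFinM -!expRD; congr (expR _)%:E; ring.
rewrite ge0_integralZl//; last first.
  by apply/measurable_EFinP; exact: measurable_expR_mul.
by rewrite mgf_lpsi// -EFinM -expRD addrC.
Qed.

Lemma convn_mgf_sub s t k (c : R) : Theta s -> Theta t ->
  \int[convn (F s) k]_y (expR ((t - s) * y - c))%:E =
  (expR (k%:R * (ps t - ps s) - c))%:E.
Proof.
move=> Ts Tt.
rewrite (eq_integral (fun x : T => (expR (- c))%:E * (expR ((t - s) * x))%:E)); last first.
  by move=> x _; rewrite -EFinM -expRD addrC.
rewrite ge0_integralZl//; last first.
  by apply/measurable_EFinP; exact: measurable_expR_mul.
by rewrite convn_mgf// -EFinM -expRD addrC.
Qed.

(** Markov's inequality for the tilting factor; the sign of [t - s] selects the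
tail that is bounded. *)
Lemma convn_chernoff s t k (c : R) : Theta s -> Theta t ->
  convn (F s) k [set y : R | (c <= (t - s) * y)%R] <=
  (expR (k%:R * (ps t - ps s) - c))%:E.
Proof.
move=> Ts Tt.
apply: (@le_trans _ _ (\int[convn (F s) k]_y (expR ((t - s) * y - c))%:E)).
  apply: measure_le_integral.
  - apply: (@measurable_set_ler _ T R (cst c) (fun y => (t - s) * y)%R) => //.
    exact: measurable_funM.
  - exact: measurable_tilt.
  - by move=> x; exact: expR_ge0.
  - by move=> x /= cx; rewrite -expR0 ler_expR subr_ge0.
by rewrite convn_mgf_sub.
Qed.

End exponential_tilting.

(** * Differentiation and convexity of the log-Laplace transform *)

Definition interior_pt (R : realType) (D : set R) (s : R) :=
  exists u v, [/\ D u, D v, u < s & s < v].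

Section mgf_derivative.
Context (R : realType) (P : probability (measurableTypeR R) R).
Local Notation Theta := (Theta P).
Local Notation ps := (lpsi P).
Local Notation T := (measurableTypeR R).

Lemma expR_mul_between (u w v x : R) : u <= w -> w <= v ->
  expR (w * x) <= expR (u * x) + expR (v * x).
Proof.
move=> uw wv; have [x0|x0] := leP 0 x.
  apply: (@le_trans _ _ (expR (v * x))); last by rewrite lerDr expR_ge0.
  by rewrite ler_expR ler_wpM2r.
apply: (@le_trans _ _ (expR (u * x))); last by rewrite lerDl expR_ge0.
by rewrite ler_expR ler_wnM2r// ltW.
Qed.

Lemma mgf_integrable t : Theta t ->
  P.-integrable [set: T] (EFin \o (fun x : T => expR (t * x))).
Proof.
move=> /mgf_ThetaP Mt; apply/integrableP; split.
  by apply/measurable_EFinP; exact: measurable_expR_mul.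
apply: le_lt_trans Mt; apply: ge0_le_integral => //.
- apply: measurableT_comp => //; apply/measurable_EFinP; exact: measurable_expR_mul.
- by apply/measurable_EFinP; exact: measurable_expR_mul.
- by move=> x _; rewrite /= ger0_norm// expR_ge0.
Qed.

Lemma Theta_between u w v : Theta u -> Theta v -> u <= w -> w <= v -> Theta w.
Proof.
move=> Tu Tv uw wv; apply/mgf_ThetaP.
have mE (t : R) : measurable_fun [set: T] (fun x : T => (expR (t * x))%:E).
  by apply/measurable_EFinP; exact: measurable_expR_mul.
apply: (@le_lt_trans _ _ (\int[P]_x ((expR (u * x))%:E + (expR (v * x))%:E))%E).
  apply: ge0_le_integral => //; first exact: emeasurable_funD.
  by move=> x _; rewrite -EFinD lee_fin expR_mul_between.
rewrite ge0_integralD//.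
by apply: lte_add_pinfty; exact/mgf_ThetaP.
Qed.

Lemma Rmgf_lpsi t : Theta t -> \int[P]_x (expR (t * x)) = expR (ps t).
Proof. by move=> Tt; rewrite /Rintegral mgf_lpsi. Qed.

Lemma partial_expR_mul (x y : R) :
  is_derive x 1 (fun t => expR (t * y)) (y * expR (x * y)).
Proof.
have h : is_derive x 1 (fun t : R => t * y) y.
  have := @is_deriveM R R id (cst y) x 1 1 0 (is_derive_id _ _) (is_derive_cst _ _ _).
  by rewrite scaler0 add0r /GRing.scale/= mulr1.
have := @is_derive1_comp _ expR (fun t : R => t * y) x _ _ (is_derive_expR _) h.
by rewrite mulrC.
Qed.

(** The majorant that allows differentiation under the integral: the linear
factor [x] is absorbed by moving the exponent a distance [e] further out, still
within [u, v]. *)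
Lemma normM_expR_bound (u v s e t x : R) : 0 < e -> u <= s - e - e ->
  s + e + e <= v -> s - e < t -> t < s + e ->
  `|x * expR (t * x)| <= e^-1 * (expR (u * x) + expR (v * x)).
Proof.
move=> e0 use sev te1 te2; rewrite normrM (ger0_norm (expR_ge0 _)).
rewrite -(ler_pM2l e0) !mulrA mulfV ?gt_eqF// mul1r.
have -> : e * `|x| = `|e * x| by rewrite normrM (ger0_norm (ltW e0)).
have ew (w : R) : u <= w <= v -> expR (w * x) <= expR (u * x) + expR (v * x).
  by move=> /andP[? ?]; exact: expR_mul_between.
have ex : `|e * x| <= expR `|e * x|.
  by apply: le_trans (expR_ge1Dx _); rewrite lerDr.
apply: le_trans (_ : expR `|e * x| * expR (t * x) <= _).
  by rewrite ler_wpM2r// expR_ge0.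
rewrite -expRD; have [x0|x0] := leP 0 x.
  rewrite ger0_norm ?mulr_ge0 ?(ltW e0)// -mulrDl; apply: ew; lra.
rewrite ltr0_norm ?pmulr_rlt0// -mulNr -mulrDl; apply: ew; lra.
Qed.

Lemma mgf_is_derive u s v : Theta u -> Theta v -> u < s -> s < v ->
  P.-integrable [set: T] (EFin \o (fun x : T => x * expR (s * x))) /\
  is_derive s 1 (fun t => \int[P]_x (expR (t * x)))
    (\int[P]_x (x * expR (s * x))).
Proof.
move=> Tu Tv us sv.
pose e := Num.min (s - u) (v - s) / 2.
have e0 : 0 < e by rewrite divr_gt0// lt_min !subr_gt0 us sv.
have eu : u <= s - e - e.
  have : Num.min (s - u) (v - s) <= s - u by rewrite ge_min lexx.
  rewrite -[X in X <= _](divfK (x := 2))// -/e; lra.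
have ev : s + e + e <= v.
  have : Num.min (s - u) (v - s) <= v - s by rewrite ge_min lexx orbT.
  rewrite -[X in X <= _](divfK (x := 2))// -/e; lra.
pose f (t : R) (x : T) := expR (t * x).
pose G (x : T) := e^-1 * (expR (u * x) + expR (v * x)).
have Is : `]s - e, s + e[%classic s by rewrite /= in_itv/=; lra.
have If (x : R) : `]s - e, s + e[%classic x ->
    P.-integrable [set: T] (EFin \o f x).
  rewrite /= in_itv/= => /andP[? ?]; apply: mgf_integrable.
  apply: (Theta_between Tu Tv); lra.
have df (x : R) (y : T) : `]s - e, s + e[%classic x -> [set: T] y ->
   derivable (f ^~ y) x 1.
  by move=> _ _; have [] := partial_expR_mul x y.
have pE (x : R) (y : T) : partial1of2 f x y = y * expR (x * y).
  rewrite partial1of2E; have pd := partial_expR_mul x y.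
  by rewrite derive_val.
have G0 (y : T) : 0 <= G y.
  by rewrite mulr_ge0 ?invr_ge0 ?(ltW e0)// addr_ge0// expR_ge0.
have IG : P.-integrable [set: T] (EFin \o G).
  have -> : EFin \o G = (fun x => (e^-1)%:E *
      ((EFin \o f u) \+ (EFin \o f v)) x)%E by [].
  apply: integrableZl => //; apply: integrableD => //; exact: mgf_integrable.
have GB (x : R) (y : T) : `]s - e, s + e[%classic x -> [set: T] y ->
   `|partial1of2 f x y| <= G y.
  rewrite /= in_itv/= => /andP[? ?] _; rewrite pE.
  exact: (normM_expR_bound (s := s)).
have mxe : measurable_fun [set: T] (fun x : T => x * expR (s * x)).
  by apply: measurable_funM => //; exact: measurable_expR_mul.
split.
  apply: le_integrable IG => //; first exact/measurable_EFinP.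
  move=> x _ /=; rewrite lee_fin -pE [leRHS]ger0_norm//; exact: GB.
have H := cvg_differentiation_under_integral measurableT Is If df G0 IG GB.
have -> : \int[P]_x (x * expR (s * x)) = \int[P]_y (partial1of2 f s y).
  by apply: eq_Rintegral => y _; rewrite pE.
apply: DeriveDef.
- exact: (derivable_under_integral measurableT Is If df G0 IG GB).
- rewrite -derive1E.
  exact: (differentiation_under_integral measurableT Is If df G0 IG GB).
Qed.

Lemma interior_pt_Theta s : interior_pt Theta s -> Theta s.
Proof. by move=> [u [v [Tu Tv us sv]]]; apply: (Theta_between Tu Tv); exact: ltW. Qed.

Lemma lpsi_derive s : interior_pt Theta s ->
  is_derive s 1 ps (dpsi P s) /\
  dpsi P s = (\int[P]_x (x * expR (s * x))) / expR (ps s).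
Proof.
move=> /[dup] /interior_pt_Theta Ts [u [v [Tu Tv us sv]]].
have [_ dM] := mgf_is_derive Tu Tv us sv.
set M := (fun t => _) in dM.
have Ms : M s = expR (ps s) by rewrite /M Rmgf_lpsi.
have M0 : 0 < M s by rewrite Ms expR_gt0.
have dln := @is_derive1_comp _ _ M s _ _ (is_derive1_ln M0) dM.
have eqn : {near s, (@ln R \o M) =1 ps}.
  near=> t; rewrite /= /M Rmgf_lpsi ?expRK//.
  have : t \in `]u, v[ by near: t; apply: near_in_itvoo; rewrite in_itv/= us sv.
  by rewrite in_itv/= => /andP[? ?]; apply: (Theta_between Tu Tv); exact: ltW.
have dps : is_derive s 1 ps ((M s)^-1 * \int[P]_x (x * expR (s * x))).
  exact: near_eq_is_derive eqn dln.
have e : dpsi P s = (M s)^-1 * \int[P]_x (x * expR (s * x)).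
  by rewrite /dpsi derive1E derive_val.
by split; [rewrite e | rewrite e Ms mulrC].
Unshelve. all: end_near. Qed.

(** The inequality [1 + z <= expR z] at [z = (t - s) (x - m)], multiplied by
[expR (s x + (t - s) m)].  Integrated with [m] the mean under the tilt by [s],
the left-hand side loses its second term and the result is the tangent
inequality for the logarithm of the Laplace transform; the equality case is
recorded because it decides when that inequality is strict. *)
Lemma tangent_minorant (m s t x : R) :
  expR ((t - s) * m) * (expR (s * x) + (t - s) * (x * expR (s * x) - m * expR (s * x)))
   <= expR (t * x) ?= iff ((t == s) || (x == m)).
Proof.
have -> : expR (t * x) = expR ((t - s) * m) * (expR (s * x) * expR ((t - s) * (x - m))).
  by rewrite -!expRD; congr expR; ring.
have -> : expR (s * x) + (t - s) * (x * expR (s * x) - m * expR (s * x)) =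
   expR (s * x) * (1 + (t - s) * (x - m)) by ring.
rewrite !mulrA -expRD; split.
  by rewrite ler_pM2l ?expR_gt0// expR_ge1Dx.
have [->|ts] := eqVneq t s; first by rewrite subrr !mul0r addr0 expR0 eqxx.
have [->|xm] := eqVneq x m; first by rewrite subrr !mulr0 addr0 expR0 eqxx.
by rewrite lt_eqF// ltr_pM2l ?expR_gt0// expR_gt1Dx// mulf_neq0 ?subr_eq0.
Qed.

Lemma integral_tangent s t (m := dpsi P s) : interior_pt Theta s -> Theta t ->
  P.-integrable [set: T] (EFin \o (fun x : T =>
    expR ((t - s) * m) *
    (expR (s * x) + (t - s) * (x * expR (s * x) - m * expR (s * x))))) /\
  \int[P]_x (expR ((t - s) * m) *
    (expR (s * x) + (t - s) * (x * expR (s * x) - m * expR (s * x)))) =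
  expR (ps s + (t - s) * m).
Proof.
move=> /[dup] iTs /[dup] /interior_pt_Theta Ts [u [v [Tu Tv us sv]]] Tt.
have [Ix _] := mgf_is_derive Tu Tv us sv.
have Is := mgf_integrable Ts.
have [_ dE] := lpsi_derive iTs.
have Ims : P.-integrable [set: T] (EFin \o (fun x : T => m * expR (s * x))).
  by apply: (integrableZl measurableT m Is).
have IB : P.-integrable [set: T]
    (EFin \o (fun x : T => x * expR (s * x) - m * expR (s * x))).
  by apply: (integrableB measurableT Ix Ims).
have IZ : P.-integrable [set: T]
    (EFin \o (fun x : T => (t - s) * (x * expR (s * x) - m * expR (s * x)))).
  by apply: (integrableZl measurableT (t - s) IB).
have IS : P.-integrable [set: T]
    (EFin \o (fun x : T => expR (s * x) + (t - s) * (x * expR (s * x) - m * expR (s * x)))).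
  by apply: (integrableD measurableT Is IZ).
split; first by apply: (integrableZl measurableT (expR ((t - s) * m)) IS).
rewrite RintegralZl// RintegralD// RintegralZl// RintegralB// RintegralZl//.
rewrite Rmgf_lpsi//.
have -> : \int[P]_x (x * expR (s * x)) = m * expR (ps s).
  by rewrite /m dE divfK// gt_eqF// expR_gt0.
by rewrite subrr mulr0 addr0 -expRD addrC.
Qed.

Lemma lpsi_tangent s t : interior_pt Theta s -> Theta t ->
  ps s + (t - s) * dpsi P s <= ps t.
Proof.
move=> iTs Tt; rewrite -ler_expR.
have [I E] := integral_tangent iTs Tt.
rewrite -E -Rmgf_lpsi//; apply: le_Rintegral => //; first exact: mgf_integrable.
by move=> x _; rewrite tangent_minorant.
Qed.

(** Equality would force [tangent_minorant] to be tight almost everywhere, that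
is, [P] to be a point mass at [dpsi P s]. *)
Lemma lpsi_tangent_strict s t : (forall x : R, P [set x] <> 1%E) ->
  interior_pt Theta s -> Theta t -> t != s -> ps s + (t - s) * dpsi P s < ps t.
Proof.
move=> ndP iTs Tt ts; rewrite lt_neqAle lpsi_tangent// andbT.
apply/eqP => eps.
have [I E] := integral_tangent iTs Tt.
have It := mgf_integrable Tt.
set L := (fun x : T => _) in I E.
have IB : P.-integrable [set: T] (EFin \o (fun x : T => expR (t * x) - L x)).
  by apply: (integrableB measurableT It I).
have mB : measurable_fun [set: T] (fun x : T => expR (t * x) - L x).
  by apply/measurable_EFinP; exact: (measurable_int _ IB).
have B0 x : 0 <= expR (t * x) - L x by rewrite subr_ge0 tangent_minorant.
have I0 : (\int[P]_x (expR (t * x) - L x)%:E = 0)%E.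
  rewrite -[LHS]fineK; last exact: (integrable_fin_num _ IB).
  congr EFin; rewrite -[LHS]/(\int[P]_x (expR (t * x) - L x)).
  by rewrite RintegralB// Rmgf_lpsi// E eps subrr.
have := integral_eq0_null mB B0 I0.
have -> : [set x : T | 0 < expR (t * x) - L x] = ~` [set dpsi P s].
  apply/seteqP; split => x /=;
    rewrite subr_gt0 (lt_leif (tangent_minorant (dpsi P s) s t x)) (negbTE ts) /=.
  - by move=> /eqP.
  - by move=> ?; apply/eqP.
move=> PC; apply: (ndP (dpsi P s)).
have := @probability_setC _ _ _ P [set dpsi P s] (measurable_set1 _).
rewrite PC => /esym /eqP; rewrite sube_eq ?fin_num_measure//.
by rewrite add0e => /eqP.
Qed.

(** Lower semicontinuity, by Fatou's lemma.  It shows in particular that the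
parameter set contains an endpoint at which [ps] stays bounded. *)
Lemma lpsi_limit (u_ : nat -> R) t C :
  u_ n @[n --> \oo] --> t -> (forall n, Theta (u_ n) /\ ps (u_ n) <= C) ->
  Theta t /\ ps t <= C.
Proof.
move=> ut Tu; apply: mgf_le_lpsi.
have mE (w : R) : measurable_fun [set: T] (fun x : T => (expR (w * x))%:E).
  by apply/measurable_EFinP; exact: measurable_expR_mul.
rewrite (eq_integral (fun x : T => limn_einf (fun n => (expR (u_ n * x))%:E))); last first.
  move=> x _; apply/esym; apply: (cvg_limn_einf_sup _).1.
  apply: cvg_EFin; first exact: nearW.
  apply: (@continuous_cvg _ _ _ _ _ _ expR); first exact: continuous_expR.
  by apply: cvgMr_tmp; exact: ut.
apply: le_trans (fatou _ _ _ _) _ => //.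
rewrite limn_einf_lim; apply: lime_le; first exact: is_cvg_einfs.
apply: nearW => n; apply: ge_ereal_inf; exists (\int[P]_x (expR (u_ n * x))%:E)%E.
  by exists n => /=.
by have [Tn ?] := Tu n; rewrite mgf_lpsi// lee_fin ler_expR.
Qed.

End mgf_derivative.

(** * Exponents at the critical parameter *)

Section cumulant.
Context (R : realType).
Implicit Types (D : set R) (f df : R -> R) (a mu s t e h m : R) (tp : \bar R).

(** What the large deviation arguments use of a log-Laplace transform [f] with
domain [D] and derivative [df].  Unlike the transform itself, this list of
properties is visibly stable under reflection ([cumulant_opp]). *)
Record cumulant D f df : Prop := Cumulant {
  cum_dom0 : D 0 ;
  cum0 : f 0 = 0 ;
  cum_between : forall u w v, D u -> D v -> u <= w -> w <= v -> D w ;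
  cum_derive : forall s, interior_pt D s -> is_derive s 1 f (df s) ;
  cum_tangent : forall s t, interior_pt D s -> D t ->
    f s + (t - s) * df s <= f t ;
  cum_tangent_strict : forall s t, interior_pt D s -> D t -> t != s ->
    f s + (t - s) * df s < f t ;
  cum_limit : forall (u : nat -> R) t C, u n @[n --> \oo] --> t ->
    (forall n, D (u n) /\ f (u n) <= C) -> D t /\ f t <= C }.

(** The pair [mu], [tp] stands for mu_a^+ and theta_a^+: [mu] is the largest slope
whose rate is at most [a^-1], and the slopes of [f] increase to [mu] at [tp].
The rate function is spelled out as Legendre inequalities, so that the same
record describes mu_a^- and theta_a^- after reflection. *)
Record critical D f df a mu tp : Prop := Critical {
  crit_gt0 : (0 < tp)%E ;
  crit_dom : forall t, 0 < t -> (t%:E < tp)%E -> D t ;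
  crit_le : forall s, D s -> 0 < s -> s * mu - f s <= a^-1 ;
  crit_gt : forall m, mu < m -> exists2 t, D t & a^-1 < t * m - f t ;
  crit_slope_le : forall s, 0 < s -> (s%:E < tp)%E -> df s <= mu ;
  crit_slope_lim : forall t, tp = t%:E -> forall e : R, 0 < e ->
    exists2 s0, s0 < t & forall s, s0 < s -> s < t -> mu - e < df s }.

Lemma is_derive_near f (s m : R) : is_derive s 1 f m ->
  forall e : R, 0 < e -> exists2 h0 : R, 0 < h0 &
    forall h, `|h| < h0 -> `|f (s + h) - f s - h * m| <= e * `|h|.
Proof.
move=> /is_derive1_caratheodory [g [fg gc gs]] e e0.
have /cvgrPdist_lt /(_ e e0) : g z @[z --> s] --> g s by exact: gc.
move=> -[h0 /= h00 H]; exists h0 => // h hh0.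
rewrite fg addrAC subrr add0r [h * m]mulrC -mulrBl normrM ler_wpM2r//.
rewrite -gs distrC; apply/ltW/H.
by rewrite /ball_ /= opprD addrA subrr add0r normrN.
Qed.

Lemma critical_interior D f df a mu tp : cumulant D f df ->
  critical D f df a mu tp ->
  forall s, 0 < s -> (s%:E < tp)%E -> interior_pt D s.
Proof.
move=> Cf Cr s s0 stp.
have [v sv vtp] : exists2 v, s < v & (v%:E < tp)%E.
  case: tp stp {Cr} => [t| |] //.
  - rewrite lte_fin => st; exists ((s + t) / 2); rewrite ?lte_fin; lra.
  - by move=> _; exists (s + 1); rewrite ?ltry// ltrDl.
exists 0, v; split => //; first exact: (cum_dom0 Cf).
by apply: (crit_dom Cr) => //; exact: lt_trans sv.
Qed.

Lemma slope_nondecreasing D f df : cumulant D f df ->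
  forall s t, interior_pt D s -> interior_pt D t -> s <= t -> df s <= df t.
Proof.
move=> Cf s t Is It; rewrite le_eqVlt => /predU1P[-> //|st].
have inD w : interior_pt D w -> D w.
  by move=> [u [v [Du Dv ? ?]]]; apply: (cum_between Cf Du Dv); exact: ltW.
have h1 := cum_tangent Cf Is (inD _ It).
have h2 := cum_tangent Cf It (inD _ Is).
rewrite -(ler_pM2l (x := t - s)) ?subr_gt0//; lra.
Qed.

(** At [s = 2 th] the quantity [(1 + q)/2 - r] is, up to terms in [d], the
second-moment exponent.  When [2 th] is not available, [s] is taken just left of
the critical parameter: there the slope is nearly [mu], the rate is at most
[a^-1] by [crit_le], and so [(1 + q)/2 - r] is at least the linear exponent, again up to terms in [d].
In both cases [d] spends a fixed fraction of the slack. *)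
Lemma detection_exponents D f df a mu tp (th beta : R) :
  cumulant D f df -> 0 < a -> critical D f df a mu tp ->
  0 < th -> D th -> (th%:E <= tp)%E -> 0 < beta ->
  (if ((2 * th)%:E < tp)%E then beta < 2^-1 * (1 + a * (f (2 * th) - 2 * f th))
   else beta < a * (th * mu - f th)) ->
  exists s d : R, [/\ interior_pt D s, 0 < s, 0 < d &
    let q := a * (s * df s - `|s| * d - f s) in
    let r := a * ((s - th) * df s - f s + f th + `|s - th| * d) in
    [/\ beta < (1 + q) / 2 - r, r < q & q < 1]].
Proof.
move=> Cf a0 Cr th0 Dth thtp b0.
case: ifPn => [th2 bb|th2 bb].
- have thtp' : (th%:E < tp)%E by apply: lt_trans th2; rewrite lte_fin; lra.
  have I2 := critical_interior Cf Cr (mulr_gt0 (ltr0Sn _ _) th0) th2.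
  have I1 := critical_interior Cf Cr th0 thtp'.
  set m := df (2 * th).
  have m1 : df th <= m by apply: (slope_nondecreasing Cf) => //; lra.
  have g0 : 0 < th * m - f th.
    have := cum_tangent_strict Cf I1 (cum_dom0 Cf).
    rewrite eq_sym gt_eqF// (cum0 Cf) => /(_ isT) h.
    have : th * df th <= th * m by rewrite ler_pM2l.
    lra.
  have mmu : m <= mu.
    by apply: (crit_slope_le Cr) => //; rewrite mulr_gt0.
  have D2 : D (2 * th) by apply: (crit_dom Cr) => //; rewrite mulr_gt0.
  have q1 : a * (2 * th * m - f (2 * th)) <= 1.
    have cD := crit_le Cr D2 (mulr_gt0 (ltr0Sn _ _) th0).
    rewrite -[leRHS](mulfV (lt0r_neq0 a0)) ler_pM2l//; apply: le_trans cD.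
    by rewrite lerD2r ler_wpM2l// ltW// mulr_gt0.
  pose b := 2^-1 * (1 + a * (f (2 * th) - 2 * f th)).
  pose d1 := (b - beta) / (4 * a * th); pose d2 := (th * m - f th) / (6 * th).
  have d10 : 0 < d1 by rewrite divr_gt0 ?mulr_gt0// subr_gt0.
  have d20 : 0 < d2 by rewrite divr_gt0 ?mulr_gt0// subr_gt0.
  have e1 : a * th * d1 = (b - beta) / 4.
    by rewrite /d1; field; rewrite !gt_eqF.
  have e2 : th * d2 = (th * m - f th) / 6 by rewrite /d2; field; rewrite gt_eqF.
  pose d := Num.min d1 d2.
  have d0 : 0 < d by rewrite lt_min d10.
  have dd1 : a * th * d <= a * th * d1.
    by rewrite ler_wpM2l ?mulr_ge0 ?(ltW a0) ?(ltW th0)// ge_min lexx.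
  have dd2 : th * d <= th * d2 by rewrite ler_wpM2l ?(ltW th0)// ge_min lexx orbT.
  have ad0 : 0 < a * th * d by rewrite !mulr_gt0.
  have add2 : a * (th * d) <= a * (th * d2) by rewrite ler_wpM2l// ltW.
  have ag0 : 0 < a * (th * m - f th) by rewrite mulr_gt0.
  exists (2 * th), d; split => //; first by rewrite mulr_gt0.
  rewrite -/m !gtr0_norm ?mulr_gt0//; last by lra.
  rewrite e2 in add2; rewrite e1 /b in dd1.
  by split; lra.
- have {th2} : (tp <= (2 * th)%:E)%E by rewrite leNgt.
  case: tp thtp Cr => [T| |]; [|by rewrite leye_eq|by rewrite leeNy_eq].
  rewrite !lee_fin => thT Cr T2.
  have T0 : 0 < T by have := crit_gt0 Cr; rewrite lte_fin.
  pose G := th * mu - f th - beta / a.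
  have G0 : 0 < G.
    by rewrite /G subr_gt0 ltr_pdivrMr// mulrC.
  pose d := G / (4 * T).
  have d0 : 0 < d by rewrite divr_gt0// mulr_gt0.
  have dE : T * d = G / 4 by rewrite /d; field; rewrite gt_eqF.
  have [s0 s0T Hs] := crit_slope_lim Cr (erefl _) d0.
  have [s [ss0 sT sp]] : exists s, [/\ s0 < s, s < T & 0 < s].
    exists ((Num.max s0 0 + T) / 2).
    have m1 : s0 <= Num.max s0 0 by rewrite le_max lexx.
    have m2 : 0 <= Num.max s0 0 by rewrite le_max lexx orbT.
    have m3 : Num.max s0 0 < T by rewrite gt_max s0T T0.
    by split; lra.
  have Is : interior_pt D s by apply: (critical_interior Cf Cr) => //; rewrite lte_fin.
  have Ds : D s by apply: (crit_dom Cr) => //; rewrite lte_fin.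
  have m1 := Hs s ss0 sT.
  have m2 : df s <= mu by apply: (crit_slope_le Cr) => //; rewrite lte_fin.
  have c1 := crit_le Cr Ds sp.
  set m := df s in m1 m2 *.
  have nT : `|s - th| <= T by rewrite ler_norml; lra.
  have n0 : 0 <= `|s - th| by [].
  have c2 : a * (s * mu - f s) <= 1.
    by rewrite -(mulfV (lt0r_neq0 a0)) ler_pM2l.
  have aG : a * G = a * (th * mu - f th) - beta.
    by rewrite /G; field; rewrite gt_eqF.
  have aT : a * (T * d) = a * G / 4 by rewrite dE mulrA.
  have sd : a * (s * d) <= a * (T * d).
    by rewrite ler_pM2l// ler_wpM2r// ltW.
  have sd0 : 0 < a * (s * d) := mulr_gt0 a0 (mulr_gt0 sp d0).
  have nd : a * (`|s - th| * d) <= a * (T * d).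
    by rewrite ler_pM2l// ler_wpM2r// ltW.
  have am : a * (s * m) <= a * (s * mu) by rewrite ler_pM2l// ler_pM2l.
  have tm : a * (th * (mu - d)) <= a * (th * m).
    by rewrite ler_pM2l// ler_pM2l// ltW.
  have td : a * (th * d) <= a * (T * d) by rewrite ler_pM2l// ler_wpM2r// ltW.
  have smd : a * ((2 * th - s) * (mu - d)) <= a * ((2 * th - s) * m).
    by rewrite ler_pM2l// ler_wpM2l ?(ltW m1)// subr_ge0; lra.
  have aG0 : 0 < a * G by rewrite mulr_gt0.
  exists s, d; split => //; rewrite (gtr0_norm sp) -/m; split; lra.
Qed.

(** The tangent inequalities at [s < tp] pass to the limit: the slopes tend to
[mu] and [f] is lower semicontinuous. *)
Lemma limit_tangent D f df a mu tp T : cumulant D f df ->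
  critical D f df a mu tp -> tp = T%:E ->
  D T /\ forall t, D t -> f T + (t - T) * mu <= f t.
Proof.
move=> Cf Cr tpT.
have T0 : 0 < T by have := crit_gt0 Cr; rewrite tpT lte_fin.
have inner s : 0 < s -> s < T -> [/\ interior_pt D s, D s & df s <= mu].
  move=> sp sT; split.
  - by apply: (critical_interior Cf Cr) => //; rewrite tpT lte_fin.
  - by apply: (crit_dom Cr) => //; rewrite tpT lte_fin.
  - by apply: (crit_slope_le Cr) => //; rewrite tpT lte_fin.
have key t e : D t -> 0 < e -> D T /\ f T <= f t - (t - T) * mu + e.
  move=> Dt e0.
  pose N := `|t - T| + T + `|mu| + 1.
  have N1 : 1 <= N by rewrite lerDr !addr_ge0// ltW.
  have N0 : 0 < N by apply: lt_le_trans N1.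
  pose eta := e / (2 * N).
  have eta0 : 0 < eta by rewrite divr_gt0// mulr_gt0.
  have etaN : N * eta = e / 2 by rewrite /eta; field; rewrite gt_eqF.
  have [s0 s0T Hs] := crit_slope_lim Cr tpT eta0.
  pose s1 := Num.max (Num.max s0 0) (T - eta).
  have s1T : s1 < T by rewrite !gt_max s0T T0 ltrBlDr ltrDl.
  have s10 : s0 <= s1 by rewrite !le_max lexx.
  have s11 : 0 <= s1 by rewrite !le_max lexx orbT.
  have s12 : T - eta <= s1 by rewrite le_max lexx orbT.
  have bound s : s1 < s -> s < T -> D s /\ f s <= f t - (t - T) * mu + e.
    move=> s1s sT; have [Is Ds dm] := inner s (le_lt_trans s11 s1s) sT.
    split => //.
    have tg := cum_tangent Cf Is Dt.
    have dl := Hs s (le_lt_trans s10 s1s) sT.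
    have p0 : 0 <= mu - df s by rewrite subr_ge0.
    have p1 : mu - df s <= eta by lra.
    have p2 : (t - s) * (mu - df s) <= (`|t - T| + T) * eta.
      apply: (@le_trans _ _ ((`|t - T| + T) * (mu - df s))).
        rewrite ler_wpM2r//; have := ler_norm (t - T); lra.
      by rewrite ler_wpM2l// addr_ge0// ltW.
    have p3 : (s - T) * mu <= `|mu| * eta.
      apply: le_trans (ler_norm _) _; rewrite normrM mulrC ler_wpM2l//.
      by rewrite ler_norml; lra.
    have : (`|t - T| + T) * eta + `|mu| * eta <= N * eta.
      by rewrite -mulrDl ler_wpM2r ?(ltW eta0)// lerDl.
    lra.
  pose u n := T - (T - s1) * (n.+2%:R)^-1.
  have uT : u n @[n --> \oo] --> T.
    rewrite -[X in _ --> X]subr0 -[X in _ --> _ - X](mulr0 (T - s1)).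
    apply: cvgB; first exact: cvg_cst.
    apply: cvgM; first exact: cvg_cst.
    rewrite (cvg_shiftS (fun n => n.+1%:R^-1 : R^o)); exact: cvg_harmonic.
  apply: (cum_limit Cf uT) => n; apply: bound; rewrite /u.
  - have : (T - s1) * n.+2%:R^-1 < T - s1.
      by rewrite gtr_pMr ?subr_gt0// invf_lt1 ?ltr0n// ltr1n.
    by move=> lt; rewrite ltrBrDl -ltrBrDr.
  - by rewrite ltrBlDr ltrDl divr_gt0 ?subr_gt0// ltr0n.
have [DT _] := key 0 1 (cum_dom0 Cf) ltr01.
split => // t Dt; apply/ler_addgt0Pr => e e0.
have [_] := key t e Dt e0; lra.
Qed.

(** If the rate of [mu] were below [a^-1], then a slightly larger slope would
still have rate at most [a^-1], against the maximality of [mu].  If [D] ends at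
[T], any small increase works, because all parameters are at most [T].  If [T] is
interior, [f] has slope [mu] at [T], and the slope of a short chord to the right
of [T] works: the supremum in its rate is attained over that chord. *)
Lemma critical_rate D f df a mu tp T : cumulant D f df ->
  critical D f df a mu tp -> tp = T%:E ->
  D T /\ a^-1 <= T * mu - f T.
Proof.
move=> Cf Cr tpT.
have T0 : 0 < T by have := crit_gt0 Cr; rewrite tpT lte_fin.
have [DT tanT] := limit_tangent Cf Cr tpT.
split => //; rewrite leNgt; apply/negP => lt1.
pose kap := a^-1 - (T * mu - f T).
have kap0 : 0 < kap by rewrite subr_gt0.
suff [m mum rm] : exists2 m, mu < m & forall t, D t -> t * m - f t <= a^-1.
  by have [t Dt] := crit_gt Cr mum; rewrite ltNge rm.
have [[t1 Dt1 Tt1]|noD] := pselect (exists2 t1, D t1 & T < t1); last first.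
  exists (mu + kap / T); first by rewrite ltrDl divr_gt0.
  move=> t Dt; have tT : t <= T by rewrite leNgt; apply/negP => Tt; apply: noD; exists t.
  have tl := tanT t Dt.
  have : t * (kap / T) <= T * (kap / T).
    by rewrite ler_wpM2r// divr_ge0 ?(ltW kap0) ?(ltW T0).
  have -> : T * (kap / T) = kap by field; rewrite gt_eqF.
  by rewrite /kap; lra.
have IT : interior_pt D T.
  by exists 0, t1; split => //; exact: (cum_dom0 Cf).
have t10 : 0 < t1 by exact: lt_trans Tt1.
pose eta := kap / t1.
have eta0 : 0 < eta by rewrite divr_gt0.
have etaE : t1 * eta = kap by rewrite /eta; field; rewrite gt_eqF.
(* comparing the derivative with the limiting tangent on either side of T *)
have dfT : df T <= mu.
  apply/ler_addgt0Pr => e e0.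
  have [h0 h00 Hh] := is_derive_near (cum_derive Cf IT) e0.
  pose h := Num.min (h0 / 2) (T / 2).
  have hp : 0 < h by rewrite lt_min !divr_gt0.
  have hh0 : h < h0 by rewrite gt_min; apply/orP; left; lra.
  have hT : h < T by rewrite gt_min; apply/orP; right; lra.
  have DTh : D (T - h).
    by apply: (crit_dom Cr); rewrite ?tpT ?lte_fin; lra.
  have := Hh (- h); rewrite normrN (gtr0_norm hp) => /(_ hh0).
  rewrite ler_norml => /andP[_ hd].
  have tl := tanT _ DTh.
  rewrite -(ler_pM2l hp); lra.
have dfT2 : mu <= df T.
  apply/ler_addgt0Pr => e e0.
  have [h0 h00 Hh] := is_derive_near (cum_derive Cf IT) e0.
  pose h := Num.min (h0 / 2) (t1 - T).
  have hp : 0 < h by rewrite lt_min divr_gt0// subr_gt0.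
  have hh0 : h < h0 by rewrite gt_min; apply/orP; left; lra.
  have hT : h <= t1 - T by rewrite ge_min lexx orbT.
  have DTh : D (T + h).
    by apply: (cum_between Cf DT Dt1); lra.
  have := Hh h; rewrite (gtr0_norm hp) => /(_ hh0).
  rewrite ler_norml => /andP[_ hd].
  have tl := tanT _ DTh.
  rewrite -(ler_pM2l hp); lra.
have [h0 h00 Hh] := is_derive_near (cum_derive Cf IT) eta0.
pose h := Num.min (h0 / 2) ((t1 - T) / 2).
have hp : 0 < h by rewrite lt_min !divr_gt0// subr_gt0.
have hh0 : h < h0 by rewrite gt_min; apply/orP; left; lra.
have hT : h < t1 - T by rewrite gt_min; apply/orP; right; lra.
have DTh : D (T + h) by apply: (cum_between Cf DT Dt1); lra.
have ITh : interior_pt D (T + h).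
  by exists 0, t1; split => //; [exact: (cum_dom0 Cf)| |]; lra.
have := Hh h; rewrite (gtr0_norm hp) => /(_ hh0).
rewrite ler_norml => /andP[_ hd].
pose m := (f (T + h) - f T) / h.
have mE : h * m = f (T + h) - f T by rewrite /m; field; rewrite gt_eqF.
have mum : mu < m.
  have TnT : T + h != T by rewrite gt_eqF// ltrDl.
  have := cum_tangent_strict Cf IT DTh TnT.
  have -> : T + h - T = h by ring.
  have : h * mu <= h * df T by rewrite ler_pM2l.
  by move=> p1 p2; rewrite -(ltr_pM2l hp) mE; lra.
have hdf : h * df T <= h * mu by rewrite ler_pM2l.
have meta : m <= mu + eta by rewrite -(ler_pM2l hp) mE; lra.
exists m => // t Dt.
have mT : T * m - f T <= a^-1.
  have : T * m <= T * (mu + eta) by rewrite ler_pM2l.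
  have : T * eta <= t1 * eta by rewrite ler_pM2r// ltW.
  by rewrite etaE /kap; lra.
have [tT|tT] := leP t T.
  have tl := tanT _ Dt.
  have : (T - t) * mu <= (T - t) * m by rewrite ler_wpM2l ?(ltW mum)// subr_ge0.
  lra.
have [tTh|tTh] := leP t (T + h).
  have tl := tanT _ Dt.
  have t0 : 0 < t by exact: lt_trans tT.
  have : t * m <= t * (mu + eta) by rewrite ler_pM2l.
  have : t * eta <= t1 * eta by rewrite ler_pM2r//; lra.
  by rewrite etaE /kap; lra.
have mdf : m <= df (T + h).
  have tl := cum_tangent Cf ITh DT.
  rewrite -(ler_pM2l hp) mE; lra.
have tl := cum_tangent Cf ITh Dt.
have : (t - (T + h)) * m <= (t - (T + h)) * df (T + h).
  by rewrite ler_wpM2l// subr_ge0 ltW.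
lra.
Qed.

Lemma cumulant_opp D f df : cumulant D f df ->
  cumulant [set t | D (- t)] (f \o -%R) (fun s => - df (- s)).
Proof.
move=> Cf.
have iopp s : interior_pt [set t | D (- t)] s -> interior_pt D (- s).
  by move=> [u [v [Du Dv us sv]]]; exists (- v), (- u); rewrite !ltrN2.
split => /=.
- by rewrite oppr0; exact: (cum_dom0 Cf).
- by rewrite oppr0 (cum0 Cf).
- by move=> u w v Du Dv uw wv; apply: (cum_between Cf Dv Du); rewrite lerN2.
- move=> s /iopp /(cum_derive Cf) h.
  have := @is_derive1_comp _ f -%R s _ _ h (is_deriveN (is_derive_id _ _)).
  by rewrite mulrN1.
- move=> s t /iopp Is Dt; have := cum_tangent Cf Is Dt; lra.
- move=> s t /iopp Is Dt ts; have := cum_tangent_strict Cf Is Dt.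
  rewrite eqr_opp => /(_ ts); lra.
- move=> u t C ut Du; apply: (cum_limit Cf (u := fun n => - u n)) => //.
  exact: cvgN.
Qed.

End cumulant.

(** * The critical parameters of an exponential family *)

Section critical_parameters.
Context (R : realType).
Implicit Types (D : set R) (f df : R -> R) (a mu s t e m : R) (tp : \bar R).

Lemma left_limit_near (g : R -> R) mu tp :
  match tp with
  | t%:E => (g s)%:E @[s --> t^'-] --> mu%:E
  | +oo%E => (g s)%:E @[s --> +oo] --> mu%:E
  | -oo%E => False
  end -> forall e : R, 0 < e -> exists2 s0 : R, (s0%:E < tp)%E &
    forall s, s0 < s -> (s%:E < tp)%E -> `|mu - g s| < e.
Proof.
case: tp => [t| |] // H e e0.
- have /fine_cvg /cvgrPdist_lt /(_ e e0) := H.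
  rewrite near_withinE => -[h /= h0 Hh].
  exists (t - h); first by rewrite lte_fin ltrBlDr ltrDl.
  move=> s hs; rewrite lte_fin => st; apply: Hh => //=.
  by rewrite gtr0_norm ?subr_gt0//; lra.
- have /fine_cvg /cvgrPdist_lt /(_ e e0) := H.
  move=> [M [_ HM]]; exists M; first exact: ltry.
  by move=> s Ms _; exact: HM.
Qed.

(** Only the limit of the slopes is known near [tp]; the bound by [mu] on the
whole range follows since they increase. *)
Lemma critical_intro D f df a mu tp : cumulant D f df -> (0 < tp)%E ->
  (forall t, 0 < t -> (t%:E < tp)%E -> D t) ->
  (forall m, (forall t, D t -> t * m - f t <= a^-1) -> m <= mu) ->
  (forall e : R, 0 < e ->
    exists2 m, mu - e < m & forall t, D t -> t * m - f t <= a^-1) ->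
  (forall e : R, 0 < e -> exists2 s0 : R, (s0%:E < tp)%E &
    forall s, s0 < s -> (s%:E < tp)%E -> `|mu - df s| < e) ->
  critical D f df a mu tp.
Proof.
move=> Cf tp0 tpD mu1 mu2 lim.
have Is s : 0 < s -> (s%:E < tp)%E -> interior_pt D s.
  move=> s0 stp.
  have [v sv vtp] : exists2 v, s < v & (v%:E < tp)%E.
    case: tp stp {tp0 tpD lim} => [t| |] //.
    - by rewrite lte_fin => st; exists ((s + t) / 2); rewrite ?lte_fin; lra.
    - by move=> _; exists (s + 1); rewrite ?ltry// ltrDl.
  exists 0, v; split => //; first exact: (cum_dom0 Cf).
  by apply: tpD => //; exact: lt_trans sv.
split => //.
- move=> s Ds s0; apply/ler_addgt0Pr => e e0.
  have [m mum /(_ s Ds) sm] := mu2 (e / s) (divr_gt0 e0 s0).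
  have : s * (mu - e / s) <= s * m by rewrite ler_pM2l// ltW.
  have -> : s * (mu - e / s) = s * mu - e by field; rewrite gt_eqF.
  lra.
- move=> m mum; have : ~ (forall t, D t -> t * m - f t <= a^-1).
    by move=> /mu1; rewrite leNgt mum.
  move=> /existsNP[t /not_implyP[Dt]] /negP; rewrite -ltNge => h.
  by exists t.
- move=> s s0 stp; apply/ler_addgt0Pr => e e0.
  have [s1 s1tp Hs] := lim e e0.
  have [w [sw s1w wtp]] : exists w, [/\ s < w, s1 < w & (w%:E < tp)%E].
    have mtp : ((Num.max s s1)%:E < tp)%E by rewrite EFin_max gt_max stp.
    have ms : s <= Num.max s s1 by rewrite le_max lexx.
    have ms1 : s1 <= Num.max s s1 by rewrite le_max lexx orbT.
    case: tp mtp {tp0 tpD Is stp lim s1tp Hs} => [t| |] //.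
    - by rewrite lte_fin => st; exists ((Num.max s s1 + t) / 2); split; rewrite ?lte_fin; lra.
    - by move=> _; exists (Num.max s s1 + 1); split; rewrite ?ltry//; lra.
  have := Hs w s1w wtp; rewrite ltr_norml => /andP[h _].
  have := slope_nondecreasing Cf (Is s s0 stp) (Is w (lt_trans s0 sw) wtp) (ltW sw).
  lra.
- move=> t tpt e e0; have [s0 s0t Hs] := lim e e0.
  exists s0; first by rewrite tpt lte_fin in s0t.
  move=> s s0s st; have := Hs s s0s; rewrite tpt lte_fin => /(_ st).
  by rewrite ltr_norml => /andP[_]; lra.
Qed.

End critical_parameters.

Section critical_expfam.
Context (R : realType) (P : probability (measurableTypeR R) R).
Hypothesis ndP : forall x : R, P [set x] <> 1%E.
Local Notation Theta := (Theta P).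
Local Notation ps := (lpsi P).
Implicit Types (a mu s t e m : R) (tp tm : \bar R).

Lemma cumulant_lpsi : cumulant Theta ps (dpsi P).
Proof.
split.
- exact: Theta0.
- exact: lpsi0.
- exact: Theta_between.
- by move=> s /lpsi_derive[].
- exact: lpsi_tangent.
- by move=> s t; exact: lpsi_tangent_strict.
- exact: lpsi_limit.
Qed.

Lemma rate_leP m a : (rate P m <= (a^-1)%:E)%E <->
  (forall t, Theta t -> t * m - ps t <= a^-1).
Proof.
split=> [rm t Tt|H].
  rewrite -lee_fin; apply: le_trans rm; apply: ereal_sup_ubound.
  by exists t => //=; rewrite psi_fin.
apply: ge_ereal_sup => _ [t Tt <-]; rewrite psi_fin//= -EFinB lee_fin.
exact: H.
Qed.

Lemma rate_mean a : 0 < a -> interior_pt Theta 0 -> (rate P (dpsi P 0) <= (a^-1)%:E)%E.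
Proof.
move=> a0 I0; apply/rate_leP => t Tt.
have := cum_tangent cumulant_lpsi I0 Tt; rewrite lpsi0 subr0 add0r => h.
by apply: (@le_trans _ _ 0); rewrite ?invr_ge0 ?(ltW a0)// subr_le0.
Qed.

(** The one-sided conditions on the two critical parameters together put 0 in
the interior, so the mean is a slope of rate 0 and mu_a^+, mu_a^- are finite. *)
Lemma interior0 a tm tp : is_theta_minus P a tm -> is_theta_plus P a tp ->
  interior_pt Theta 0.
Proof.
move=> [tm0 Tm _] [tp0 Tp _].
have [u u0 Tu] : exists2 u : R, u < 0 & Theta u.
  case: tm tm0 Tm => [t| |] // t0 Tm.
  - by rewrite lte_fin in t0; exists (t / 2); [|apply: Tm; rewrite ?lte_fin]; lra.
  - by exists (-1); rewrite ?ltrN10//; apply: Tm; rewrite ?ltrN10 ?ltNyr.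
have [v v0 Tv] : exists2 v : R, 0 < v & Theta v.
  case: tp tp0 Tp => [t| |] // t0 Tp.
  - by rewrite lte_fin in t0; exists (t / 2); [|apply: Tp; rewrite ?lte_fin]; lra.
  - by exists 1 => //; apply: Tp; rewrite ?ltry.
by exists u, v.
Qed.

Lemma mu_plus_critical a tp : 0 < a -> interior_pt Theta 0 ->
  is_theta_plus P a tp ->
  exists2 mu, mu_plus P a = mu%:E & critical Theta ps (dpsi P) a mu tp.
Proof.
move=> a0 I0 [tp0 Tp lim].
have [u [v [_ Tv _ v0]]] := I0.
have ubm m : (rate P m <= (a^-1)%:E)%E -> m <= (a^-1 + ps v) / v.
  by move=> /rate_leP/(_ v Tv) h; rewrite ler_pdivlMr//; lra.
have mufin : mu_plus P a \is a fin_num.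
  rewrite fin_numElt; apply/andP; split.
    apply: (@lt_le_trans _ _ (dpsi P 0)%:E); first exact: ltNyr.
    apply: ereal_sup_ubound; exists (dpsi P 0) => //; exact: rate_mean.
  apply: (@le_lt_trans _ _ ((a^-1 + ps v) / v)%:E); last exact: ltry.
  by apply: ge_ereal_sup => _ [m /ubm mv <-]; rewrite lee_fin.
have muE := fineK mufin; exists (fine (mu_plus P a)) => //.
apply: critical_intro => //.
- exact: cumulant_lpsi.
- move=> m /rate_leP rm; rewrite -lee_fin muE; apply: ereal_sup_ubound.
  by exists m.
- move=> e e0; have [_ [m rm <-]] := ub_ereal_sup_adherent e0 mufin.
  rewrite -/(mu_plus P a) -muE -EFinB lte_fin => h.
  by exists m => //; exact/rate_leP.
- apply: left_limit_near; rewrite muE.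
  by case: tp tp0 Tp lim.
Qed.

Lemma mu_minus_critical a tm : 0 < a -> interior_pt Theta 0 ->
  is_theta_minus P a tm ->
  exists2 mu, mu_minus P a = mu%:E &
    critical [set t | Theta (- t)] (ps \o -%R) (fun s => - dpsi P (- s)) a
      (- mu) (- tm)%E.
Proof.
move=> a0 I0 [tm0 Tm lim].
have [u [v [Tu _ u0 _]]] := I0.
have lbm m : (rate P m <= (a^-1)%:E)%E -> (a^-1 + ps u) / u <= m.
  by move=> /rate_leP/(_ u Tu) h; rewrite ler_ndivrMr//; lra.
have mufin : mu_minus P a \is a fin_num.
  rewrite fin_numElt; apply/andP; split; last first.
    apply: (@le_lt_trans _ _ (dpsi P 0)%:E); last exact: ltry.
    apply: ereal_inf_lbound; exists (dpsi P 0) => //; exact: rate_mean.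
  apply: (@lt_le_trans _ _ ((a^-1 + ps u) / u)%:E); first exact: ltNyr.
  by apply: le_ereal_inf_tmp => _ [m /lbm mv <-]; rewrite lee_fin.
have muE := fineK mufin; exists (fine (mu_minus P a)) => //.
apply: critical_intro => //.
- exact: cumulant_opp cumulant_lpsi.
- by rewrite lteNr oppe0.
- by move=> t t0 ttm; apply: Tm; rewrite ?oppr_lt0// EFinN lteNr.
- move=> m rm; rewrite lerNr -lee_fin muE; apply: ereal_inf_lbound.
  exists (- m) => //; apply/rate_leP => t Tt.
  have := rm (- t); rewrite /= opprK => /(_ Tt); lra.
- move=> e e0; have [_ [m rm <-]] := lb_ereal_inf_adherent e0 mufin.
  rewrite -/(mu_minus P a) -muE -EFinD lte_fin => h.
  exists (- m); first by lra.
  move=> t Tt; have /rate_leP/(_ _ Tt) := rm.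
  rewrite /=; lra.
- apply: left_limit_near; case: tm tm0 Tm lim => [t| |] //= t0 Tm lim.
  + apply: (@cvg_EFin _ _ _ _ (fun s => (- dpsi P (- s))%:E)); first exact: nearW.
    apply: (@cvgN _ _ _ _ _ (fun s => dpsi P (- s))).
    rewrite -muE in lim; have /fine_cvg l := lim.
    exact/(cvg_at_rightNP (dpsi P)).
  + apply: (@cvg_EFin _ _ _ _ (fun s => (- dpsi P (- s))%:E)); first exact: nearW.
    apply: (@cvgN _ _ _ _ _ (fun s => dpsi P (- s))).
    rewrite -muE in lim; have /fine_cvg l := lim.
    exact/(cvgNy_compNP (dpsi P)).
Qed.

End critical_expfam.

(** * Reading exponents off the phase curve *)

Section phase_exponents.
Context (R : realType) (P : probability (measurableTypeR R) R).
Hypothesis ndP : forall x : R, P [set x] <> 1%E.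
Local Notation Theta := (Theta P).
Local Notation ps := (lpsi P).
Context (a : R) (tm tp : \bar R) (th beta : R).
Hypothesis a0 : 0 < a.
Hypothesis tmP : is_theta_minus P a tm.
Hypothesis tpP : is_theta_plus P a tp.
Hypothesis th0 : th != 0.
Hypothesis Tth : Theta th.
Hypothesis tmth : (tm <= th%:E)%E.
Hypothesis thtp : (th%:E <= tp)%E.

Lemma half_leeP (t : R) (x : \bar R) :
  (((2^-1)%:E * x <= t%:E) = (x <= (2 * t)%:E))%E /\
  ((t%:E <= (2^-1)%:E * x) = ((2 * t)%:E <= x))%E.
Proof.
case: x => [r| |].
- rewrite -EFinM !lee_fin; split; apply/idP/idP; lra.
- by rewrite gt0_muley ?lte_fin ?invr_gt0// !leye_eq !leey.
- by rewrite gt0_muleNy ?lte_fin ?invr_gt0// !leeNy_eq !leNye.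
Qed.

Lemma phase_curve_pos : 0 < th ->
  phase_curve P a tm tp th =
  (if (2 * th)%:E <= tp then
    (2^-1)%:E * (1 + a%:E * (psi P (2 * th)%R - 2%:E * psi P th))
  else a%:E * (th%:E * mu_plus P a - psi P th))%E.
Proof.
move=> thp; have [tm0 _ _] := tmP.
rewrite /phase_curve ltNge !(half_leeP _ _).1 !(half_leeP _ _).2 thtp andbT.
have -> : (tm <= (2 * th)%:E)%E.
  by apply: le_trans (ltW tm0) _; rewrite lee_fin mulr_ge0// ltW.
by case: (_ <= tp)%E.
Qed.

Lemma phase_curve_neg : th < 0 ->
  phase_curve P a tm tp th =
  (if tm <= (2 * th)%:E then
    (2^-1)%:E * (1 + a%:E * (psi P (2 * th)%R - 2%:E * psi P th))
  else a%:E * (th%:E * mu_minus P a - psi P th))%E.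
Proof.
move=> thn; have [tp0 _ _] := tpP.
have t2 : ((2 * th)%:E <= tp)%E.
  by apply: le_trans (ltW tp0); rewrite lee_fin; lra.
rewrite /phase_curve ltNge !(half_leeP _ _).1 !(half_leeP _ _).2.
by rewrite t2 andbT.
Qed.

Let b1 := 2^-1 * (1 + a * (ps (2 * th) - 2 * ps th)).

Lemma chi2_branch_fin : Theta (2 * th) ->
  ((2^-1)%:E * (1 + a%:E * (psi P (2 * th)%R - 2%:E * psi P th)) = b1%:E)%E.
Proof. by move=> T2; rewrite !psi_fin. Qed.

Lemma linear_branch_fin mu :
  (a%:E * (th%:E * mu%:E - psi P th) = (a * (th * mu - ps th))%:E)%E.
Proof. by rewrite psi_fin. Qed.

Lemma chi2_branch_lty :
  ((2^-1)%:E * (1 + a%:E * (psi P (2 * th)%R - 2%:E * psi P th)) < beta%:E)%E ->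
  Theta (2 * th) /\ b1 < beta.
Proof.
have [T2|nT2] := pselect (Theta (2 * th)).
  by rewrite chi2_branch_fin// lte_fin.
have -> : psi P (2 * th) = +oo%E.
  by apply/eqP; move: nT2 => /negP; rewrite -leNgt leye_eq.
rewrite psi_fin// addye// gt0_muley// addey// gt0_muley ?lte_fin ?invr_gt0//.
Qed.

(** Either the second moment of the likelihood ratio is small, or truncation at
the slope [mu] works.  In the second case [s] is the Chernoff parameter both for
the discarded mass and for the truncated second moment, which is why it has to
lie between [th] and [2 * th]. *)
Definition undetectable_exponents :=
  (Theta (2 * th) /\ b1 < beta) \/
  exists s mu, [/\ Theta s, 0 <= (s - th) * th, 0 <= (2 * th - s) * th,
    a^-1 <= s * mu - ps s & a * (th * mu - ps th) < beta].

Lemma phase_curve_lt : (phase_curve P a tm tp th < beta%:E)%E ->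
  undetectable_exponents.
Proof.
have I0 := interior0 tmP tpP.
have [mu muE Cr] := mu_plus_critical ndP a0 I0 tpP.
have [nu nuE Cn] := mu_minus_critical ndP a0 I0 tmP.
case: (ltgtP th 0) th0 => // [thn|thp] _.
- rewrite phase_curve_neg//; case: ifPn => [_ /chi2_branch_lty|]; first by left.
  rewrite -ltNge nuE linear_branch_fin lte_fin => tl bb.
  have [t tE] : exists t, tm = t%:E.
    have := tmth; move: tl; case: (tm) => [t _ _| |]; first by exists t.
      by rewrite leye_eq.
    by rewrite ltNge leNye.
  rewrite tE lte_fin in tl; have := tmth; rewrite tE lee_fin => tth.
  have [] := critical_rate (cumulant_opp (cumulant_lpsi ndP)) Cn (T := - t).
    by rewrite tE.
  rewrite /= opprK => Tt ct; right; exists t, nu; split => //; nra.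
- rewrite phase_curve_pos//; case: ifPn => [_ /chi2_branch_lty|]; first by left.
  rewrite -ltNge muE linear_branch_fin lte_fin => tl bb.
  have [t tE] : exists t, tp = t%:E.
    have := thtp; move: tl; case: (tp) => [t _ _| |]; first by exists t.
      by rewrite ltNge leey.
    by rewrite leeNy_eq.
  rewrite tE lte_fin in tl; have := thtp; rewrite tE lee_fin => tth.
  have [Tt ct] := critical_rate (cumulant_lpsi ndP) Cr tE.
  by right; exists t, mu; split => //; nra.
Qed.

(** When the critical parameter is exactly [2 * t], the curve follows the
second-moment branch whereas [detection_exponents] asks for the linear one. *)
Lemma crossover_le D f df mu T t : cumulant D f df -> critical D f df a mu T%:E ->
  T = 2 * t -> 2^-1 * (1 + a * (f (2 * t) - 2 * f t)) <= a * (t * mu - f t).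
Proof.
move=> Cf Cr Tt; have [_] := critical_rate Cf Cr (erefl _).
rewrite -(ler_pM2l a0) mulfV ?gt_eqF// Tt; lra.
Qed.

(** Some half-line has null probability about [n] to the power [- q] and
alternative probability at least about [n] to the power [- r].  The three
inequalities say that the surplus of small p-values dominates the null standard
deviation of their number, that such an observation is likelier under the
alternative, and that their null mean tends to infinity. *)
Definition detectable_exponents :=
  exists s d, [/\ interior_pt Theta s, 0 < s * th, 0 < d &
    let q := a * (s * dpsi P s - `|s| * d - ps s) in
    let r := a * ((s - th) * dpsi P s - ps s + ps th + `|s - th| * d) in
    [/\ beta < (1 + q) / 2 - r, r < q & q < 1]].

Lemma phase_curve_gt : 0 < beta -> (beta%:E < phase_curve P a tm tp th)%E ->
  detectable_exponents.
Proof.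
move=> beta0; have I0 := interior0 tmP tpP.
have [mu muE Cr] := mu_plus_critical ndP a0 I0 tpP.
have [nu nuE Cn] := mu_minus_critical ndP a0 I0 tmP.
have Cf := cumulant_lpsi ndP; have Co := cumulant_opp Cf.
case: (ltgtP th 0) th0 => // [thn|thp] _.
- rewrite phase_curve_neg// => bb.
  have [|||||s [d [Is s0 d0]]] := @detection_exponents _ _ _ _ a (- nu)%R (- tm)%E (- th) beta Co a0 Cn.
  + by rewrite oppr_gt0.
  + by rewrite /= opprK.
  + by rewrite EFinN leeN2.
  + by [].
  + rewrite /= mulrN opprK opprK EFinN lteN2 mulrNN.
    case: ifPn => [tt|].
      have T2 : Theta (2 * th).
        have := crit_dom Cn (t := - (2 * th)); rewrite /= opprK; apply.
          by lra.
        by rewrite EFinN lteN2.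
      by move: bb; rewrite (ltW tt) chi2_branch_fin// lte_fin.
    rewrite -leNgt => tt; move: bb; case: ifPn => [t2|_]; last first.
      by rewrite nuE linear_branch_fin lte_fin.
    have tE : tm = (2 * th)%:E by apply/eqP; rewrite eq_le tt t2.
    rewrite tE in Cn.
    have [/=] := critical_rate Co Cn (T := - (2 * th)) (erefl _).
    rewrite opprK => T2 _; rewrite chi2_branch_fin// lte_fin => bb.
    have := @crossover_le _ _ _ _ _ (- th) Co Cn.
    rewrite /= mulrN !opprK => /(_ (erefl _)).
    rewrite mulrNN; exact: lt_le_trans.
  + move=> /= [h1 h2 h3].
    exists (- s), d; split => //.
    * have [u [v [Du Dv us sv]]] := Is.
      by exists (- v), (- u); split => //; rewrite ltrN2.
    * by rewrite mulNr oppr_gt0 pmulr_rlt0.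
    * have -> : `|- s - th| = `|s - - th| by rewrite -normrN opprD !opprK.
      by rewrite normrN opprK in h1 h2 h3 *; split; lra.
- rewrite phase_curve_pos// => bb.
  have [|s [d [Is s0 d0 H]]] := @detection_exponents _ _ _ _ a mu tp th beta Cf a0 Cr thp Tth thtp beta0.
  + case: ifPn => [tt|].
      have T2 : Theta (2 * th) by apply: (crit_dom Cr) => //; rewrite mulr_gt0.
      by move: bb; rewrite (ltW tt) chi2_branch_fin// lte_fin.
    rewrite -leNgt => tt; move: bb; case: ifPn => [t2|_]; last first.
      by rewrite muE linear_branch_fin lte_fin.
    have tE : tp = (2 * th)%:E by apply/eqP; rewrite eq_le tt t2.
    rewrite tE in Cr.
    have [T2 _] := critical_rate Cf Cr (erefl _).
    rewrite chi2_branch_fin// lte_fin => bb.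
    by have := @crossover_le _ _ _ _ _ th Cf Cr (erefl _); exact: lt_le_trans.
  + by exists s, d; split => //; rewrite mulr_gt0.
Qed.

End phase_exponents.

(** * A second-moment lower bound on the sum of errors *)

Lemma integral_indicT d (T : measurableType d) (R : realType)
    (P : probability T R) (A : set T) : measurable A ->
  (\int[P]_x (\1_A x)%:E = P A)%E.
Proof. by move=> mA; rewrite integral_indic// setIT. Qed.

Section two_point.
Local Open Scope ereal_scope.
Context d (T : measurableType d) (R : realType).

(** The sum of errors is at least the mean under [P] of [min 1 L], with [L] the
product of the [h]; and [min 1 L >= L - (L - 1)^2 / del - del / 4] depends only
on the first two moments of [L]. *)
Lemma two_point_bound (P Q : probability T R) n (h : T -> R) (m1 m2 del : R)
    (A : set (n.-tuple T)) :
  measurable_fun setT h -> (forall x, 0 <= h x)%R ->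
  (forall g : T -> \bar R, measurable_fun setT g -> (forall x, 0 <= g x) ->
     \int[P]_x (g x * (h x)%:E) <= \int[Q]_x g x) ->
  \int[P]_x (h x)%:E = m1%:E -> \int[P]_x (h x ^+ 2)%:E = m2%:E ->
  (0 < del)%R -> measurable A ->
  (m1 ^+ n * (1 + 2 / del) - (m2 ^+ n + 1) / del - del / 4)%:E <=
  iid P n A + iid Q n (~` A).
Proof.
move=> mh h0 hPQ M1 M2 d0 mA.
pose L (x : n.-tuple T) : R := (\prod_(i < n) h (tnth x i))%R.
have L0 x : (0 <= L x)%R by rewrite prodr_ge0.
have mL : measurable_fun setT L by exact: measurable_prod_tnth.
have mA' : measurable (~` A) by exact: measurableC.
have mI (B : set (n.-tuple T)) : measurable B ->
    measurable_fun setT (fun x => (\1_B x : R)%:E).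
  by move=> mB; apply/measurable_EFinP; exact: measurable_indic.
have EL : \int[iid P n]_x (L x)%:E = (m1 ^+ n)%:E.
  by rewrite integral_iid_prod// M1 EFin_expe.
have EL2 : \int[iid P n]_x (L x ^+ 2)%:E = (m2 ^+ n)%:E.
  rewrite EFin_expe -M2 -(@integral_iid_prod _ _ _ P n (fun x => h x ^+ 2)%R).
  - by apply: eq_integral => x _; rewrite /L -prodrXl.
  - exact: measurable_funX.
  - by move=> x; rewrite exprn_ge0.
have QA : \int[iid P n]_x ((\1_(~` A) x)%:E * (L x)%:E) <= iid Q n (~` A).
  have := @integral_iid_density _ _ _ P Q n h (fun x => (\1_(~` A) x)%:E) mh h0 hPQ
    (mI _ mA') (fun x => _).
  have -> : \int[iid Q n]_x (\1_(~` A) x)%:E = iid Q n (~` A).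
    exact: integral_indicT.
  by apply=> x; rewrite lee_fin.
have PA : \int[iid P n]_x (\1_A x)%:E = iid P n A by exact: integral_indicT.
pose f1 (x : n.-tuple T) : \bar R := (L x * (1 + 2 / del))%:E.
pose f2 (x : n.-tuple T) : \bar R := ((L x ^+ 2 + 1) / del + del / 4)%:E.
have If1 : \int[iid P n]_x f1 x = (m1 ^+ n * (1 + 2 / del))%:E.
  rewrite /f1; under eq_integral do rewrite EFinM.
  rewrite ge0_integralZr//; first by rewrite EL -EFinM.
  - exact/measurable_EFinP.
  - by move=> x _; rewrite lee_fin.
  - by rewrite lee_fin addr_ge0// divr_ge0// ltW.
have If2 : \int[iid P n]_x f2 x = ((m2 ^+ n + 1) / del + del / 4)%:E.
  rewrite /f2 (eq_integral (fun x => (L x ^+ 2)%:E * (del^-1)%:E + (del^-1 + del / 4)%:E)); last first.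
    by move=> x _; rewrite -EFinM -EFinD; congr EFin; ring.
  rewrite ge0_integralD//; last 3 first.
  - by move=> x _; rewrite lee_fin mulr_ge0 ?exprn_ge0// invr_ge0 ltW.
  - apply: emeasurable_funM => //; apply/measurable_EFinP; exact: measurable_funX.
  - by move=> x _; rewrite lee_fin addr_ge0 ?divr_ge0 ?invr_ge0 ?(ltW d0).
  rewrite ge0_integralZr//; last 3 first.
  - by apply/measurable_EFinP; exact: measurable_funX.
  - by move=> x _; rewrite lee_fin exprn_ge0.
  - by rewrite lee_fin invr_ge0 ltW.
  rewrite EL2 integral_cst// [X in _ + _ * X]probability_setT mule1 -EFinM -EFinD.
  by congr EFin; ring.
have key : \int[iid P n]_x f1 x <=
   (iid P n A + iid Q n (~` A)) + \int[iid P n]_x f2 x.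
  apply: (@le_trans _ _ (\int[iid P n]_x
     (((\1_A x)%:E + (\1_(~` A) x)%:E * (L x)%:E) + f2 x))).
    apply: ge0_le_integral => //.
    - by move=> x _; rewrite lee_fin mulr_ge0// addr_ge0// divr_ge0// ltW.
    - by apply/measurable_EFinP; exact: measurable_funM.
    - apply: emeasurable_funD.
        apply: emeasurable_funD; first exact: mI.
        apply: emeasurable_funM; [exact: mI|exact/measurable_EFinP].
      apply/measurable_EFinP; apply: measurable_funD => //.
      apply: measurable_funM => //; apply: measurable_funD => //; exact: measurable_funX.
    move=> x _; rewrite /f1 /f2 -EFinM -!EFinD lee_fin !indicE in_setC.
    (* completing the square: (L - 1)^2 / del + del / 4 >= L - 1 *)
    have h1 : (L x - 1 <= (L x ^+ 2 + 1) / del + del / 4 - L x * (2 / del))%R.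
      rewrite -subr_ge0.
      have -> : ((L x ^+ 2 + 1) / del + del / 4 - L x * (2 / del) - (L x - 1) =
        (L x - 1 - del / 2) ^+ 2 / del)%R by field; rewrite gt_eqF.
      by rewrite divr_ge0 ?sqr_ge0// ltW.
    have h2 : (0 <= (L x ^+ 2 + 1) / del + del / 4 - L x * (2 / del))%R.
      have -> : ((L x ^+ 2 + 1) / del + del / 4 - L x * (2 / del) =
        (L x - 1) ^+ 2 / del + del / 4)%R by field; rewrite gt_eqF.
      by rewrite addr_ge0// divr_ge0 ?sqr_ge0// ltW.
    by have := L0 x; case: (x \in A); rewrite /= ?mul0r ?mul1r ?addr0 ?add0r; lra.
  rewrite ge0_integralD//; last 4 first.
  - by move=> x _; rewrite adde_ge0// lee_fin// mulr_ge0.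
  - apply: emeasurable_funD; first exact: mI.
    apply: emeasurable_funM; [exact: mI|exact/measurable_EFinP].
  - move=> x _; rewrite lee_fin addr_ge0 ?divr_ge0 ?addr_ge0 ?exprn_ge0 ?(ltW d0)//.
  - apply/measurable_EFinP; apply: measurable_funD => //.
    apply: measurable_funM => //; apply: measurable_funD => //; exact: measurable_funX.
  rewrite leeD2r// ge0_integralD//; last 3 first.
  - exact: mI.
  - by move=> x _; rewrite -EFinM lee_fin mulr_ge0.
  - apply: emeasurable_funM; [exact: mI|exact/measurable_EFinP].
  by rewrite PA leeD2l.
move: key; rewrite If1 If2.
have : iid P n A + iid Q n (~` A) \is a fin_num.
  by rewrite fin_numD !fin_num_measure.
case: (_ + _) => // r _; rewrite -EFinD !lee_fin; lra.
Qed.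

End two_point.

(** * Mixtures and randomized observations *)

Section mixture_integral.
Local Open Scope ereal_scope.
Context d (T : measurableType d) (R : realType).

Lemma integral_mixture (e : {i01 R}) (P Q : probability T R) (g : T -> \bar R) :
  measurable_fun setT g -> (forall x, 0 <= g x) ->
  \int[mixture e P Q]_x g x =
  (1 - e%:num)%:E * \int[P]_x g x + (e%:num)%:E * \int[Q]_x g x.
Proof.
move=> mg g0; rewrite /mixture ge0_integral_measure_add//.
by rewrite !ge0_integral_mscale.
Qed.

Lemma bernoulli_ge (m : R) n : (0 <= m -> 1 - n%:R * (1 - m) <= m ^+ n)%R.
Proof.
move=> m0; elim: n => [|n IH]; first by rewrite mul0r subr0 expr0.
rewrite exprS -natr1; apply: le_trans (ler_wpM2l m0 IH).
have n0 : (0 <= n%:R :> R)%R by [].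
have := mulr_ge0 n0 (sqr_ge0 (1 - m)%R); rewrite expr2; lra.
Qed.

Lemma two_point_lower (P Q : probability T R) n (h : T -> R) (m1 m2 u v del : R)
    (A : set (n.-tuple T)) :
  measurable_fun setT h -> (forall x, 0 <= h x)%R ->
  (forall g : T -> \bar R, measurable_fun setT g -> (forall x, 0 <= g x) ->
     \int[P]_x (g x * (h x)%:E) <= \int[Q]_x g x) ->
  \int[P]_x (h x)%:E = m1%:E -> \int[P]_x (h x ^+ 2)%:E = m2%:E ->
  (1 - u <= m1)%R -> (m2 <= 1 + v)%R -> (0 < del)%R -> measurable A ->
  (1 - n%:R * u * (1 + 2 / del) - (expR (n%:R * v) - 1) / del - del / 4)%:E <=
  iid P n A + iid Q n (~` A).
Proof.
move=> mh h0 hPQ M1 M2 um1 m2v d0 mA.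
apply: le_trans (two_point_bound mh h0 hPQ M1 M2 d0 mA).
have m10 : (0 <= m1)%R.
  by rewrite -lee_fin -M1; apply: integral_ge0 => x _; rewrite lee_fin.
have m20 : (0 <= m2)%R.
  by rewrite -lee_fin -M2; apply: integral_ge0 => x _; rewrite lee_fin sqr_ge0.
have n0 : (0 <= n%:R :> R)%R by [].
have b1 : (1 - n%:R * u <= m1 ^+ n)%R.
  apply: le_trans (bernoulli_ge n m10).
  by rewrite lerD2l lerN2 ler_wpM2l//; lra.
have b2 : (m2 ^+ n <= expR (n%:R * v))%R.
  rewrite expRM_natl lerXn2r ?nnegrE ?expR_ge0//.
  by apply: le_trans (expR_ge1Dx v).
have e1 : ((1 - n%:R * u) * (1 + 2 / del) <= m1 ^+ n * (1 + 2 / del))%R.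
  by rewrite ler_wpM2r// addr_ge0// divr_ge0// ltW.
have e2 : ((m2 ^+ n + 1) / del <= (expR (n%:R * v) + 1) / del)%R.
  by rewrite ler_wpM2r ?invr_ge0 ?(ltW d0)// lerD2r.
rewrite lee_fin; lra.
Qed.

End mixture_integral.

Section observations.
Local Open Scope ereal_scope.
Context (R : realType).
Local Notation T := (measurableTypeR R).
Implicit Types (G H : probability T R) (e : {i01 R}).

Definition obs_law G H e : probability (obs R) R :=
  (mixture e G H \x uniform_prob (@ltr01 R))%E.

(** The auxiliary variable has the same law under both hypotheses, so it enters
integrals only through this average. *)
Definition avg_aux (g : obs R -> \bar R) (y : T) : \bar R :=
  \int[uniform_prob (@ltr01 R)]_v g (y, v).

Lemma measurable_avg_aux (g : obs R -> \bar R) : measurable_fun setT g ->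
  (forall x, 0 <= g x) -> measurable_fun setT (avg_aux g).
Proof.
move=> mg g0.
exact: (@measurable_fun_fubini_tonelli_F _ _ _ _ _ (uniform_prob (@ltr01 R)) g mg g0).
Qed.

Lemma avg_aux_ge0 (g : obs R -> \bar R) : (forall x, 0 <= g x) ->
  forall y, 0 <= avg_aux g y.
Proof. by move=> g0 y; exact: integral_ge0. Qed.

Lemma integral_obs_law G H e (g : obs R -> \bar R) : measurable_fun setT g ->
  (forall x, 0 <= g x) ->
  \int[obs_law G H e]_x g x =
  (1 - e%:num)%:E * \int[G]_y avg_aux g y + (e%:num)%:E * \int[H]_y avg_aux g y.
Proof.
move=> mg g0; rewrite /obs_law fubini_tonelli1// integral_mixture//.
- exact: measurable_avg_aux.
- exact: avg_aux_ge0.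
Qed.

Lemma integral_obs_law0 G H (g : obs R -> \bar R) : measurable_fun setT g ->
  (forall x, 0 <= g x) ->
  \int[obs_law G H (0%R : R)%:i01]_x g x = \int[G]_y avg_aux g y.
Proof. by move=> mg g0; rewrite integral_obs_law// subr0 mul1e mul0e adde0. Qed.

Lemma avg_auxM (g : obs R -> \bar R) (h : T -> R) y : measurable_fun setT g ->
  (forall x, 0 <= g x) -> (forall y, 0 <= h y)%R ->
  avg_aux (fun x => g x * (h x.1)%:E) y = avg_aux g y * (h y)%:E.
Proof.
move=> mg g0 h0; rewrite /avg_aux /=.
rewrite (@ge0_integralZr _ _ R _ setT _ (fun v => g (y, v)))//; last by rewrite lee_fin.
by apply: measurableT_comp => //; exact: pair1_measurable.
Qed.

Lemma avg_aux_cst (h : T -> R) y : avg_aux (fun x => (h x.1)%:E) y = (h y)%:E.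
Proof.
by rewrite /avg_aux /= integral_cst// [X in _ * X]probability_setT mule1.
Qed.

(** Truncation to [B] makes the second moment finite and keeps the function
dominated by the likelihood ratio of the mixture. *)
Definition mix_lr (e : {i01 R}) (l : T -> R) (B : set T) (y : T) : R :=
  1 - e%:num + e%:num * (l y * \1_B y).

(** The mean is at least [1 - e tau]; in the second moment the terms of first
order in [e] cancel, so it is at most [1 + e^2 w]. *)
Lemma mix_lr_lower_bound G H e (l : T -> R) (B : set T) n (tau w del : R)
    (A : set (n.-tuple (obs R))) :
  measurable_fun setT l -> (forall y, 0 <= l y)%R -> measurable B ->
  (forall g : T -> \bar R, measurable_fun setT g -> (forall y, 0 <= g y) ->
     \int[G]_y (g y * (l y)%:E) <= \int[H]_y g y) ->
  \int[G]_y (l y)%:E = 1 ->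
  H (~` B) <= tau%:E ->
  \int[G]_y (l y ^+ 2 * \1_B y)%:E <= w%:E ->
  (0 < del)%R -> measurable A ->
  (1 - n%:R * (e%:num * tau) * (1 + 2 / del)
     - (expR (n%:R * (e%:num ^+ 2 * w)) - 1) / del - del / 4)%:E <=
  iid (obs_law G H (0%R : R)%:i01) n A + iid (obs_law G H e) n (~` A).
Proof.
move=> ml l0 mB lGH l1 tauB wB d0 mA.
have e0 : (0 <= e%:num)%R by [].
have e1 : (0 <= 1 - e%:num)%R by rewrite subr_ge0.
have mI (C : set T) : measurable C -> measurable_fun setT (\1_C : T -> R).
  by move=> mC; exact: measurable_indic.
have mlI (C : set T) : measurable C -> measurable_fun setT (fun y => l y * \1_C y)%R.
  by move=> mC; apply: measurable_funM => //; exact: mI.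
have lI0 (C : set T) y : (0 <= l y * \1_C y)%R by rewrite mulr_ge0// indicE.
have mm : measurable_fun setT (mix_lr e l B).
  apply: measurable_funD => //; apply: measurable_funM => //; exact: mlI.
have m0 y : (0 <= mix_lr e l B y)%R by rewrite addr_ge0// mulr_ge0.
have mh : measurable_fun setT (fun x : obs R => mix_lr e l B x.1).
  exact: measurableT_comp.
(* masses of the likelihood ratio on B and outside B *)
have lC : \int[G]_y (l y * \1_(~` B) y)%:E <= tau%:E.
  have mBC : measurable (~` B) by exact: measurableC.
  apply: le_trans tauB; rewrite -(integral_indicT H mBC).
  have := lGH (fun y => (\1_(~` B) y)%:E) _ _.
  under eq_integral do rewrite -EFinM mulrC.
  apply; last by move=> y; rewrite lee_fin.
  by apply/measurable_EFinP; exact: mI.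
have lsum : \int[G]_y (l y * \1_B y)%:E + \int[G]_y (l y * \1_(~` B) y)%:E = 1.
  rewrite -ge0_integralD//.
  - rewrite -[RHS]l1; apply: eq_integral => y _; rewrite -EFinD !indicE in_setC.
    by case: (y \in B); rewrite /= ?mulr0 ?mulr1 ?addr0 ?add0r.
  - by move=> y _; rewrite lee_fin.
  - by apply/measurable_EFinP; exact: mlI.
  - by move=> y _; rewrite lee_fin.
  - by apply/measurable_EFinP; apply: mlI; exact: measurableC.
have lB0 : 0 <= \int[G]_y (l y * \1_B y)%:E by apply: integral_ge0 => y _; rewrite lee_fin.
have lC0 : 0 <= \int[G]_y (l y * \1_(~` B) y)%:E by apply: integral_ge0 => y _; rewrite lee_fin.
have [p pE] : exists p : R, \int[G]_y (l y * \1_B y)%:E = p%:E.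
  move: lsum lB0 lC0; case: integral => [r _ _ _| |] //; first by exists r.
  by case: integral.
rewrite pE in lsum lB0.
have [p0 p1 pt] : [/\ 0 <= p, p <= 1 & 1 - tau <= p]%R.
  move: lsum lC lB0 lC0; case: integral => [r| |] //.
  by rewrite -EFinD => -[rp]; rewrite !lee_fin; split; lra.
have w0 : 0 <= \int[G]_y (l y ^+ 2 * \1_B y)%:E.
  by apply: integral_ge0 => y _; rewrite lee_fin mulr_ge0 ?sqr_ge0// indicE.
have [q qE] : exists q : R, \int[G]_y (l y ^+ 2 * \1_B y)%:E = q%:E.
  by move: wB w0; case: integral => [r _ _| |] //; exists r.
rewrite qE lee_fin in wB.
have ml2 : measurable_fun setT (fun y => l y ^+ 2 * \1_B y)%R.
  by apply: measurable_funM; [exact: measurable_funX|exact: mI].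
have M1 : \int[G]_y (mix_lr e l B y)%:E = (1 - e%:num + e%:num * p)%:E.
  rewrite /mix_lr; under eq_integral do rewrite EFinD EFinM.
  rewrite ge0_integralD//; last 2 first.
  - by move=> y _; rewrite mule_ge0// lee_fin.
  - by apply: emeasurable_funM => //; apply/measurable_EFinP; exact: mlI.
  rewrite ge0_integralZl//; last 2 first.
  - by apply/measurable_EFinP; exact: mlI.
  - by move=> y _; rewrite lee_fin.
  by rewrite pE integral_cst// [X in _ * X + _]probability_setT mule1.
have M2 : \int[G]_y (mix_lr e l B y ^+ 2)%:E =
   ((1 - e%:num) ^+ 2 + 2 * (1 - e%:num) * e%:num * p + e%:num ^+ 2 * q)%:E.
  rewrite (eq_integral (fun y => ((1 - e%:num) ^+ 2)%:E +
     (2 * (1 - e%:num) * e%:num)%:E * (l y * \1_B y)%:E +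
     (e%:num ^+ 2)%:E * (l y ^+ 2 * \1_B y)%:E)); last first.
    move=> y _; rewrite -!EFinM -!EFinD /mix_lr; congr EFin.
    by rewrite indicE; case: (y \in B); rewrite /= ?mulr0 ?mulr1; ring.
  have c0 : (0 <= 2 * (1 - e%:num) * e%:num)%R by rewrite !mulr_ge0.
  have q0 y : (0 <= l y ^+ 2 * \1_B y)%R by rewrite mulr_ge0 ?sqr_ge0// indicE.
  rewrite ge0_integralD//; last 4 first.
  - by move=> y _; rewrite adde_ge0// ?mule_ge0// ?lee_fin ?sqr_ge0.
  - apply: emeasurable_funD => //; apply: emeasurable_funM => //.
    by apply/measurable_EFinP; exact: mlI.
  - by move=> y _; rewrite mule_ge0// lee_fin ?sqr_ge0.
  - by apply: emeasurable_funM => //; exact/measurable_EFinP.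
  rewrite ge0_integralD//; last 2 first.
  - by move=> y _; rewrite mule_ge0// lee_fin.
  - by apply: emeasurable_funM => //; apply/measurable_EFinP; exact: mlI.
  have Zl (c : R) (f : T -> R) : (0 <= c)%R -> measurable_fun setT f ->
      (forall y, 0 <= f y)%R ->
      \int[G]_y (c%:E * (f y)%:E) = c%:E * \int[G]_y (f y)%:E.
    move=> ? ? f0; rewrite ge0_integralZl//; first exact/measurable_EFinP.
    by move=> y _; rewrite lee_fin.
  rewrite (Zl _ _ c0 (mlI _ mB) (lI0 B)) (Zl _ _ (sqr_ge0 _) ml2 q0).
  by rewrite pE qE integral_cst// [X in _ * X + _ + _]probability_setT mule1.
apply: (@two_point_lower _ _ R (obs_law G H (0%R : R)%:i01) (obs_law G H e) n
  (fun x => mix_lr e l B x.1) (1 - e%:num + e%:num * p)%R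
  ((1 - e%:num) ^+ 2 + 2 * (1 - e%:num) * e%:num * p + e%:num ^+ 2 * q)%R
  _ _ _ A mh _ _ _ _ _ _ d0 mA) => //.
- move=> g mg g0; rewrite integral_obs_law0//; last 2 first.
  + by apply: emeasurable_funM => //; exact/measurable_EFinP.
  + by move=> x; rewrite mule_ge0// lee_fin.
  under eq_integral do rewrite avg_auxM//.
  have mG := measurable_avg_aux mg g0; have G0 := avg_aux_ge0 g0.
  rewrite integral_obs_law//.
  rewrite (eq_integral (fun y => (1 - e%:num)%:E * avg_aux g y +
    e%:num%:E * (avg_aux g y * (l y * \1_B y)%:E))); last first.
    move=> y _; rewrite /mix_lr EFinD ge0_muleDr ?lee_fin ?mulr_ge0//.
    by rewrite muleC EFinM muleCA.
  rewrite ge0_integralD//; last 4 first.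
  + by move=> y _; rewrite mule_ge0.
  + exact: emeasurable_funM.
  + by move=> y _; rewrite !mule_ge0// lee_fin.
  + apply: emeasurable_funM => //; apply: emeasurable_funM => //.
    by apply/measurable_EFinP; exact: mlI.
  rewrite !ge0_integralZl//; last 2 first.
  + apply: emeasurable_funM => //.
    by apply/measurable_EFinP; exact: mlI.
  + by move=> y _; rewrite mule_ge0// lee_fin.
  apply: leeD2l; apply: lee_wpmul2l; first by rewrite lee_fin.
  apply: le_trans (lGH _ mG G0); apply: ge0_le_integral => //.
  + by move=> y _; rewrite mule_ge0// lee_fin.
  + apply: emeasurable_funM => //.
    by apply/measurable_EFinP; exact: mlI.
  + by apply: emeasurable_funM => //; exact/measurable_EFinP.
  + by move=> y _; apply: lee_wpmul2l => //; rewrite lee_fin ler_piMr.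
- rewrite integral_obs_law0//; last 2 first.
  + exact/measurable_EFinP.
  + by move=> x; rewrite lee_fin.
  by under eq_integral do rewrite avg_aux_cst; exact: M1.
- rewrite integral_obs_law0//; last 2 first.
  + by apply/measurable_EFinP; exact: measurable_funX.
  + by move=> x; rewrite lee_fin sqr_ge0.
  by under eq_integral do rewrite (avg_aux_cst (fun y => mix_lr e l B y ^+ 2)%R); exact: M2.
- have : (e%:num * (1 - tau) <= e%:num * p)%R by rewrite ler_wpM2l.
  lra.
- have h1 : ((1 - e%:num) * e%:num * p <= (1 - e%:num) * e%:num * 1)%R.
    by rewrite ler_wpM2l// mulr_ge0.
  have h2 : (e%:num ^+ 2 * q <= e%:num ^+ 2 * w)%R by rewrite ler_wpM2l// sqr_ge0.
  have h3 := sqr_ge0 (e%:num : R).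
  by rewrite !expr2 in h1 h2 h3 *; lra.
Qed.

End observations.

(** * Risk and rates *)

Section risk_bounds.
Local Open Scope ereal_scope.
Context d (T : measurableType d) (R : realType).
Implicit Types (P Q : probability T R) (S : T -> R).

Lemma risk_ge P Q S (c : \bar R) : measurable_fun setT S ->
  (forall A, measurable A -> c <= P A + Q (~` A)) -> c <= risk P Q S.
Proof.
move=> mS H; rewrite /risk; case: ifPn => _.
- apply: le_ereal_inf_tmp => _ [b _ <-].
  have -> : [set x | (b < S x)%R] = ~` [set x | (S x <= b)%R].
    by apply/seteqP; split => x /=; rewrite ltNge => /negP.
  by apply: H; apply: (@measurable_set_ler _ _ _ S (cst b)).
- apply: le_ereal_inf_tmp => _ [b _ <-].
  have -> : [set x | (S x < b)%R] = ~` [set x | (b <= S x)%R].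
    by apply/seteqP; split => x /=; rewrite ltNge => /negP.
  by apply: H; apply: (@measurable_set_ler _ _ _ (cst b) S).
Qed.

Lemma upper_tail_small P S (e : R) : measurable_fun setT S -> (0 < e)%R ->
  exists b : R, P [set x | (b <= S x)%R] <= e%:E.
Proof.
move=> mS e0.
pose X : {mfun T >-> R} := HB.pack S (isMeasurableFun.Build _ _ _ _ _ mS).
have := @cvg_ccdfy0 _ T R P X.
move=> /fine_cvgP[_ /cvgrPdist_le/(_ e e0)].
move=> [M [_ HM]].
exists (M + 2)%R.
have := HM (M + 1)%R; rewrite ltrDl => /(_ ltr01).
rewrite sub0r normrN ger0_norm; last by apply: fine_ge0; exact: measure_ge0.
move=> h; apply: (@le_trans _ _ (ccdf X (M + 1)%R)); last first.
  rewrite -[leLHS]fineK ?lee_fin; first exact: h.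
  by rewrite /ccdf; apply: fin_num_measure; exact: measurable_itv.
apply: le_measure; rewrite ?inE.
- by apply: (@measurable_set_ler _ _ _ (cst (M + 2)%R) S).
- exact: measurable_funPTI.
- by move=> x /=; rewrite in_itv/= andbT => h1; apply: lt_le_trans h1; rewrite ltrD2l ltr1n.
Qed.

Lemma risk_le1 P Q S : measurable_fun setT S -> risk P Q S <= 1.
Proof.
move=> mS; apply/lee_addgt0Pr => e e0.
have Q1 A : measurable A -> Q A <= 1 by move=> mA; exact: probability_le1.
rewrite /risk; case: ifPn => _.
- have mNS : measurable_fun setT (fun x => - S x)%R by exact: measurableT_comp.
  have [b Pb] := upper_tail_small P mNS e0.
  apply: ge_ereal_inf; exists (P [set x | (S x <= - b)%R] + Q [set x | (- b < S x)%R]).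
    by exists (- b)%R.
  rewrite addeC; apply: leeD.
    by apply: Q1; apply: (@measurable_set_ltr _ _ _ (cst (- b)%R) S).
  rewrite (_ : [set x | (S x <= - b)%R] = [set x | (b <= - S x)%R])//.
  by apply/seteqP; split => x /=; rewrite lerNr.
- have [b Pb] := upper_tail_small P mS e0.
  apply: ge_ereal_inf; exists (P [set x | (b <= S x)%R] + Q [set x | (S x < b)%R]).
    by exists b.
  rewrite addeC; apply: leeD => //.
  by apply: Q1; apply: (@measurable_set_ltr _ _ _ S (cst b)).
Qed.

Lemma risk_ge0 P Q S : 0 <= risk P Q S.
Proof.
rewrite /risk; case: ifPn => _; apply: le_ereal_inf_tmp => _ [b _ <-].
- by rewrite adde_ge0.
- by rewrite adde_ge0.
Qed.

(** If both error probabilities are small, then [S] is not stochastically smaller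
under [Q], so the risk is computed with the upper tails. *)
Lemma risk_le P Q S (b e : R) : measurable_fun setT S -> (e < 2^-1)%R ->
  P [set x | (b <= S x)%R] <= e%:E -> Q [set x | (S x < b)%R] <= e%:E ->
  risk P Q S <= (2 * e)%:E.
Proof.
move=> mS e2 Pe Qe; rewrite /risk; case: ifPn => [/asboolP ss|_].
- exfalso; have := ss b.
  have -> : [set x | (b <= S x)%R] = ~` [set x | (S x < b)%R].
    by apply/seteqP; split => x /=; rewrite leNgt => /negP.
  have mB : measurable [set x | (S x < b)%R].
    by apply: (@measurable_set_ltr _ _ _ S (cst b)).
  rewrite [X in X <= _](_ : _ = 1 - Q [set x | (S x < b)%R]); last exact: probability_setC.
  have -> : P (~` [set x | (S x < b)%R]) = P [set x | (b <= S x)%R].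
    by congr (P _); apply/seteqP; split => x /=; rewrite leNgt => /negP.
  move=> /le_trans/(_ Pe).
  have : Q [set x | (S x < b)%R] \is a fin_num by exact: fin_num_measure.
  move: Qe; case: (Q _) => // q; rewrite lee_fin => qe _.
  by rewrite -EFinB lee_fin; lra.
- apply: ge_ereal_inf; exists (P [set x | (b <= S x)%R] + Q [set x | (S x < b)%R]).
    by exists b.
  by rewrite mulr_natl mulr2n EFinD leeD.
Qed.

End risk_bounds.

Section asymptotics.
Context (R : realType).

Lemma powerlessP (P0 P1 : forall n, probability (n.-tuple (obs R)) R)
    (S : forall n, n.-tuple (obs R) -> R) :
  (forall n, measurable_fun [set: n.-tuple (obs R)] (S n)) ->
  (forall e : R, 0 < e -> \forall n \near \oo,
    forall A, measurable A -> ((1 - e)%:E <= P0 n A + P1 n (~` A))%E) ->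
  asymptotically_powerless P0 P1 S.
Proof.
move=> mS H; apply: cvg_EFin.
  apply: nearW => n; rewrite ge0_fin_numE ?risk_ge0//.
  by apply: le_lt_trans (risk_le1 _ _ (mS n)) _; exact: ltry.
apply/cvgrPdist_le => e e0; near=> n.
have Hn : forall A, measurable A -> ((1 - e)%:E <= P0 n A + P1 n (~` A))%E.
  by near: n; exact: (H e e0).
have h1 : ((1 - e)%:E <= risk (P0 n) (P1 n) (S n))%E := risk_ge (mS n) Hn.
have h2 := risk_le1 (P0 n) (P1 n) (mS n).
have h3 := risk_ge0 (P0 n) (P1 n) (S n).
move: h1 h2 h3; rewrite /=; case: risk => // r; rewrite !lee_fin/= => h1 h2 _.
by rewrite ger0_norm ?subr_ge0//; lra.
Unshelve. all: end_near. Qed.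

Lemma powerfulP (P0 P1 : forall n, probability (n.-tuple (obs R)) R)
    (S : forall n, n.-tuple (obs R) -> R) :
  (forall n, measurable_fun [set: n.-tuple (obs R)] (S n)) ->
  (forall e : R, 0 < e -> \forall n \near \oo, exists b : R,
    (P0 n [set x | (b <= S n x)%R] <= e%:E)%E /\ (P1 n [set x | (S n x < b)%R] <= e%:E)%E) ->
  asymptotically_powerful P0 P1 S.
Proof.
move=> mS H; apply: cvg_EFin.
  apply: nearW => n; rewrite ge0_fin_numE ?risk_ge0//.
  by apply: le_lt_trans (risk_le1 _ _ (mS n)) _; exact: ltry.
apply/cvgrPdist_le => e e0.
pose e' := Num.min (e / 2) 4^-1.
have e'0 : 0 < e' by rewrite /e' lt_min; apply/andP; split; [exact: divr_gt0|lra].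
have e'2 : e' < 2^-1 by rewrite gt_min; apply/orP; right; lra.
have e'e : 2 * e' <= e.
  have : e' <= e / 2 by rewrite ge_min lexx.
  lra.
near=> n.
have [b [b0 b1]] : exists b : R,
    (P0 n [set x | (b <= S n x)%R] <= e'%:E)%E /\ (P1 n [set x | (S n x < b)%R] <= e'%:E)%E.
  by near: n; exact: (H e' e'0).
have h1 := risk_le (mS n) e'2 b0 b1.
have h3 := risk_ge0 (P0 n) (P1 n) (S n).
move: h1 h3; rewrite /=; case: risk => // r; rewrite !lee_fin/= => h1 h2.
by rewrite sub0r normrN ger0_norm//; lra.
Unshelve. all: end_near. Qed.

Lemma ln_nat_cvgy : (ln n%:R : R) @[n --> \oo] --> +oo.
Proof.
apply/cvgryPge => M; near=> n.
have n0 : (0 : R) < n%:R by rewrite ltr0n; near: n; exact: nbhs_infty_gt.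
rewrite -ler_expR lnK//.
near: n; exact: nbhs_infty_ger.
Unshelve. all: end_near. Qed.

(** Exponents are linear combinations of [ln n] and [k n], and
[k n ~ a ln n] turns them into multiples of [ln n]. *)
Lemma lin_le (k : nat -> nat) (a c1 c2 g : R) :
  (k n)%:R / ln (n%:R : R) @[n --> \oo] --> a -> c1 + c2 * a < g ->
  \forall n \near \oo, c1 * ln n%:R + c2 * (k n)%:R <= g * ln (n%:R : R).
Proof.
move=> ka cg.
have h : (c1 + c2 * ((k n)%:R / ln (n%:R : R))) @[n --> \oo] --> c1 + c2 * a.
  by apply: cvgD; [exact: cvg_cst|apply: cvgM; [exact: cvg_cst|]].
near=> n.
have L0 : 0 < ln (n%:R : R).
  by near: n; move/cvgryPgt: ln_nat_cvgy; apply.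
have : c1 + c2 * ((k n)%:R / ln (n%:R : R)) <= g.
  by near: n; apply: (cvgr_le _ h).
rewrite -(ler_pM2r L0); apply: le_trans; rewrite le_eqVlt; apply/orP; left.
by apply/eqP; field; rewrite gt_eqF.
Unshelve. all: end_near. Qed.

Lemma lin_ge (k : nat -> nat) (a c1 c2 g : R) :
  (k n)%:R / ln (n%:R : R) @[n --> \oo] --> a -> g < c1 + c2 * a ->
  \forall n \near \oo, g * ln (n%:R : R) <= c1 * ln n%:R + c2 * (k n)%:R.
Proof.
move=> ka cg; have h : - c1 + - c2 * a < - g by lra.
near=> n.
have : - c1 * ln n%:R + - c2 * (k n)%:R <= - g * ln (n%:R : R).
  by near: n; exact: lin_le ka h.
by rewrite !mulNr -opprD lerN2.
Unshelve. all: end_near. Qed.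

Lemma expR_lin_small (k : nat -> nat) (a c1 c2 e : R) :
  (k n)%:R / ln (n%:R : R) @[n --> \oo] --> a -> c1 + c2 * a < 0 -> 0 < e ->
  \forall n \near \oo, expR (c1 * ln n%:R + c2 * (k n)%:R) <= e.
Proof.
move=> ka c0 e0; pose g := (c1 + c2 * a) / 2.
have cg : c1 + c2 * a < g by rewrite /g; lra.
have g0 : g < 0 by rewrite /g; lra.
near=> n.
apply: (@le_trans _ _ (expR (g * ln n%:R))).
  by rewrite ler_expR; near: n; exact: lin_le ka cg.
rewrite -[leRHS]lnK// ler_expR -ler_ndivrMl//.
by near: n; move/cvgryPge: ln_nat_cvgy; apply.
Unshelve. all: end_near. Qed.

Lemma powR_natE (n : nat) (b : R) : (0 < n)%N ->
  n%:R `^ b = expR (b * ln n%:R) :> R.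
Proof. by move=> n0; rewrite /powR pnatr_eq0 eqn0Ngt n0. Qed.

Lemma natr_expR_ln (n : nat) : (0 < n)%N -> n%:R = expR (ln n%:R) :> R.
Proof. by move=> n0; rewrite lnK// posrE ltr0n. Qed.

End asymptotics.

(** * Powerlessness above the phase curve *)

Section undetectable.
Context (R : realType) (F : R -> probability (measurableTypeR R) R).
Hypothesis expfamF : exponential_family F.
Local Notation Theta := (Theta (F 0)).
Local Notation ps := (lpsi (F 0)).
Local Notation T := (measurableTypeR R).
Context (a : R) (k : nat -> nat).
Hypothesis ka : (k n)%:R / ln (n%:R : R) @[n --> \oo] --> a.
Context (beta th : R) (eps : nat -> {i01 R}).
Hypothesis Tth : Theta th.
Hypothesis epsE : forall n : nat, (0 < n)%N -> (eps n)%:num = n%:R `^ (- beta).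

Let lr n (y : R) := expR ((th - 0) * y - (k n)%:R * (ps th - ps 0)).

(** [tau] bounds the chance that a signal is discarded by the truncation, and [w]
the truncated second moment of the likelihood ratio. *)
Lemma truncated_powerless (B : nat -> set T) (tau w : nat -> R)
    (S : forall n, n.-tuple (obs R) -> R) :
  (forall n, measurable_fun [set: n.-tuple (obs R)] (S n)) ->
  (forall n, measurable (B n)) ->
  (forall n, (convn (F th) (k n) (~` B n) <= (tau n)%:E)%E) ->
  (forall n, (\int[convn (F 0) (k n)]_y (lr n y ^+ 2 * \1_(B n) y)%:E <= (w n)%:E)%E) ->
  (forall e : R, 0 < e -> \forall n \near \oo, n%:R * ((eps n)%:num * tau n) <= e) ->
  (forall e : R, 0 < e -> \forall n \near \oo, n%:R * ((eps n)%:num ^+ 2 * w n) <= e) ->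
  asymptotically_powerless (fun n => data_law (F 0) (F th) (k n) n 0%:i01)
    (fun n => data_law (F 0) (F th) (k n) n (eps n)) S.
Proof.
move=> mS mB tauB wB small1 small2; apply: powerlessP => // e e0.
have c1 : 0 < (e / 4) / (1 + 2 / e).
  by rewrite divr_gt0// ?divr_gt0// addr_gt0// divr_gt0.
have c2 : 0 < ln (1 + e ^+ 2 / 4).
  by rewrite ln_gt0// ltrDl divr_gt0// exprn_gt0.
near=> n => A mA.
apply: le_trans (@mix_lr_lower_bound R (convn (F 0) (k n)) (convn (F th) (k n))
  (eps n) (lr n) (B n) n (tau n) (w n) e A _ _ (mB n) _ _ (tauB n) (wB n) e0 mA).
- have h1 : n%:R * ((eps n)%:num * tau n) <= (e / 4) / (1 + 2 / e).
    by near: n; exact: small1.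
  have h2 : n%:R * ((eps n)%:num ^+ 2 * w n) <= ln (1 + e ^+ 2 / 4).
    by near: n; exact: small2.
  rewrite -ler_expR lnK ?posrE ?addr_gt0 ?divr_gt0 ?exprn_gt0// in h2.
  have e3 : 0 < 1 + 2 / e by rewrite addr_gt0// divr_gt0.
  rewrite ler_pdivlMr// in h1.
  have h3 : (expR (n%:R * ((eps n)%:num ^+ 2 * w n)) - 1) / e <= e / 4.
    rewrite ler_pdivrMr//; rewrite expr2 in h2; lra.
  by rewrite lee_fin; lra.
- exact: measurable_tilt.
- by move=> y; exact: expR_ge0.
- by move=> g mg g0; apply: convn_tilt => //; exact: Theta0.
- by rewrite (convn_mgf_sub expfamF)//; [rewrite subrr expR0|exact: Theta0].
Unshelve. all: end_near. Qed.

Lemma n_eps_expR_small (m c1 c2 e : R) : 1 - m * beta + c2 * a < 0 -> 0 < e ->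
  \forall n \near \oo, n%:R * (n%:R `^ (- beta)) `^ m * expR (c2 * (k n)%:R) <= e.
Proof.
move=> c0 e0; near=> n.
have n0 : (0 < n)%N by near: n; exact: nbhs_infty_gt.
rewrite -powRrM !powR_natE// {1}(natr_expR_ln _ n0) -!expRD.
have -> : ln n%:R + - beta * m * ln n%:R + c2 * (k n)%:R =
  (1 - m * beta) * ln n%:R + c2 * (k n)%:R :> R by ring.
by near: n; exact: expR_lin_small ka c0 e0.
Unshelve. all: end_near. Qed.

(** On the half-line [th y <= th k mu] the squared likelihood ratio is at most
the tilting factor of [s] times a constant, since [2 th] lies beyond [s]; off
that half-line the tilting factor of [s] relative to [th] is large, since [s]
lies beyond [th].  Both bounds have the rate of [mu] at [s] in the exponent. *)
Lemma undetectable_powerless (S : forall n, n.-tuple (obs R) -> R) :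
  0 < a -> th != 0 ->
  undetectable_exponents (F 0) a th beta ->
  (forall n, measurable_fun [set: n.-tuple (obs R)] (S n)) ->
  asymptotically_powerless (fun n => data_law (F 0) (F th) (k n) n 0%:i01)
    (fun n => data_law (F 0) (F th) (k n) n (eps n)) S.
Proof.
move=> a0 th0 [[T2 bb]|[s [mu [Ts sth sth2 rate_s bb]]]] mS.
- apply: (@truncated_powerless (fun=> setT) (fun=> 0)
    (fun n => expR ((k n)%:R * (ps (2 * th) - 2 * ps th)))) => //.
  + by move=> n; rewrite setCT measure0.
  + move=> n; rewrite (eq_integral (fun y : T => (expR ((2 * th - 0) * y - (k n)%:R * (2 * ps th)))%:E)).
      rewrite (convn_mgf_sub expfamF)//; last exact: Theta0.
      by rewrite lee_fin ler_expR lpsi0; lra.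
    move=> y _; rewrite indicT mulr1 /lr -expRM_natl lpsi0.
    by congr (expR _)%:E; ring.
  + by move=> e e0; apply: nearW => n; rewrite !mulr0 ltW.
  + move=> e e0; near=> n.
    have n0 : (0 < n)%N by near: n; exact: nbhs_infty_gt.
    rewrite epsE// mulrA -powR_mulrn ?powR_ge0// [(k n)%:R * _]mulrC.
    near: n; apply: n_eps_expR_small => //; lra.
- pose c := th * mu - ps th.
  have mB n : measurable [set y : T | th * y <= th * ((k n)%:R * mu)].
    apply: (@measurable_set_ler _ T R (fun y => th * y) (cst (th * ((k n)%:R * mu)))) => //.
    exact: measurable_funM.
  have dc n : (k n)%:R * (c - (s * mu - ps s)) <= (k n)%:R * (c - a^-1).
    by rewrite ler_wpM2l// lerD2l lerN2.
  have aca : a * a^-1 = 1 by rewrite mulfV// gt_eqF.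
  apply: (@truncated_powerless (fun n => [set y | th * y <= th * ((k n)%:R * mu)])
    (fun n => expR ((k n)%:R * (c - a^-1)))
    (fun n => expR ((k n)%:R * (2 * c - a^-1)))) => //.
  + move=> n.
    apply: (@le_trans _ _ (convn (F th) (k n) [set y | (s - th) * ((k n)%:R * mu) <= (s - th) * y])).
      apply: le_measure; rewrite ?inE.
      * exact: measurableC.
      * apply: (@measurable_set_ler _ T R (cst ((s - th) * ((k n)%:R * mu))) (fun y => (s - th) * y)) => //.
        exact: measurable_funM.
      * move=> y /= /negP; rewrite -ltNge -subr_gt0 -mulrBr => h.
        rewrite -subr_ge0 -mulrBr.
        have th20 : 0 < th ^+ 2 by rewrite exprn_even_gt0.
        rewrite -(pmulr_rge0 _ th20).
        have -> : th ^+ 2 * ((s - th) * (y - (k n)%:R * mu)) =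
          ((s - th) * th) * (th * (y - (k n)%:R * mu)) by ring.
        by rewrite mulr_ge0// ltW.
    apply: le_trans (convn_chernoff expfamF _ _ Tth Ts) _.
    rewrite lee_fin ler_expR; have := dc n; rewrite /c; lra.
  + move=> n.
    apply: (@le_trans _ _ (\int[convn (F 0) (k n)]_y
      (expR ((s - 0) * y - (2 * (k n)%:R * ps th - (2 * th - s) * ((k n)%:R * mu))))%:E)%E).
      apply: ge0_le_integral => //.
      * by move=> y _; rewrite lee_fin mulr_ge0 ?sqr_ge0// indicE.
      * apply/measurable_EFinP; apply: measurable_funM; last exact: measurable_indic.
        by apply: measurable_funX; exact: measurable_tilt.
      * by apply/measurable_EFinP; exact: measurable_tilt.
      * move=> y _; rewrite lee_fin indicE; case: (boolP (_ \in _)) => [|_]; last first.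
          by rewrite mulr0 expR_ge0.
        move=> /set_mem /= h'; have h : 0 <= th * ((k n)%:R * mu - y) by rewrite mulrBr subr_ge0.
        rewrite mulr1 /lr -expRM_natl ler_expR lpsi0 !subr0.
        have th20 : 0 < th ^+ 2 by rewrite exprn_even_gt0.
        have : 0 <= (2 * th - s) * ((k n)%:R * mu - y).
          rewrite -(pmulr_rge0 _ th20).
          have -> : th ^+ 2 * ((2 * th - s) * ((k n)%:R * mu - y)) =
            ((2 * th - s) * th) * (th * ((k n)%:R * mu - y)) by ring.
          by rewrite mulr_ge0.
        lra.
    rewrite (convn_mgf_sub expfamF)//; last exact: Theta0.
    rewrite lee_fin ler_expR lpsi0; have := dc n; rewrite /c; lra.
  + move=> e e0; near=> n.
    have n0 : (0 < n)%N by near: n; exact: nbhs_infty_gt.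
    rewrite epsE// mulrA -[n%:R `^ (- beta)]powRr1 ?powR_ge0// [(k n)%:R * _]mulrC.
    near: n; apply: n_eps_expR_small => //; rewrite -/c in bb; lra.
  + move=> e e0; near=> n.
    have n0 : (0 < n)%N by near: n; exact: nbhs_infty_gt.
    rewrite epsE// mulrA -powR_mulrn ?powR_ge0// [(k n)%:R * _]mulrC.
    near: n; apply: n_eps_expR_small => //; rewrite -/c in bb; lra.
Unshelve. all: end_near. Qed.

End undetectable.

(** * Randomized p-values are uniform *)

Section uniform_law.
Context (R : realType).
Local Notation T := (measurableTypeR R).
Local Notation U := (uniform_prob (@ltr01 R)).
Local Open Scope ereal_scope.

Lemma uniform_probE (A : set T) : measurable A ->
  U A = lebesgue_measure (A `&` `[0%R, 1%R]%classic).
Proof.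
move=> mA; rewrite /uniform_prob integral_uniform_pdf.
rewrite (eq_integral (fun=> 1)); last first.
  move=> x; rewrite inE/= => -[_]; rewrite in_itv/= /uniform_pdf => ->.
  by rewrite subr0 invr1.
by rewrite integral_cst ?mul1e//; apply: measurableI.
Qed.

Lemma uniform_prob_le (u : R) : (0 <= u <= 1)%R -> U [set v | (v <= u)%R] = u%:E.
Proof.
move=> /andP[u0 u1]; rewrite uniform_probE; last first.
  by apply: (@measurable_set_ler _ T R id (cst u)).
have -> : [set v : T | (v <= u)%R] `&` `[0%R, 1%R]%classic = `[0%R, u]%classic.
  apply/seteqP; split => v /=; rewrite !in_itv/=.
    by move=> [vu /andP[v0 _]]; rewrite v0.
  by move=> /andP[v0 vu]; split => //; rewrite v0 (le_trans vu).
rewrite lebesgue_measure_itv/= lte_fin; case: ltP => [_|u0']; first by rewrite sube0.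
by congr EFin; apply/eqP; rewrite eq_le u0.
Qed.

Lemma uniform_prob_full (A : set T) : measurable A ->
  (forall v, 0 <= v <= 1 -> A v)%R -> U A = 1.
Proof.
move=> mA A01; rewrite uniform_probE//.
have -> : A `&` `[0%R, 1%R]%classic = `[0%R, 1%R]%classic.
  by apply/setIidPr => v /=; rewrite in_itv/= => /A01.
by rewrite lebesgue_measure_itv/= lte_fin ltr01 sube0.
Qed.

Lemma uniform_prob_empty (A : set T) : measurable A ->
  (forall v, 0 <= v <= 1 -> ~ A v)%R -> U A = 0.
Proof.
move=> mA A01; rewrite uniform_probE//.
rewrite (_ : A `&` _ = set0) ?measure0//.
apply/seteqP; split => v //= -[Av]; rewrite in_itv/= => /A01; exact.
Qed.

End uniform_law.

Section identity_variable.
Context (R : realType).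

Definition idRV : measurableTypeR R -> R := idfun.

HB.instance Definition _ :=
  @isMeasurableFun.Build _ _ _ _ idRV (@measurable_id _ _ setT).

End identity_variable.

Section randomized_tail.
Context (R : realType).
Local Notation T := (measurableTypeR R).
Local Notation U := (uniform_prob (@ltr01 R)).
Context (G : probability T R).

Definition tail (y : R) : R := fine (G [set z | y < z]).
Definition atom (y : R) : R := fine (G [set y]).
Definition rtail (x : obs R) : R := tail x.1 + x.2 * atom x.1.

Lemma pvalueE (x : obs R) : pvalue G x = 2 * Num.min (rtail x) (1 - rtail x).
Proof. by []. Qed.

Lemma measurable_ray (y : R) : measurable ([set z | y < z] : set T).
Proof. exact: (@measurable_set_ltr _ T R (cst y) id). Qed.

Lemma measurable_cray (y : R) : measurable ([set z | y <= z] : set T).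
Proof. exact: (@measurable_set_ler _ T R (cst y) id). Qed.

Lemma tailE y : G [set z | y < z] = (tail y)%:E.
Proof. by rewrite /tail fineK// fin_num_measure//; exact: measurable_ray. Qed.

Lemma atomE y : G [set y] = (atom y)%:E.
Proof. by rewrite /atom fineK// fin_num_measure//; exact: measurable_set1. Qed.

Lemma tail_ge0 y : 0 <= tail y.
Proof. by rewrite fine_ge0. Qed.

Lemma atom_ge0 y : 0 <= atom y.
Proof. by rewrite fine_ge0. Qed.

Lemma tailD_atom y : G [set z | y <= z] = (tail y + atom y)%:E.
Proof.
rewrite EFinD -tailE -atomE -measureU//.
- by congr (G _); apply/seteqP; split => z /=; rewrite le_eqVlt;
    [move=> /predU1P[->|]; [right|left]|move=> [->|->]; rewrite ?orbT ?eqxx].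
- exact: measurable_ray.
- by apply/seteqP; split => z //= -[yz zy]; rewrite zy ltxx in yz.
Qed.

Lemma tail_nonincreasing y z : y <= z -> tail z <= tail y.
Proof.
move=> yz; rewrite -lee_fin -!tailE; apply: le_measure; rewrite ?inE.
- exact: measurable_ray.
- exact: measurable_ray.
- by move=> w /=; exact: le_lt_trans.
Qed.

Lemma tailD_atom_le y z : y < z -> tail z + atom z <= tail y.
Proof.
move=> yz; rewrite -lee_fin -tailE -tailD_atom; apply: le_measure; rewrite ?inE.
- exact: measurable_cray.
- exact: measurable_ray.
- by move=> w /=; exact: lt_le_trans.
Qed.

Lemma measurable_tail : measurable_fun [set: T] tail.
Proof.
pose X : {mfun T >-> R} := @idRV R.
have -> : tail = fine \o ccdf (P := G) X.
  apply/funext => y; rewrite /tail /ccdf /distribution /pushforward /=.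
  by congr (fine (G _)); apply/seteqP; split => z /=; rewrite in_itv/= andbT.
by apply: measurableT_comp => //; exact: ccdf_measurable.
Qed.

Lemma measurable_atom : measurable_fun [set: T] atom.
Proof.
pose X : {mfun T >-> R} := @idRV R.
have -> : atom = pmf (P := G) X.
  by apply/funext => y.
exact: pmf_measurable.
Qed.

Lemma measurable_rtail : measurable_fun setT rtail.
Proof.
apply: measurable_funD; first exact: measurableT_comp measurable_tail _.
apply: measurable_funM => //; exact: measurableT_comp measurable_atom _.
Qed.

Lemma measurable_pvalue : measurable_fun setT (pvalue G).
Proof.
rewrite (_ : pvalue G = fun x => 2 * Num.min (rtail x) (1 - rtail x))//.
apply: measurable_funM => //; apply: measurable_minr; first exact: measurable_rtail.
apply: measurable_funB => //; exact: measurable_rtail.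
Qed.

(** The quantile is the infimum of the points with tail at most [s]; the last two
inequalities are the right continuity of the tail and its left limit there. *)
Lemma tail_quantile (s : R) : 0 < s -> s < 1 -> exists y : R,
  [/\ forall z, y < z -> tail z <= s, forall z, z < y -> s < tail z,
      tail y <= s & s <= tail y + atom y].
Proof.
move=> s0 s1; pose X : {mfun T >-> R} := @idRV R.
have tailX y : ccdf (P := G) X y = (tail y)%:E.
  rewrite -tailE /ccdf /distribution /pushforward /=.
  by congr (G _); apply/seteqP; split => z /=; rewrite in_itv/= andbT.
have [y1 y1s] : exists y, tail y <= s.
  have /fine_cvgP[_ /cvgrPdist_le/(_ s s0) [M [_ HM]]] := cvg_ccdfy0 (P := G) X.
  exists (M + 1); have := HM (M + 1); rewrite ltrDl ltr01 => /(_ isT).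
  by rewrite /= tailX/= sub0r normrN ger0_norm// tail_ge0.
have [y0 y0s] : exists y, s < tail y.
  have s1' : 0 < (1 - s) / 2 by lra.
  have /fine_cvgP[_ /cvgrPdist_le/(_ _ s1') [M [_ HM]]] := cvg_ccdfNy1 (P := G) X.
  exists (M - 1); have := HM (M - 1); rewrite ltrBlDr ltrDl ltr01 => /(_ isT).
  rewrite /= tailX/= => h; have := le_trans (ler_norm _) h; lra.
pose E := [set y | tail y <= s].
have E0 : E !=set0 by exists y1.
have Elb : has_lbound E.
  exists y0 => y /= ys; rewrite leNgt; apply/negP => yy0.
  by have := le_lt_trans ys y0s; rewrite ltNge tail_nonincreasing// ltW.
pose y := inf E.
have above z : y < z -> tail z <= s.
  move=> yz; have [w Ew wz] := inf_lt E0 yz.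
  by apply: le_trans Ew; apply: tail_nonincreasing; exact: ltW.
have below z : z < y -> s < tail z.
  move=> zy; rewrite ltNge; apply/negP => Ez.
  by have := ge_inf Elb Ez; rewrite leNgt zy.
have u0 n : 0 < (n.+1%:R^-1 : R) by rewrite invr_gt0.
have unear (e : R) : 0 < e -> exists n, n.+1%:R^-1 < e.
  move=> e0; exists (Num.truncn e^-1); rewrite invf_plt ?posrE//; exact: truncnS_gt.
exists y; split => //.
- pose A n := [set z : T | y + n.+1%:R^-1 < z].
  have mA n : measurable (A n) by exact: measurable_ray.
  have UA : \bigcup_n A n = [set z | y < z].
    apply/seteqP; split => z /=.
      by move=> [n _ /=]; apply: lt_trans; rewrite ltrDl.
    by rewrite -subr_gt0 => /unear[n un]; exists n => //; rewrite /A /= -ltrBrDl.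
  have ndA : nondecreasing_seq A.
    move=> m n mn; apply/subsetPset => z /=; apply: le_lt_trans.
    by rewrite lerD2l lef_pV2 ?posrE// ler_nat.
  have := @nondecreasing_cvg_mu _ _ _ G A mA _ ndA.
  rewrite UA => /(_ (measurable_ray y)) cv.
  rewrite -lee_fin -tailE -(cvg_lim _ cv)//; apply: lime_le.
    by apply/cvg_ex; eexists; exact: cv.
  apply: nearW => n /=; rewrite tailE lee_fin; apply: above; rewrite ltrDl//.
- pose A n := [set z : T | y - n.+1%:R^-1 < z].
  have mA n : measurable (A n) by exact: measurable_ray.
  have IA : \bigcap_n A n = [set z | y <= z].
    apply/seteqP; split => z /=.
      move=> Az; rewrite leNgt; apply/negP => zy.
      move: zy; rewrite -subr_gt0 => /unear[n un].
      have := Az n I; rewrite /A /= ltrBlDr => h; rewrite ltrBrDl in un.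
      by have := lt_trans h un; rewrite ltxx.
    by move=> yz n _ /=; apply: lt_le_trans yz; rewrite ltrBlDr ltrDl.
  have niA : nonincreasing_seq A.
    move=> m n mn; apply/subsetPset => z /=; apply: le_lt_trans.
    by rewrite lerD2l lerN2 lef_pV2 ?posrE// ler_nat.
  have A0 : (G (A 0%N) < +oo)%E by rewrite tailE ltry.
  have := @nonincreasing_cvg_mu _ _ _ G A A0 mA _ niA.
  rewrite IA => /(_ (measurable_cray y)) cv.
  rewrite -lee_fin -tailD_atom -(cvg_lim _ cv)//; apply: lime_ge.
    by apply/cvg_ex; eexists; exact: cv.
  apply: nearW => n /=; rewrite tailE lee_fin; apply/ltW/below.
  by rewrite ltrBlDr ltrDl.
Qed.

(** Given [Y = z], the event is sure for [z] beyond the quantile, impossible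
before it, and at the quantile [y] itself has probability [c], where
[tail y + c * atom y = s]. *)
Lemma rtail_uniform H (s : R) : 0 < s -> s < 1 ->
  obs_law G H 0%:i01 [set x | rtail x <= s] = s%:E.
Proof.
move=> s0 s1; have [y [above below tys sty]] := tail_quantile s0 s1.
have mB : measurable [set x | rtail x <= s].
  apply: (@measurable_set_ler _ _ R rtail (cst s)) => //; exact: measurable_rtail.
rewrite -(integral_indicT _ mB) integral_obs_law0//; last first.
  by apply/measurable_EFinP; exact: measurable_indic.
pose c := if atom y == 0 then 1 else (s - tail y) / atom y.
have ty0 := tail_ge0 y; have ay0 := atom_ge0 y.
have cE : tail y + c * atom y = s.
  rewrite /c; case: eqVneq => [a0|a0]; last by rewrite divfK//; ring.
  by move: sty; rewrite a0 mulr0 addr0 => sty; apply/eqP; rewrite eq_le tys.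
have c01 : 0 <= c <= 1.
  rewrite /c; case: eqVneq => [a0|a0]; first by rewrite ler01 lexx.
  have a1 : 0 < atom y by rewrite lt_neqAle eq_sym a0.
  by rewrite divr_ge0 ?subr_ge0// ler_pdivrMr// mul1r; lra.
have mv z : measurable ([set v | tail z + v * atom z <= s] : set T).
  apply: (@measurable_set_ler _ T R (fun v => tail z + v * atom z) (cst s)) => //.
  by apply: measurable_funD => //; exact: measurable_funM.
have avgE z : avg_aux (fun x => (\1_[set x | rtail x <= s] x)%:E) z =
    U [set v | tail z + v * atom z <= s].
  rewrite /avg_aux -(integral_indicT _ (mv z)); apply: eq_integral => v _.
  by rewrite !indicE; congr ((_ : bool)%:R)%:E; apply/idP/idP; rewrite !inE.
rewrite (eq_integral (fun z : T => (\1_[set z : T | y < z] z)%:E + c%:E * (\1_([set y] : set T) z)%:E)%E); last first.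
  move=> z _; rewrite avgE !indicE.
  have [zy|yz|->] := ltgtP z y.
  - rewrite !memNset ?mule0 ?adde0//=; last 2 first.
    + by move=> zy'; move: zy; rewrite zy' ltxx.
    + by apply/negP; rewrite -leNgt ltW.
    rewrite uniform_prob_empty// => v /andP[v0 v1] /=; apply/negP; rewrite -ltNge.
    by apply: lt_le_trans (below _ zy) _; rewrite lerDl mulr_ge0// atom_ge0.
  - rewrite mem_set// memNset ?mule0 ?adde0//=; last first.
      by move=> zy'; move: yz; rewrite zy' ltxx.
    rewrite uniform_prob_full// => v /andP[v0 v1] /=.
    have [w yw wz] : exists2 w, y < w & w < z by exists ((y + z) / 2); lra.
    apply: le_trans (above _ yw); apply: le_trans (tailD_atom_le wz).
    by rewrite lerD2l ler_piMl// atom_ge0.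
  - have -> : (y \in ([set z | y < z] : set T)) = false by rewrite memNset//= ltxx.
    have -> : (y \in ([set y] : set T)) = true by exact: mem_set.
    rewrite /= mule1 add0e.
    have [a0|a0] := eqVneq (atom y) 0.
      rewrite uniform_prob_full//; first by rewrite /c a0 eqxx.
      by move=> v _ /=; rewrite a0 mulr0 addr0.
    have a1 : 0 < atom y by rewrite lt_neqAle eq_sym a0.
    rewrite -(uniform_prob_le c01); congr (U _).
    apply/seteqP; split => v /=; rewrite /c (negbTE a0) ler_pdivlMr//; lra.
have mI (C : set T) : measurable C -> measurable_fun setT (fun z => (\1_C z : R)%:E).
  by move=> mC; apply/measurable_EFinP; exact: measurable_indic.
rewrite ge0_integralD//; last 3 first.
- by apply: mI; exact: measurable_ray.
- by move=> z _; rewrite mule_ge0// lee_fin; case/andP: c01.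
- by apply: emeasurable_funM => //; apply: mI; exact: measurable_set1.
rewrite ge0_integralZl//; last 2 first.
- by apply: mI; exact: measurable_set1.
- by rewrite lee_fin; case/andP: c01.
rewrite !integral_indicT//; last exact: measurable_ray.
by rewrite tailE atomE -EFinM -EFinD cE.
Qed.

Lemma rtail_uniform_lt H (s : R) : 0 < s -> s < 1 ->
  obs_law G H 0%:i01 [set x | rtail x < s] = s%:E.
Proof.
move=> s0 s1.
have mle u : measurable [set x | rtail x <= u].
  by apply: (@measurable_set_ler _ _ R rtail (cst u)) => //; exact: measurable_rtail.
have mlt : measurable [set x | rtail x < s].
  by apply: (@measurable_set_ltr _ _ R rtail (cst s)) => //; exact: measurable_rtail.
apply/eqP; rewrite eq_le; apply/andP; split.
  rewrite -(rtail_uniform H s0 s1); apply: le_measure; rewrite ?inE//.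
  by move=> x /=; exact: ltW.
apply/lee_addgt0Pr => e e0.
pose u := Num.max (s - e) (s / 2).
have u0 : 0 < u by rewrite lt_max; apply/orP; right; lra.
have us : u < s by rewrite gt_max; apply/andP; split; lra.
have ue : s - e <= u by rewrite le_max lexx.
apply: (@le_trans _ _ (u + e)%:E); first by rewrite lee_fin; lra.
rewrite EFinD leeD2r// -(rtail_uniform H u0 (lt_trans us s1)).
apply: le_measure; rewrite ?inE//.
by move=> x /= xu; exact: le_lt_trans us.
Qed.

Lemma pvalue_uniform H (t : R) : 0 < t -> t < 1 ->
  obs_law G H 0%:i01 [set x | pvalue G x <= t] = t%:E.
Proof.
move=> t0 t1; set P := obs_law _ _ _.
have mle : measurable [set x | rtail x <= t / 2].
  by apply: (@measurable_set_ler _ _ R rtail (cst (t / 2))) => //; exact: measurable_rtail.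
have mlt : measurable [set x | rtail x < 1 - t / 2].
  by apply: (@measurable_set_ltr _ _ R rtail (cst (1 - t / 2))) => //; exact: measurable_rtail.
have -> : [set x | pvalue G x <= t] =
    [set x | rtail x <= t / 2] `|` ~` [set x | rtail x < 1 - t / 2].
  apply/seteqP; split => x /=; rewrite pvalueE.
    move=> h; have : Num.min (rtail x) (1 - rtail x) <= t / 2 by lra.
    rewrite ge_min => /orP[?|?]; [by left|right; apply/negP; rewrite -leNgt; lra].
  move=> h; suff : Num.min (rtail x) (1 - rtail x) <= t / 2 by lra.
  rewrite ge_min; apply/orP; case: h => [?|/negP]; first by left.
  by rewrite -leNgt => ?; right; lra.
rewrite measureU//; last 2 first.
- exact: measurableC.
- apply/seteqP; split => x //= -[h] /negP; rewrite -leNgt; lra.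
rewrite [X in (_ + X)%E](_ : _ = (1 - P [set x | (rtail x < 1 - t / 2)%R])%E); last first.
  exact: probability_setC.
transitivity ((t / 2)%:E + (1 - (1 - t / 2)%:E))%E.
  by congr (_ + (_ - _))%E; [apply: rtail_uniform|apply: rtail_uniform_lt]; lra.
by rewrite -EFinB -EFinD; congr EFin; field.
Qed.

End randomized_tail.

(** * Higher criticism through counts of small p-values *)

Section higher_criticism.
Context (R : realType).
Local Notation T := (measurableTypeR R).
Context (G : probability T R).

Definition ostat n (x : n.-tuple (obs R)) (i : nat) : R :=
  (sort <=%R [seq pvalue G xi | xi <- x])`_i.

Definition hc_term n (x : n.-tuple (obs R)) (i : nat) : R :=
  (i%:R - n%:R * ostat x i.-1) /
  Num.sqrt (n%:R * ostat x i.-1 * (1 - ostat x i.-1)).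

Lemma HC_E n (x : n.-tuple (obs R)) :
  HC G x = \big[Num.max/hc_term x 1%N]_(1 <= i < n./2.+1) hc_term x i.
Proof. by []. Qed.

Definition small_p (t : R) : set (obs R) := [set z | pvalue G z <= t].

Lemma measurable_small_p t : measurable (small_p t).
Proof.
apply: (@measurable_set_ler _ _ R (pvalue G) (cst t)) => //.
exact: measurable_pvalue.
Qed.

Lemma hits_count n (x : n.-tuple (obs R)) t :
  hits R (small_p t) x = (count (<= t) [seq pvalue G xi | xi <- x])%:R :> R.
Proof.
rewrite count_map -sum1_count big_tuple natr_sum /hits [RHS]big_mkcond/=.
apply: eq_bigr => i _; rewrite indicE /small_p.
by case: ifPn => h; [rewrite mem_set|rewrite memNset//=; exact/negP].
Qed.

Lemma ostat_leE n (x : n.-tuple (obs R)) i t : (i < n)%N ->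
  (ostat x i <= t) = (i.+1%:R <= hits R (small_p t) x).
Proof.
move=> ilt; rewrite hits_count ler_nat -(count_sort <=%R) /ostat.
set s := sort _ _.
have ss : sorted <=%R s by apply: sort_sorted; exact: le_total.
have sz : size s = n by rewrite size_sort size_map size_tuple.
apply/idP/idP => h; last exact: nth_count_le.
rewrite ltnNge; apply/negP => h'.
have : (count (<= t) s <= i < size s)%N by rewrite h' sz.
by move=> /(nth_count_gt 0 ss); rewrite ltNge h.
Qed.

Lemma ostat_mem n (x : n.-tuple (obs R)) i : (i < n)%N ->
  exists j, ostat x i = pvalue G (tnth x j).
Proof.
move=> ilt; have : ostat x i \in [seq pvalue G xi | xi <- x].
  by rewrite -(mem_sort <=%R) mem_nth// size_sort size_map size_tuple.
by move=> /mapP[y /tnthP[j ->] ->]; exists j.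
Qed.

Lemma measurable_ostat n i : (i < n)%N ->
  measurable_fun [set: n.-tuple (obs R)] (@ostat n ^~ i).
Proof.
move=> ilt; apply: (measurability (@RGenOInfty.G R)) => [|/= _ [_] [t] -> <-].
  exact: RGenOInfty.measurableE.
rewrite setTI (_ : _ @^-1` _ = [set x | hits R (small_p t) x < i.+1%:R]).
  apply: (@measurable_set_ltr _ _ R (@hits _ _ R n (small_p t)) (cst i.+1%:R)) => //.
  apply: measurable_hits; exact: measurable_small_p.
have E (x : n.-tuple (obs R)) : (t < ostat x i) = (hits R (small_p t) x < i.+1%:R).
  by rewrite !ltNge ostat_leE.
by apply/seteqP; split => x /=; rewrite in_itv/= andbT E.
Qed.

(** Brings the reciprocal under the scope of the measurability of power
functions; both sides are 0 for nonpositive [y]. *)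
Lemma inv_sqrtE (y : R) : (Num.sqrt y)^-1 = (Num.max y 0) `^ (- 2^-1).
Proof.
rewrite powRN powR12_sqrt ?le_max ?lexx ?orbT//; congr (_^-1).
by case: (leP y 0) => // y0; rewrite sqrtr0 ler0_sqrtr.
Qed.

Lemma measurable_hc_term n i : (0 < i <= n)%N ->
  measurable_fun [set: n.-tuple (obs R)] (@hc_term n ^~ i).
Proof.
move=> /andP[i0 iltn]; have ilt : (i.-1 < n)%N by rewrite prednK.
have mo := measurable_ostat ilt.
rewrite /hc_term; under eq_fun do rewrite inv_sqrtE.
apply: measurable_funM.
  by apply: measurable_funB => //; exact: measurable_funM.
apply: (measurableT_comp (measurable_powR _)).
apply: measurable_maxr => //; apply: measurable_funM; first exact: measurable_funM.
exact: measurable_funB.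
Qed.

Lemma measurable_HC n : measurable_fun [set: n.-tuple (obs R)] (@HC R G n).
Proof.
have [n0|n0] := posnP n.
  subst n; rewrite (_ : @HC R G 0 = cst (HC G [tuple]))//.
  by apply/funext => x; rewrite (tuple0 x).
rewrite (_ : @HC R G n = fun x =>
  \big[Num.max/hc_term x 1%N]_(1 <= i < n./2.+1) hc_term x i)//.
have hs : {subset index_iota 1 n./2.+1 <= [pred i | 0 < i <= n]%N}.
  move=> i; rewrite mem_index_iota !inE ltnS => /andP[-> /=] /leq_trans; apply.
  by rewrite -divn2 leq_div.
elim: (index_iota _ _) hs => [_|i s IH hs].
  by under eq_fun do rewrite big_nil; exact: measurable_hc_term.
under eq_fun do rewrite big_cons; apply: measurable_maxr.
  by apply: measurable_hc_term; apply: hs; rewrite inE eqxx.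
by apply: IH => j js; apply: hs; rewrite inE js orbT.
Qed.

Lemma HC_ge_term n (x : n.-tuple (obs R)) i : (0 < i)%N -> (i <= n./2)%N ->
  hc_term x i <= HC G x.
Proof.
move=> i0 i2; rewrite HC_E; apply: le_bigmax_seq => //.
by rewrite mem_index_iota i0 ltnS.
Qed.

Lemma HC_ge_exists n (x : n.-tuple (obs R)) (c : R) : (2 <= n)%N -> c <= HC G x ->
  exists i, [/\ (0 < i)%N, (i <= n./2)%N & c <= hc_term x i].
Proof.
move=> n2; rewrite HC_E.
have one : (1 <= n./2)%N by rewrite half_gt0.
have : {subset index_iota 1 n./2.+1 <= [pred i | 0 < i <= n./2]%N}.
  by move=> i; rewrite mem_index_iota !inE ltnS.
elim: (index_iota _ _) => [_|i s IH hs].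
  by rewrite big_nil => c1; exists 1%N.
rewrite big_cons le_max => /orP[ci|]; last first.
  by apply: IH => j js; apply: hs; rewrite inE js orbT.
have := hs i; rewrite !inE eqxx => /(_ isT) /andP[? ?].
by exists i.
Qed.

(** The [j]-th smallest p-value is at most [t], and the [j]-th term decreases in
it.  A vanishing p-value has to be excluded: it would make the denominator, hence
by convention the whole term, equal to 0. *)
Lemma HC_lower n (x : n.-tuple (obs R)) (t : R) j : 0 < t -> t < 1 ->
  (0 < j)%N -> (j <= n./2)%N -> j%:R <= hits R (small_p t) x -> n%:R * t <= j%:R ->
  (forall i, 0 < pvalue G (tnth x i)) ->
  (j%:R - n%:R * t) / Num.sqrt (n%:R * t) <= HC G x.
Proof.
move=> t0 t1 j0 j2 jN ntj pp.
have jn : (j <= n)%N by apply: leq_trans j2 _; rewrite -divn2 leq_div.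
have n0 : (0 : R) < n%:R by rewrite ltr0n; exact: leq_trans jn.
have jlt : (j.-1 < n)%N by rewrite prednK.
apply: le_trans (HC_ge_term x j0 j2); rewrite /hc_term.
have qt : ostat x j.-1 <= t by rewrite ostat_leE// prednK.
have q0 : 0 < ostat x j.-1 by have [l ->] := ostat_mem x jlt.
set q := ostat x j.-1 in qt q0 *.
have d0 : 0 < n%:R * q * (1 - q) by rewrite !mulr_gt0// subr_gt0; exact: le_lt_trans t1.
have dd : n%:R * q * (1 - q) <= n%:R * t.
  apply: (@le_trans _ _ (n%:R * q)).
    by rewrite ler_piMr ?mulr_ge0 ?(ltW n0) ?(ltW q0)//; lra.
  by rewrite ler_wpM2l// ltW.
apply: (@le_trans _ _ ((j%:R - n%:R * t) / Num.sqrt (n%:R * q * (1 - q)))).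
  rewrite ler_wpM2l ?subr_ge0// lef_pV2 ?posrE ?sqrtr_gt0//; last by rewrite mulr_gt0.
  by rewrite ler_wsqrtr.
rewrite ler_wpM2r ?invr_ge0 ?sqrtr_ge0// lerD2l lerN2 ler_wpM2l//; exact: ltW.
Qed.

(** Rounding the maximizing order statistic up to a multiple of [n^-1] leaves
finitely many events.  Below [n^-1] this grid is too coarse; there the p-value
is compared with [n^-1] itself if it is above [c^-1 / n], and with [c^-1 / n]
otherwise. *)
Lemma HC_upper n (x : n.-tuple (obs R)) (c : R) : (2 <= n)%N -> 4 <= c -> c <= HC G x ->
  [\/ 1 <= hits R (small_p (c^-1 / n%:R)) x,
      Num.sqrt (c / 2) <= hits R (small_p (n%:R^-1)) x |
      exists m, [/\ (2 <= m)%N, (m < n)%N &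
        m%:R + c * Num.sqrt m%:R / 4 <= hits R (small_p (m%:R / n%:R)) x]].
Proof.
move=> n2 c4 /(HC_ge_exists n2)[i [i0 i2 ci]].
have c0 : 0 < c by exact: lt_le_trans c4.
have iN : (i <= n)%N by apply: leq_trans i2 _; rewrite -divn2 leq_div.
have n0 : (0 : R) < n%:R by rewrite ltr0n; exact: leq_trans n2.
have ilt : (i.-1 < n)%N by rewrite prednK.
have i2R : 2 * i%:R <= n%:R :> R.
  rewrite -natrM ler_nat; apply: leq_trans (leq_mul (leqnn 2) i2) _.
  by rewrite mul2n -{2}(odd_double_half n) leq_addl.
move: ci; rewrite /hc_term; set q := ostat x i.-1 => ci.
have hq t : q <= t -> i%:R <= hits R (small_p t) x.
  by rewrite /q ostat_leE// prednK.
have [qs|qs] := leP q (c^-1 / n%:R).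
  apply: Or31; apply: le_trans (hq _ qs); by rewrite ler1n.
have q0 : 0 < q by apply: lt_trans qs; rewrite divr_gt0 ?invr_gt0.
have nq0 : 0 < n%:R * q by rewrite mulr_gt0.
have den0 : 0 < Num.sqrt (n%:R * q * (1 - q)).
  rewrite lt_neqAle sqrtr_ge0 andbT; apply/eqP => e0.
  by move: ci; rewrite -e0 invr0 mulr0 leNgt c0.
rewrite ler_pdivlMr// in ci.
have num0 : n%:R * q < i%:R.
  by rewrite -subr_gt0; apply: lt_le_trans ci; rewrite mulr_gt0.
have q2 : 2 * q <= 1.
  by rewrite -(ler_pM2l n0) mulr1; lra.
have ci' : n%:R * q + c * Num.sqrt (n%:R * q / 2) <= i%:R.
  rewrite -lerBrDl; apply: le_trans ci.
  rewrite ler_wpM2l ?(ltW c0)// ler_wsqrtr// ler_wpM2l ?(ltW nq0)//; lra.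
have [qn|qn] := leP q n%:R^-1.
  apply: Or32; apply: le_trans (hq _ qn); apply: le_trans ci'.
  apply: (@le_trans _ _ (c * Num.sqrt (n%:R * q / 2))); last by rewrite lerDr ltW.
  have cnq : c^-1 / 2 <= n%:R * q / 2.
    rewrite ler_wpM2r// mulrC; rewrite ltr_pdivrMr// in qs; exact: ltW.
  apply: (@le_trans _ _ (c * Num.sqrt (c^-1 / 2))); last first.
    by rewrite ler_wpM2l ?(ltW c0)// ler_wsqrtr.
  have cE : c = Num.sqrt (c ^+ 2) by rewrite sqrtr_sqr ger0_norm// ltW.
  rewrite [X in _ <= X * _]cE -sqrtrM ?sqr_ge0//.
  by rewrite ler_wsqrtr// expr2 mulrA mulfK ?gt_eqF.
have nq1 : 1 < n%:R * q by rewrite mulrC -ltr_pdivrMr// mul1r.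
pose m := (Num.truncn (n%:R * q)).+1.
have mge : n%:R * q < m%:R by exact: truncnS_gt.
have mle : m%:R - 1 <= n%:R * q.
  by rewrite /m -natr1 addrK; rewrite truncn_le; exact: ltW.
have m2 : (2 <= m)%N.
  by rewrite -(ltr_nat R); exact: lt_trans mge.
have mn : (m < n)%N.
  rewrite -(ltr_nat R); apply: (@le_lt_trans _ _ (n%:R * q + 1)); first by lra.
  have : 2 <= i%:R :> R by rewrite ler_nat -(ltr_nat R); exact: lt_trans num0.
  lra.
apply: Or33; exists m; split => //.
have qm : q <= m%:R / n%:R by rewrite ler_pdivlMr// mulrC ltW.
apply: le_trans (hq _ qm); apply: le_trans ci'.
have m2R : 2 <= m%:R :> R by rewrite ler_nat.
have s1 : Num.sqrt m%:R / 2 <= Num.sqrt (n%:R * q / 2).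
  have -> : Num.sqrt m%:R / 2 = Num.sqrt (m%:R / 4) :> R.
    have -> : m%:R / 4 = m%:R * (2^-1) ^+ 2 :> R by rewrite expr2; field.
    by rewrite sqrtrM// sqrtr_sqr ger0_norm.
  by rewrite ler_wsqrtr//; lra.
have s2 : c * (Num.sqrt m%:R / 2) <= c * Num.sqrt (n%:R * q / 2).
  by rewrite ler_wpM2l// ltW.
have s3 : 1 <= Num.sqrt m%:R :> R by rewrite -[leLHS]sqrtr1 ler_wsqrtr//; lra.
have s4 : 4 * 1 <= c * Num.sqrt m%:R by rewrite ler_pM.
lra.
Qed.

End higher_criticism.

(** * Higher criticism under the null *)

Section null_tail.
Context (R : realType).
Local Notation T := (measurableTypeR R).

Lemma expR_quadratic (x : R) : 0 <= x -> x <= 3 / 4 -> expR x <= 1 + x + 4 * x ^+ 2.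
Proof.
move=> x0 x34; have x1 : 0 < 1 - x by lra.
apply: (@le_trans _ _ (1 - x)^-1).
  rewrite -[leLHS]invrK lef_pV2 ?posrE ?invr_gt0 ?expR_gt0// -expRN.
  exact: expR_ge1Dx.
rewrite -[leLHS]mul1r ler_pdivrMr//.
have : 0 <= x ^+ 2 * (3 - 4 * x) by rewrite mulr_ge0 ?sqr_ge0//; lra.
lra.
Qed.

Context (G H : probability T R) (n : nat).
Let P : probability (obs R) R := obs_law G H 0%:i01.
Let null_chernoff t lam c : 0 < t -> t < 1 -> 0 < lam ->
  (iid P n [set x | (c <= hits R (small_p G t) x)%R] <=
   (expR (n%:R * (t * (expR lam - 1)) - lam * c))%:E)%E.
Proof.
move=> t0 t1 l0; have mS := measurable_small_p G t.
rewrite (_ : [set x | _] = [set x | lam * c <= lam * hits R (small_p G t) x]); last first.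
  by apply/seteqP; split=> x /=; rewrite ler_pM2l.
apply: le_trans (hits_chernoff P n lam c mS) _.
by rewrite /P /small_p pvalue_uniform.
Qed.

(** A union bound over the events of [HC_upper], each by the Chernoff bound of
[hits_chernoff] with parameter [ln c], [1] and [m^(-1/2)] respectively. *)
Lemma HC_null_tail (c : R) : (2 <= n)%N -> 4 <= c ->
  (iid P n [set x | (c <= HC G x)%R] <=
   (expR (1 - ln c) + expR (expR 1 - 1 - Num.sqrt (c / 2)) + n%:R * expR (4 - c / 4))%:E)%E.
Proof.
move=> n2 c4; have c0 : 0 < c by lra.
have n0 : (0 : R) < n%:R by rewrite ltr0n; exact: leq_trans n2.
have n1 : (1 : R) < n%:R by rewrite ltr1n.
pose A1 := [set x : n.-tuple (obs R) | (1 <= hits R (small_p G (c^-1 / n%:R)) x)%R].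
pose A2 := [set x : n.-tuple (obs R) |
  (Num.sqrt (c / 2) <= hits R (small_p G (n%:R^-1)) x)%R].
pose A3 m := if (2 <= m)%N then [set x : n.-tuple (obs R) |
  (m%:R + c * Num.sqrt m%:R / 4 <= hits R (small_p G (m%:R / n%:R)) x)%R] else set0.
have mh b t : measurable [set x : n.-tuple (obs R) | (b <= hits R (small_p G t) x)%R].
  apply: (@measurable_set_ler _ _ R (cst b) (@hits _ _ R n (small_p G t))) => //.
  by apply: measurable_hits; exact: measurable_small_p.
have mA3 m : measurable (A3 m) by rewrite /A3; case: ifP => _ //; exact: mh.
have mU : measurable (\big[setU/set0]_(m < n) A3 m) by exact: bigsetU_measurable.
apply: (@le_trans _ _ (iid P n (A1 `|` A2 `|` \big[setU/set0]_(m < n) A3 m))).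
  apply: le_measure; rewrite ?inE.
  - apply: (@measurable_set_ler _ _ R (cst c) (@HC R G n)) => //; exact: measurable_HC.
  - apply: measurableU => //; apply: measurableU; exact: mh.
  - move=> x /= /(HC_upper n2 c4)[h|h|[m [m2 mn h]]]; [by left; left|by left; right|right].
    by rewrite -bigcup_mkord; exists m => //=; rewrite /A3 m2.
apply: le_trans (measureU2 _ _ _) _ => //; first by apply: measurableU; exact: mh.
rewrite !EFinD; apply: leeD.
  apply: le_trans (measureU2 _ _ _) _ => //; [exact: mh|exact: mh|apply: leeD].
  - apply: le_trans (null_chernoff _ _ _ (_ : 0 < ln c)) _.
    + by rewrite divr_gt0 ?invr_gt0.
    + rewrite ltr_pdivrMr// mul1r; apply: lt_trans n1; rewrite invf_lt1//; lra.
    + by rewrite ln_gt0//; lra.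
    + rewrite lee_fin ler_expR lnK ?posrE// mulr1 lerB//.
      have -> : n%:R * (c^-1 / n%:R * (c - 1)) = 1 - c^-1.
        by field; rewrite !gt_eqF.
      by rewrite gerBl invr_ge0 ltW.
  - apply: le_trans (null_chernoff _ _ _ (ltr01)) _.
    + by rewrite invr_gt0.
    + by rewrite invf_lt1.
    + by rewrite lee_fin ler_expR mulrA mulfV ?gt_eqF// !mul1r.
apply: le_trans (Boole_inequality _ (fun m _ => mA3 m)) _.
rewrite mulr_natl -[n in _ *+ n]card_ord -sumr_const -sumEFin; apply: lee_sum => m _.
rewrite /A3; case: ifPn => m2; last by rewrite measure0 lee_fin expR_ge0.
have m2R : 2 <= (m : nat)%:R :> R by rewrite ler_nat.
have m0 : 0 < (m : nat)%:R :> R by lra.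
set s := Num.sqrt _.
have s0 : 0 < s by rewrite sqrtr_gt0.
have s2 : s ^+ 2 = (m : nat)%:R by rewrite sqr_sqrtr// ltW.
have sm : (4 / 3) <= s.
  have : (4 / 3) ^+ 2 <= s ^+ 2 by rewrite s2; lra.
  by rewrite ler_pXn2r// ?nnegrE ?(ltW s0)//; lra.
apply: le_trans (null_chernoff _ _ _ (_ : 0 < s^-1)) _.
- by rewrite divr_gt0.
- by rewrite ltr_pdivrMr// mul1r ltr_nat.
- by rewrite invr_gt0.
rewrite lee_fin ler_expR.
have e : expR s^-1 <= 1 + s^-1 + 4 * s^-1 ^+ 2.
  apply: expR_quadratic; first by rewrite invr_ge0 ltW.
  by rewrite -[3 / 4]invrK lef_pV2 ?posrE ?invf_div.
have -> : n%:R * ((m : nat)%:R / n%:R * (expR s^-1 - 1)) = s ^+ 2 * (expR s^-1 - 1).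
  by rewrite s2; field; rewrite gt_eqF.
have -> : s^-1 * ((m : nat)%:R + c * s / 4) = s + c / 4.
  by rewrite -s2; field; rewrite gt_eqF.
have : s ^+ 2 * (expR s^-1 - 1) <= s ^+ 2 * (s^-1 + 4 * s^-1 ^+ 2).
  rewrite ler_wpM2l ?sqr_ge0//; lra.
have -> : s ^+ 2 * (s^-1 + 4 * s^-1 ^+ 2) = s + 4 by field; rewrite gt_eqF.
lra.
Qed.
End null_tail.

(** At the level [8 ln n] the union over the grid costs
[n * expR (4 - 2 ln n)]. *)
Lemma HC_null_vanishes (R : realType) (G H : nat -> probability (measurableTypeR R) R) (e : R) :
  0 < e -> \forall n \near \oo,
  (iid (obs_law (G n) (H n) (0%R : R)%:i01) n [set x | (8 * ln n%:R <= HC (G n) x)%R] <= e%:E)%E.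
Proof.
move=> e0.
have e3 : 0 < e / 3 by rewrite divr_gt0.
have lnbig (b : R) : \forall n \near \oo, b <= ln n%:R.
  by have := @ln_nat_cvgy R => /cvgryPge/(_ b).
near=> n.
have n2 : (2 <= n)%N by near: n; exact: nbhs_infty_ge.
have n0 : (0 < n)%N by exact: leq_trans n2.
have l1 : 1 <= ln n%:R :> R by near: n; exact: lnbig.
have l0 : 0 < 8 * ln n%:R :> R by lra.
apply: le_trans (HC_null_tail (G n) (H n) n2 (_ : 4 <= 8 * ln n%:R)) _; first lra.
rewrite lee_fin.
suff : [/\ expR (1 - ln (8 * ln n%:R)) <= e / 3,
  expR (expR 1 - 1 - Num.sqrt (8 * ln n%:R / 2)) <= e / 3 &
  n%:R * expR (4 - 8 * ln n%:R / 4) <= e / 3].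
  by move=> [? ? ?]; lra.
have ee : e / 3 = expR (ln (e / 3)) by rewrite lnK.
split.
- rewrite ee ler_expR.
  suff : 1 - ln (e / 3) <= ln (8 * ln n%:R) by lra.
  rewrite -ler_expR lnK ?posrE//.
  apply: (@le_trans _ _ (ln n%:R)); last by lra.
  by near: n; exact: lnbig.
- rewrite ee ler_expR.
  suff : expR 1 - 1 - ln (e / 3) <= Num.sqrt (8 * ln n%:R / 2) by lra.
  apply: le_trans (ler_norm _) _.
  rewrite -sqrtr_sqr ler_wsqrtr//.
  apply: (@le_trans _ _ (ln n%:R)); last by lra.
  by near: n; exact: lnbig.
- rewrite {1}natr_expR_ln// -expRD ee ler_expR.
  suff : 4 - ln (e / 3) <= ln n%:R by lra.
  by near: n; exact: lnbig.
Unshelve. all: by end_near. Qed.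

(** * Higher criticism under the alternative *)

Section small_pvalues.
Context (R : realType).
Local Notation T := (measurableTypeR R).
Local Notation U := (uniform_prob (@ltr01 R)).
Implicit Types G H : probability T R.

Lemma obs_lawE G H (e : {i01 R}) (A : set (obs R)) : measurable A ->
  (obs_law G H e A = (1 - e%:num)%:E * obs_law G H (0%R : R)%:i01 A
    + (e%:num)%:E * \int[H]_y avg_aux (fun x => (\1_A x)%:E) y)%E.
Proof.
move=> mA; have mI : measurable_fun setT (fun x : obs R => (\1_A x : R)%:E).
  by apply/measurable_EFinP; exact: measurable_indic.
have I0 (x : obs R) : (0 <= (\1_A x : R)%:E)%E by rewrite lee_fin.
rewrite -(integral_indicT (obs_law G H e) mA).
rewrite -(integral_indicT (obs_law G H (0%R : R)%:i01) mA).
by rewrite integral_obs_law0// integral_obs_law.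
Qed.

(** The two-sided p-value is at most twice either tail beyond [y], and one of
the two lies within the half-line. *)
Lemma pvalue_far G (s c b y v : R) : s != 0 -> 0 <= v <= 1 ->
  (G [set z : R | (c <= s * z)%R] <= b%:E)%E -> c <= s * y ->
  pvalue G (y, v) <= 2 * b.
Proof.
move=> s0 /andP[v0 v1] Gb cy; rewrite pvalueE ler_pM2l// ge_min /rtail/=.
have va : v * atom G y <= atom G y by rewrite ler_piMl// atom_ge0.
have va0 : 0 <= v * atom G y by rewrite mulr_ge0// atom_ge0.
have mB : measurable [set z : T | (c <= s * z)%R].
  apply: (@measurable_set_ler _ T R (cst c) (fun z => s * z)) => //.
  exact: measurable_funM.
case: (ltgtP s 0) s0 => // [sn|sp] _; apply/orP; [right|left].
- have : (G [set z : T | (z <= y)%R] <= b%:E)%E.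
    apply: le_trans Gb; apply: le_measure; rewrite ?inE//.
      by apply: (@measurable_set_ler _ T R id (cst y)).
    by move=> z /= zy; apply: le_trans cy _; rewrite ler_nM2l.
  rewrite (_ : [set z : T | _] = ~` [set z | (y < z)%R]); last first.
    by apply/seteqP; split=> z /=; [move=> h; apply/negP; rewrite -leNgt|move/negP; rewrite -leNgt].
  rewrite [X in (X <= _)%E](_ : _ = 1 - G [set z | (y < z)%R])%E; last first.
    by apply: probability_setC; exact: measurable_ray.
  by rewrite tailE -EFinB lee_fin; lra.
- suff : tail G y + atom G y <= b by lra.
  rewrite -lee_fin -tailD_atom; apply: le_trans Gb; apply: le_measure; rewrite ?inE//.
    exact: measurable_cray.
  by move=> z /= yz; apply: le_trans cy _; rewrite ler_pM2l.
Qed.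

Lemma obs_law_small_p G H (e : {i01 R}) (s c b w : R) : s != 0 ->
  0 < 2 * b -> 2 * b < 1 ->
  (G [set z : R | (c <= s * z)%R] <= b%:E)%E ->
  (w%:E <= H [set z : R | (c <= s * z)%R])%E ->
  (((1 - e%:num) * (2 * b) + e%:num * w)%:E <= obs_law G H e (small_p G (2 * b)))%E.
Proof.
move=> s0 b0 b1 Gb Hw; have mS := measurable_small_p G (2 * b).
have mB : measurable [set z : T | (c <= s * z)%R].
  apply: (@measurable_set_ler _ T R (cst c) (fun z => s * z)) => //.
  exact: measurable_funM.
rewrite obs_lawE// {1}/small_p pvalue_uniform// EFinD !EFinM; apply: leeD => //.
apply: lee_wpmul2l; first by rewrite lee_fin.
apply: le_trans Hw _; rewrite -(integral_indicT H mB).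
have mI : measurable_fun setT (fun x : obs R => (\1_(small_p G (2 * b)) x : R)%:E).
  by apply/measurable_EFinP; exact: measurable_indic.
have I0 (x : obs R) : (0 <= (\1_(small_p G (2 * b)) x : R)%:E)%E by rewrite lee_fin.
apply: ge0_le_integral => //.
- by apply/measurable_EFinP; exact: measurable_indic.
- exact: measurable_avg_aux.
move=> y _; rewrite indicE; case: (boolP (y \in _)) => [|_]; last exact: avg_aux_ge0.
rewrite inE/= => cy; rewrite /avg_aux.
have m1 : measurable [set v : T | small_p G (2 * b) (y, v)].
  rewrite -[X in measurable X]setTI; exact: (pair1_measurable y).
rewrite (eq_integral (fun v : T => (\1_[set v | small_p G (2 * b) (y, v)] v)%:E)); last first.
  by move=> v _; rewrite !indicE; congr (_%:R%:E); apply/idP/idP; rewrite !inE.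
rewrite [leRHS](integral_indicT U m1).
by rewrite [leRHS](uniform_prob_full m1)// => v v01; exact: (pvalue_far s0 v01 Gb cy).
Qed.

(** A p-value is almost surely positive under the null, being uniform; the
domination hypothesis with [h] positive carries the null event over to [H]. *)
Lemma obs_law_pvalue0 G H (e : {i01 R}) (h : T -> R) :
  measurable_fun setT h -> (forall y, 0 < h y) ->
  (forall g : T -> \bar R, measurable_fun setT g -> (forall y, 0 <= g y)%E ->
     \int[H]_y (g y * (h y)%:E) <= \int[G]_y g y)%E ->
  (obs_law G H e (small_p G 0) = 0)%E.
Proof.
move=> mh h0 dom; have mS := measurable_small_p G 0.
have mI : measurable_fun setT (fun x : obs R => (\1_(small_p G 0) x : R)%:E).
  by apply/measurable_EFinP; exact: measurable_indic.
have I0 (x : obs R) : (0 <= (\1_(small_p G 0) x : R)%:E)%E by rewrite lee_fin.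
have null0 : (obs_law G H (0%R : R)%:i01 (small_p G 0) = 0)%E.
  apply/eqP; rewrite eq_le measure_ge0 andbT; apply/lee_addgt0Pr => t t0.
  rewrite add0e; have [t1|t1] := leP 1 t.
    apply: (@le_trans _ _ 1%E); last by rewrite lee_fin.
    exact: probability_le1.
  rewrite -(pvalue_uniform G H t0 t1); apply: le_measure; rewrite ?inE//.
    exact: measurable_small_p.
  by move=> x /= /le_trans; apply; exact: ltW.
rewrite obs_lawE// null0 mule0 add0e.
set u := avg_aux _.
have mu : measurable_fun setT u by exact: measurable_avg_aux.
have u0 y : (0 <= u y)%E by exact: avg_aux_ge0.
have uh : (\int[H]_y (u y * (h y)%:E) = 0)%E.
  apply/eqP; rewrite eq_le; apply/andP; split; last first.
    by apply: integral_ge0 => y _; rewrite mule_ge0// lee_fin ltW.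
  by apply: le_trans (dom u mu u0) _; rewrite -(integral_obs_law0 G H mI I0) integral_indicT// null0.
have muh : measurable_fun setT (fun y => u y * (h y)%:E)%E.
  by apply: emeasurable_funM => //; exact/measurable_EFinP.
have : ae_eq H setT (fun y => u y * (h y)%:E)%E (cst 0)%E.
  apply/(ae_eq_integral_abs _ _ muh) => //; rewrite -[RHS]uh.
  by apply: eq_integral => y _; rewrite gee0_abs// mule_ge0// lee_fin ltW.
move=> aeuh.
have aeu : ae_eq H setT u (cst 0)%E.
  apply: filterS aeuh => y /= /(_ I) /eqP; rewrite mule_eq0 => /orP[/eqP ->//|].
  by rewrite eqe gt_eqF.
rewrite (_ : (\int[H]_y u y = 0)%E) ?mule0//.
have := (ae_eq_integral_abs H measurableT mu).2 aeu.
by under eq_integral do rewrite gee0_abs//.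
Qed.

End small_pvalues.

Section lower_tail.
Context d (T : measurableType d) (R : realType).

Lemma expR_le_quadratic (x : R) : 0 <= x -> expR (- x) <= 1 - x + x ^+ 2.
Proof.
move=> x0; rewrite expRN; apply: (@le_trans _ _ (1 + x)^-1).
  by rewrite lef_pV2 ?posrE ?expR_gt0//; [exact: expR_ge1Dx|lra].
rewrite -[leLHS]mul1r ler_pdivrMr; last by lra.
have : 0 <= x ^+ 3 by exact: exprn_ge0.
have -> : (1 - x + x ^+ 2) * (1 + x) = 1 + x ^+ 3 by ring.
lra.
Qed.

(** [L] is the surplus measured in standard deviations; the Chernoff parameter
[- (8 s)^-1] keeps the quadratic term below [1/64]. *)
Lemma hits_lower_tail (P : probability T R) n A (t v L : R) : measurable A ->
  0 <= v -> 1 <= n%:R * t -> ((t + v / 2)%:E <= P A)%E ->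
  L * Num.sqrt (n%:R * t) <= n%:R * v ->
  (iid P n [set x | (hits R A x <= n%:R * t + n%:R * v / 4)%R] <=
   (expR (1 - L / 64))%:E)%E.
Proof.
move=> mA v0 nt1 PA Lv; set s := Num.sqrt _ in Lv.
have s1 : 1 <= s by rewrite -sqrtr1 ler_wsqrtr.
have s0 : 0 < s by lra.
have s2 : s ^+ 2 = n%:R * t by rewrite sqr_sqrtr//; lra.
pose x := (8 * s)^-1.
have x0 : 0 < x by rewrite invr_gt0; lra.
have x8 : x <= 1 / 8 by rewrite /x div1r lef_pV2 ?posrE//; lra.
have xs : x * s = 1 / 8 by rewrite /x; field; rewrite gt_eqF.
set c := n%:R * t + _.
rewrite (_ : [set y | _] = [set y | - x * c <= - x * hits R A y]); last first.
  by apply/seteqP; split=> y /=; rewrite ler_nM2l// oppr_lt0.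
apply: le_trans (hits_chernoff P n (- x) c mA) _.
rewrite lee_fin ler_expR.
have pA : t + v / 2 <= fine (P A).
  by rewrite -lee_fin fineK// fin_num_measure.
have e1 : expR (- x) - 1 <= - x + x ^+ 2 by have := expR_le_quadratic (ltW x0); lra.
have e2 : - x + x ^+ 2 <= 0.
  have : x * x <= x * (1 / 8) by rewrite ler_pM2l.
  by rewrite expr2; lra.
have e3 : fine (P A) * (expR (- x) - 1) <= (t + v / 2) * (- x + x ^+ 2).
  apply: (@le_trans _ _ (fine (P A) * (- x + x ^+ 2))).
    by rewrite ler_wpM2l// fine_ge0.
  by rewrite ler_wnM2r.
have e4 : n%:R * (fine (P A) * (expR (- x) - 1)) <= n%:R * ((t + v / 2) * (- x + x ^+ 2)).
  by rewrite ler_wpM2l.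
have nv0 : 0 <= n%:R * v by rewrite mulr_ge0.
have h1 : x * (x * (n%:R * v)) <= 1 / 8 * (x * (n%:R * v)).
  by rewrite ler_wpM2r// mulr_ge0// ltW.
have h2 : x * (L * s) <= x * (n%:R * v) by rewrite ler_pM2l.
have h3 : x * (L * s) = L / 8 by rewrite mulrCA xs; ring.
have h4 : x * x * (n%:R * t) = 1 / 64.
  rewrite -s2 (_ : x * x * s ^+ 2 = (x * s) ^+ 2); last by ring.
  by rewrite xs; lra.
have h5 : 0 <= x * (n%:R * v) by rewrite mulr_ge0// ltW.
apply: le_trans (lerD e4 (lexx _)) _; rewrite /c.
set X := x * (n%:R * v) in h1 h2 h5.
have -> : n%:R * ((t + v / 2) * (- x + x ^+ 2)) - - x * (n%:R * t + n%:R * v / 4) =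
  x * x * (n%:R * t) - X / 4 + x * X / 2 by rewrite /X; field.
rewrite h4; lra.
Qed.

Lemma hits_null (P : probability T R) n A : measurable A -> P A = 0%E ->
  iid P n [set x | 1 <= hits R A x] = 0%E.
Proof.
move=> mA PA; apply/eqP; rewrite eq_le measure_ge0 andbT.
apply/lee_addgt0Pr => e e0; rewrite add0e.
pose lam := Num.max 1 (- ln e).
have l0 : 0 < lam by rewrite lt_max ltr01.
rewrite (_ : [set y | _] = [set y | lam * 1 <= lam * hits R A y]); last first.
  by apply/seteqP; split=> y /=; rewrite ler_pM2l.
apply: le_trans (hits_chernoff P n lam 1 mA) _.
rewrite PA/= mul0r mulr0 sub0r mulr1 lee_fin -[leRHS]lnK// ler_expR lerNl.
by rewrite le_max lexx orbT.
Qed.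

End lower_tail.

Lemma leq_half_mul4 n : (2 <= n)%N -> (n <= n./2 * 4)%N.
Proof.
rewrite -half_gt0 => h; rewrite -[leqLHS]odd_double_half -muln2.
by apply: (@leq_trans (1 + n./2 * 2)); [rewrite leq_add2r leq_b1|lia].
Qed.

Section HC_large.
Context (R : realType).
Local Notation T := (measurableTypeR R).

(** Higher criticism looks only at the smaller half of the p-values, so the count
of small ones is capped at [n./2]; the cap is harmless because [t <= 1/8]. *)
Lemma HC_ge_of_hits (G : probability T R) n (x : n.-tuple (obs R)) (t v L : R) :
  (2 <= n)%N -> 0 < t -> t <= 1 / 8 -> 0 <= v -> v <= 1 -> 1 <= n%:R * t ->
  L * Num.sqrt (n%:R * t) <= n%:R * v ->
  n%:R * t + n%:R * v / 4 < hits R (small_p G t) x ->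
  (forall i, 0 < pvalue G (tnth x i)) ->
  L / 8 <= HC G x.
Proof.
move=> n2 t0 t8 v0 v1 nt1 Lv; rewrite hits_count; set N := count _ _ => hN pp.
have n0 : (0 : R) < n%:R by rewrite ltr0n; exact: leq_trans n2.
have nv0 : 0 <= n%:R * v by rewrite mulr_ge0// ltW.
have s0 : 0 < Num.sqrt (n%:R * t) by rewrite sqrtr_gt0; lra.
have nt8 : n%:R * t <= n%:R / 8 by rewrite -[n%:R / 8]mulr1 -mulrA ler_pM2l//; lra.
have nvn : n%:R * v <= n%:R by rewrite ler_piMr// ltW.
have half : n%:R / 4 <= n./2%:R :> R.
  by rewrite ler_pdivrMr// -natrM ler_nat leq_half_mul4.
have N0 : (0 < N)%N by rewrite -(ltr0n R); lra.
pose j := minn N n./2.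
have jE : j = N \/ j = n./2 by rewrite /j /minn; case: ifP; [left|right].
have jN : (j <= N)%N by exact: geq_minl.
have j2 : (j <= n./2)%N by exact: geq_minr.
have j0 : (0 < j)%N by rewrite /j leq_min N0 half_gt0.
have jge : n%:R * v / 8 <= j%:R - n%:R * t by case: jE => ->; lra.
apply: le_trans (@HC_lower _ G n x t j t0 _ j0 j2 _ _ pp); last first.
- lra.
- by rewrite hits_count ler_nat.
- lra.
rewrite ler_pdivlMr//; lra.
Qed.

End HC_large.

(** * Power below the phase curve *)

Section concentration.
Context (R : realType) (F : R -> probability (measurableTypeR R) R).
Hypothesis expfamF : exponential_family F.
Local Notation Theta := (Theta (F 0)).
Local Notation ps := (lpsi (F 0)).
Local Notation T := (measurableTypeR R).

(** Chernoff's inequality at [s + h] and [s - h]: differentiability of [ps] at [s]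
makes the exponent at most [- h d / 2] for small [h]. *)
Lemma convn_concentration (s d : R) : interior_pt Theta s -> 0 < d ->
  exists2 eta : R, 0 < eta & forall k : nat,
    (convn (F s) k [set y : R | (k%:R * d <= `|y - k%:R * dpsi (F 0) s|)%R] <=
     (2 * expR (- eta * k%:R))%:E)%E.
Proof.
move=> Is d0; set m := dpsi _ _.
have [u [v [Tu Tv us sv]]] := Is.
have Ts := interior_pt_Theta Is.
have [dm _] := lpsi_derive Is.
have d2 : 0 < d / 2 by rewrite divr_gt0.
have [h0 h00 near_s] := is_derive_near dm d2; rewrite -/m in near_s.
pose h := Num.min (h0 / 2) (Num.min (s - u) (v - s)).
have hp : 0 < h by rewrite !lt_min divr_gt0//= !subr_gt0 us.
have hu : u <= s - h by rewrite lerBrDr -lerBrDl !ge_min lexx orbT.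
have hv : s + h <= v by rewrite -lerBrDl !ge_min lexx !orbT.
have hh0 : h < h0 by rewrite !gt_min; apply/orP; left; lra.
have Tp : Theta (s + h) by apply: (Theta_between Tu Tv) => //; lra.
have Tm : Theta (s - h) by apply: (Theta_between Tu Tv) => //; lra.
have Np : ps (s + h) - ps s <= h * m + d / 2 * h.
  have := near_s h; rewrite gtr0_norm// => /(_ hh0).
  by move=> /(le_trans (ler_norm _)); lra.
have Nm : ps (s - h) - ps s <= - h * m + d / 2 * h.
  have := near_s (- h); rewrite normrN gtr0_norm// => /(_ hh0).
  by move=> /(le_trans (ler_norm _)); lra.
exists (h * d / 2); first by rewrite divr_gt0// mulr_gt0.
move=> k; have k0 : 0 <= k%:R :> R by [].
have mA (t c : R) : measurable [set y : T | c <= (t - s) * y].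
  apply: (@measurable_set_ler _ T R (cst c) (fun y => (t - s) * y)) => //.
  exact: measurable_funM.
pose A1 := [set y : T | h * (k%:R * (m + d)) <= (s + h - s) * y].
pose A2 := [set y : T | - h * (k%:R * (m - d)) <= (s - h - s) * y].
apply: (@le_trans _ _ (convn (F s) k (A1 `|` A2))).
  apply: le_measure; rewrite ?inE.
  - apply: (@measurable_set_ler _ T R (cst (k%:R * d)) (fun y => `|y - k%:R * m|)) => //.
    by apply: measurableT_comp => //; exact: measurable_funB.
  - by apply: measurableU; exact: mA.
  - move=> y /=; rewrite ler_normr => /orP[] hy; [left|right]; rewrite /A1/A2/=.
      have := ler_wpM2l (ltW hp) hy; lra.
    have := ler_wpM2l (ltW hp) hy; lra.
apply: le_trans (measureU2 _ (mA _ _) (mA _ _)) _.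
apply: le_trans (leeD (convn_chernoff expfamF _ _ Ts Tp) (convn_chernoff expfamF _ _ Ts Tm)) _.
set X := expR (- (h * d / 2) * k%:R); have -> : 2 * X = X + X by ring.
rewrite EFinD /X; apply: leeD; rewrite lee_fin ler_expR.
- have := ler_wpM2l k0 Np; lra.
- have := ler_wpM2l k0 Nm; lra.
Qed.

(** On the event the tilting factor from [s] to [t] is at least its smallest value
over sums within [k * d] of [k * m]. *)
Lemma convn_tilt_mass (s t m d : R) k : Theta s -> Theta t ->
  ((expR (- k%:R * ((s - t) * m - ps s + ps t + `|s - t| * d)))%:E *
     convn (F s) k [set y : R | (`|y - k%:R * m| < k%:R * d)%R] <=
   convn (F t) k [set y : R | (`|y - k%:R * m| < k%:R * d)%R])%E.
Proof.
move=> Ts Tt; set A := [set y : R | _].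
have mA : measurable (A : set T).
  apply: (@measurable_set_ltr _ T R (fun y => `|y - k%:R * m|) (cst (k%:R * d))) => //.
  by apply: measurableT_comp => //; exact: measurable_funB.
have mI : measurable_fun [set: T] (fun y => (\1_A y : R)%:E).
  by apply/measurable_EFinP; exact: measurable_indic.
rewrite -[leRHS](integral_indicT (convn (F t) k) mA).
apply: le_trans (convn_tilt expfamF _ Ts Tt mI _); last by move=> y; rewrite lee_fin.
rewrite -(integral_indicT (convn (F s) k) mA) -ge0_integralZl//.
apply: ge0_le_integral => //.
- by apply: emeasurable_funM => //; exact: measurable_cst.
- by apply: emeasurable_funM => //; apply/measurable_EFinP; exact: measurable_tilt.
move=> y _; rewrite indicE; case: (boolP (y \in A)) => [|_]; last by rewrite mule0 mul0e.
rewrite inE /A/= mule1 mul1e lee_fin ler_expR => yA.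
have : (s - t) * (y - k%:R * m) <= `|s - t| * (k%:R * d).
  apply: le_trans (ler_norm _) _; rewrite normrM ler_wpM2l//; exact: ltW.
lra.
Qed.

End concentration.

(** The numerical conditions of [HC_alternative_tail] at the level [t], with
[expR L] for the sample size, [K] for the number of summands and [g] for a
positive lower bound on the exponent of the standardized surplus. *)
Lemma small_p_exponents (R : realType) (L K q r beta g e : R) :
  let t := 2 * expR (- K * q) in let w := 2^-1 * expR (- K * r) in
  1 <= L -> 0 < g -> 512 / g ^+ 2 <= L -> expR ((r - q) * K) <= 1 / 32 ->
  q * K <= L -> g * L <= (1 / 2 - beta) * L + (q / 2 - r) * K ->
  e = expR (- beta * L) -> e <= 1 -> w <= 1 ->
  [/\ t <= 1 / 8, e * w <= 1, 1 <= expR L * t,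
    64 * L * Num.sqrt (expR L * t) <= expR L * (e * w) &
    t + e * w / 2 <= (1 - e) * t + e * w].
Proof.
move=> t w L1 g0 Lg rq qK gK eE e1 w1.
have e0 : 0 <= e by rewrite eE expR_ge0.
have w0 : 0 < w by rewrite mulr_gt0// expR_gt0.
have tw : t <= w / 8.
  have -> : t = 2 * (expR (- K * r) * expR ((r - q) * K)).
    by rewrite -expRD /t; congr (_ * expR _); ring.
  have := ler_wpM2l (expR_ge0 (- K * r)) rq; rewrite /w; clear; lra.
split.
- by clear -tw w1; lra.
- by rewrite mulr_ile1// ltW.
- have : 1 <= expR (L - K * q) by rewrite -expR0 ler_expR; clear -qK; lra.
  rewrite expRD -mulNr /t; clear; lra.
- have Lexp : 256 * L <= expR (g * L).
    have gL0 : 0 <= g * L by rewrite mulr_ge0 ?(ltW g0)//; clear -L1; lra.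
    apply: le_trans (expR_ge1Dxn 1%N gL0).
    have g20 : 0 < g ^+ 2 by rewrite exprn_gt0.
    rewrite ler_pdivrMr// in Lg.
    have L0 : 0 <= L by clear -L1; lra.
    have := ler_wpM2r L0 Lg.
    have -> : (2`!%:R : R) = 2 by [].
    have -> : (g * L) ^+ 2 = L * g ^+ 2 * L by ring.
    clear; lra.
  have sq : Num.sqrt (expR L * t) <= 2 * expR ((L - K * q) / 2).
    rewrite -[leRHS]ger0_norm ?mulr_ge0 ?expR_ge0// -sqrtr_sqr ler_wsqrtr//.
    rewrite exprMn -expRM_natl /t.
    have -> : 2 * ((L - K * q) / 2) = L + - K * q by field.
    have := expR_gt0 (L + - K * q); rewrite expRD; clear; lra.
  have -> : expR L * (e * w) = 2^-1 * expR ((L - K * q) / 2) *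
      expR ((1 / 2 - beta) * L + (q / 2 - r) * K).
    rewrite eE /w.
    transitivity (2^-1 * (expR L * expR (- beta * L) * expR (- K * r))); first by ring.
    by rewrite -[RHS]mulrA -!expRD; congr (_ * expR _); field.
  apply: (@le_trans _ _ (64 * L * (2 * expR ((L - K * q) / 2)))).
    by rewrite ler_wpM2l// mulr_ge0//; clear -L1; lra.
  have gK' : expR (g * L) <= expR ((1 / 2 - beta) * L + (q / 2 - r) * K).
    by rewrite ler_expR.
  have := ler_wpM2l (expR_ge0 ((L - K * q) / 2)) (le_trans Lexp gK'); clear; lra.
- have : e * (w / 2 - t) >= 0 by rewrite mulr_ge0//; clear -tw w0; lra.
  clear; lra.
Qed.

(** Outside the event that some p-value vanishes, which is null, and the event
that there are too few small p-values, [HC_ge_of_hits] applies. *)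
Lemma HC_alternative_tail (R : realType) (G H : probability (measurableTypeR R) R)
    (e : {i01 R}) (h : measurableTypeR R -> R) n (t v L : R) :
  measurable_fun setT h -> (forall y, 0 < h y) ->
  (forall g : measurableTypeR R -> \bar R, measurable_fun setT g -> (forall y, 0 <= g y)%E ->
     \int[H]_y (g y * (h y)%:E) <= \int[G]_y g y)%E ->
  (2 <= n)%N -> 0 < t -> t <= 1 / 8 -> 0 <= v -> v <= 1 -> 1 <= n%:R * t ->
  L * Num.sqrt (n%:R * t) <= n%:R * v ->
  ((t + v / 2)%:E <= obs_law G H e (small_p G t))%E ->
  (iid (obs_law G H e) n [set x | (HC G x < L / 8)%R] <= (expR (1 - L / 64))%:E)%E.
Proof.
move=> mh h0 dom n2 t0 t8 v0 v1 nt1 Lv Qp.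
have mS u := measurable_small_p G u.
have mH u : measurable_fun setT (@hits _ _ R n (small_p G u)) by exact: measurable_hits.
pose A1 := [set x : n.-tuple (obs R) |
  (hits R (small_p G t) x <= n%:R * t + n%:R * v / 4)%R].
pose A2 := [set x : n.-tuple (obs R) | (1 <= hits R (small_p G 0) x)%R].
have mA1 : measurable A1 by exact: (@measurable_set_ler _ _ R _ (cst _)).
have mA2 : measurable A2 by exact: (@measurable_set_ler _ _ R (cst _)).
apply: (@le_trans _ _ (iid (obs_law G H e) n (A1 `|` A2))).
  apply: le_measure; rewrite ?inE.
  - apply: (@measurable_set_ltr _ _ R (@HC R G n) (cst (L / 8))) => //; exact: measurable_HC.
  - exact: measurableU.
  - move=> x /= HCx.
    have [hA1|hA1] := leP (hits R (small_p G t) x) (n%:R * t + n%:R * v / 4); first by left.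
    right; rewrite /A2/= leNgt; apply/negP => hits0; move: HCx; apply/negP; rewrite -leNgt.
    apply: (HC_ge_of_hits n2 t0 t8 v0 v1 nt1 Lv hA1) => i.
    rewrite ltNge; apply/negP => pi0; move: hits0; apply/negP; rewrite -leNgt /hits.
    by rewrite (bigD1 i)//= indicE mem_set// lerDl; exact: sumr_ge0.
apply: le_trans (measureU2 _ mA1 mA2) _.
rewrite [X in (_ + X)%E](_ : _ = 0)%E; last first.
  by apply: hits_null (mS 0) _; exact: (obs_law_pvalue0 e mh h0 dom).
rewrite adde0; exact: (hits_lower_tail (mS t) v0 nt1 Qp Lv).
Qed.

Section detectable.
Context (R : realType) (F : R -> probability (measurableTypeR R) R).
Hypothesis expfamF : exponential_family F.
Local Notation Theta := (Theta (F 0)).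
Local Notation ps := (lpsi (F 0)).
Local Notation T := (measurableTypeR R).
Context (a : R) (k : nat -> nat).
Hypothesis ka : (k n)%:R / ln (n%:R : R) @[n --> \oo] --> a.
Context (beta th : R) (eps : nat -> {i01 R}).
Hypothesis Tth : Theta th.
Hypothesis epsE : forall n : nat, (0 < n)%N -> (eps n)%:num = n%:R `^ (- beta).

(** On the half-line the sums typical of [F s] are found, and their probability
under [F th] is the tilting factor up to the constant [1/2]. *)
Lemma far_mass (s d : R) : 0 < a -> interior_pt Theta s -> 0 < d ->
  \forall n \near \oo,
    ((2^-1 * expR (- (k n)%:R * ((s - th) * dpsi (F 0) s - ps s + ps th + `|s - th| * d)))%:E <=
     convn (F th) (k n) [set y : R | ((k n)%:R * (s * dpsi (F 0) s - `|s| * d) <= s * y)%R])%E.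
Proof.
move=> a0 Is d0; have [eta eta0 conc] := convn_concentration expfamF Is d0.
have Ts := interior_pt_Theta Is.
near=> n; set m := dpsi _ _; set r := _ + `|s - th| * d.
have small : expR (0 * ln n%:R + - eta * (k n)%:R) <= 1 / 4.
  by near: n; apply: (expR_lin_small ka) => //; rewrite add0r mulNr oppr_lt0 mulr_gt0.
rewrite mul0r add0r in small.
pose A := [set y : R | (`|y - (k n)%:R * m| < (k n)%:R * d)%R].
have mA : measurable (A : set T).
  apply: (@measurable_set_ltr _ T R (fun y => `|y - (k n)%:R * m|) (cst ((k n)%:R * d))) => //.
  by apply: measurableT_comp => //; exact: measurable_funB.
have mB : measurable [set y : T | ((k n)%:R * (s * m - `|s| * d) <= s * y)%R].
  apply: (@measurable_set_ler _ T R (cst ((k n)%:R * (s * m - `|s| * d))) (fun y => s * y)) => //.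
  exact: measurable_funM.
have half : (2^-1%:E <= convn (F s) (k n) A)%E.
  rewrite -[A]setCK [leRHS](_ : _ = 1 - convn (F s) (k n) (~` A))%E; last first.
    by apply: probability_setC; exact: measurableC.
  have -> : ~` A = [set y : R | ((k n)%:R * d <= `|y - (k n)%:R * m|)%R].
    by apply/seteqP; split=> y /=; [move/negP; rewrite -leNgt|move=> h; apply/negP; rewrite -leNgt].
  apply: (@le_trans _ _ (1 - (2 * expR (- eta * (k n)%:R))%:E)%E); last first.
    by apply: leeB.
  by rewrite -EFinB lee_fin; lra.
apply: (@le_trans _ _ (convn (F th) (k n) A)); last first.
  apply: le_measure; rewrite ?inE// => y /= yA.
  have : - s * (y - (k n)%:R * m) <= `|s| * ((k n)%:R * d).
    apply: le_trans (ler_norm _) _; rewrite normrM normrN ler_wpM2l//; exact: ltW.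
  lra.
apply: le_trans (convn_tilt_mass expfamF m d (k n) Ts Tth).
by rewrite mulrC EFinM; apply: lee_wpmul2l; rewrite ?lee_fin ?expR_ge0.
Unshelve. all: by end_near. Qed.

Lemma detectable_powerful :
  0 < a -> detectable_exponents (F 0) a th beta ->
  asymptotically_powerful (fun n => data_law (F 0) (F th) (k n) n 0%:i01)
    (fun n => data_law (F 0) (F th) (k n) n (eps n))
    (fun n => HC (convn (F 0) (k n)) (n := n)).
Proof.
move=> a0 [s [d [Is sth d0 /=]]].
set m := dpsi _ _; pose q := s * m - `|s| * d - ps s.
pose r := (s - th) * m - ps s + ps th + `|s - th| * d.
rewrite -/q -/r => -[bqr rq q1].
have Ts := interior_pt_Theta Is.
have s0 : s != 0 by apply: contraTneq sth => ->; rewrite mul0r ltxx.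
have [g g0 g2] : exists2 g, 0 < g & g < 1 / 2 - beta + (q / 2 - r) * a.
  have X0 : 0 < 1 / 2 - beta + (q / 2 - r) * a.
    by rewrite [ltRHS](_ : _ = (1 + a * q) / 2 - a * r - beta) ?subr_gt0//; field.
  exists ((1 / 2 - beta + (q / 2 - r) * a) / 2); first by rewrite divr_gt0.
  by rewrite ltr_pdivrMr// ltr_pMr// ltr1n.
apply: powerfulP => [n|e e0]; first exact: measurable_HC.
have lnbig (b : R) : \forall n \near \oo, b <= ln n%:R.
  by have := @ln_nat_cvgy R => /cvgryPge/(_ b).
have rq' : 0 + (r - q) * a < 0.
  by rewrite add0r pmulr_llt0// subr_lt0 -(ltr_pM2l a0).
have q1' : 0 < 1 + - q * a by rewrite mulNr subr_gt0 mulrC.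
near=> n; exists (8 * ln n%:R); split.
  by near: n; exact: (HC_null_vanishes _ (fun n => convn (F th) (k n))).
have n2 : (2 <= n)%N by near: n; exact: nbhs_infty_ge.
have n0 : (0 < n)%N by exact: leq_trans n2.
have L1 : 1 <= ln n%:R :> R by near: n; exact: lnbig.
have Le : 1 - ln e <= ln n%:R by near: n; exact: lnbig.
have Lg : 512 / g ^+ 2 <= ln n%:R by near: n; exact: lnbig.
have rqK : expR (0 * ln n%:R + (r - q) * (k n)%:R) <= 1 / 32.
  by near: n; exact: (expR_lin_small ka).
rewrite mul0r add0r in rqK.
have qK : 0 * ln n%:R <= 1 * ln n%:R + - q * (k n)%:R by near: n; exact: (lin_ge ka).
rewrite mul0r mul1r mulNr subr_ge0 in qK.
have gK : g * ln n%:R <= (1 / 2 - beta) * ln n%:R + (q / 2 - r) * (k n)%:R.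
  by near: n; exact: (lin_ge ka).
have Hw : ((2^-1 * expR (- (k n)%:R * r))%:E <= convn (F th) (k n)
    [set y : R | ((k n)%:R * (s * m - `|s| * d) <= s * y)%R])%E.
  by near: n; exact: far_mass.
set B := [set y : R | ((k n)%:R * (s * m - `|s| * d) <= s * y)%R] in Hw.
have mB : measurable (B : set T).
  apply: (@measurable_set_ler _ T R (cst _) (fun y => s * y)) => //.
  exact: measurable_funM.
have w1 : 2^-1 * expR (- (k n)%:R * r) <= 1.
  by rewrite -lee_fin; apply: le_trans Hw _; exact: probability_le1.
have Gb : (convn (F 0) (k n) B <= (expR (- (k n)%:R * q))%:E)%E.
  have := convn_chernoff expfamF (k n) ((k n)%:R * (s * m - `|s| * d)) (Theta0 (F 0)) Ts.
  rewrite subr0 => /le_trans; apply; rewrite lee_fin ler_expR lpsi0 /q le_eqVlt.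
  by apply/orP; left; apply/eqP; ring.
have eE : (eps n)%:num = expR (- beta * ln n%:R) by rewrite epsE// powR_natE.
have e1 : (eps n)%:num <= 1 by [].
have [t8 v1 nt1 Lv Qp] := small_p_exponents L1 g0 Lg rqK qK gK eE e1 w1.
rewrite -natr_expR_ln// in nt1 Lv.
have t0 : 0 < 2 * expR (- (k n)%:R * q) by rewrite mulr_gt0// expR_gt0.
have t1 : 2 * expR (- (k n)%:R * q) < 1.
  by apply: le_lt_trans t8 _; rewrite ltr_pdivrMr// mul1r ltr1n.
have v0 : 0 <= (eps n)%:num * (2^-1 * expR (- (k n)%:R * r)).
  by rewrite mulr_ge0// mulr_ge0// expR_ge0.
have Qt := obs_law_small_p (eps n) s0 t0 t1 Gb Hw.
rewrite -lee_fin in Qp.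
have mtilt : measurable_fun [set: T]
  (fun y => expR ((0 - th) * y - (k n)%:R * (ps 0 - ps th))) by exact: measurable_tilt.
have := @HC_alternative_tail R (convn (F 0) (k n)) (convn (F th) (k n)) (eps n) _ n _ _
  (64 * ln n%:R) mtilt (fun y => expR_gt0 _)
  (fun g mg g0 => convn_tilt expfamF (k n) Tth (Theta0 (F 0)) mg g0)
  n2 t0 t8 v0 v1 nt1 Lv (le_trans Qp Qt).
have -> : 64 * ln n%:R / 8 = 8 * ln n%:R :> R by field.
have -> : 64 * ln n%:R / 64 = ln n%:R :> R by field.
move=> /le_trans; apply.
rewrite lee_fin -[leRHS]lnK// ler_expR lerBlDr addrC -lerBlDr.
Unshelve. all: by end_near. Qed.

End detectable.

Unset Implicit Arguments.

Theorem theorem1 (R : realType)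
    (F : R -> probability (measurableTypeR R) R)
    (F_expfam : exponential_family F)
    (F0_nondegenerate : forall x : R, F 0 [set x] <> 1%E)
    (a : R) (a_gt0 : 0 < a)
    (k : nat -> nat) (k_gt0 : forall n : nat, (0 < k n)%N)
    (k_log : (k n)%:R / ln (n%:R : R) @[n --> \oo] --> a)
    (beta : R) (beta_gt0 : 0 < beta) (beta_lt1 : beta < 1)
    (theta_minus theta_plus : \bar R)
    (theta_minusP : is_theta_minus (F 0) a theta_minus)
    (theta_plusP : is_theta_plus (F 0) a theta_plus)
    (theta : R) (theta_neq0 : theta != 0)
    (theta_Theta : Theta (F 0) theta)
    (theta_ge : (theta_minus <= theta%:E)%E)
    (theta_le : (theta%:E <= theta_plus)%E)
    (eps : nat -> {i01 R})
    (epsE : forall n : nat, (0 < n)%N -> (eps n)%:num = n%:R `^ (- beta)) :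
  let P0 := fun n => data_law (F 0) (F theta) (k n) n 0%:i01 in
  let P1 := fun n => data_law (F 0) (F theta) (k n) n (eps n) in
  let b := phase_curve (F 0) a theta_minus theta_plus theta in
  ((b < beta%:E)%E ->
     forall S : forall n : nat, n.-tuple (obs R) -> R,
       (forall n : nat, measurable_fun [set: n.-tuple (obs R)] (S n)) ->
       asymptotically_powerless P0 P1 S) /\
  ((beta%:E < b)%E ->
     asymptotically_powerful P0 P1 (fun n => HC (convn (F 0) (k n)) (n := n))).
Proof.
move=> P0 P1 b; split.
- move=> bb S mS.
  have H := phase_curve_lt F0_nondegenerate a_gt0 theta_minusP theta_plusP theta_neq0
    theta_Theta theta_ge theta_le bb.
  exact: (undetectable_powerless F_expfam k_log theta_Theta epsE a_gt0 theta_neq0 H mS).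
- move=> bb.
  have H := phase_curve_gt F0_nondegenerate a_gt0 theta_minusP theta_plusP theta_neq0
    theta_Theta theta_ge theta_le beta_gt0 bb.
  exact: (detectable_powerful F_expfam k_log theta_Theta epsE a_gt0 H).
Qed.
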